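(* Assume that $p\ge2$ is an integer. Then $$\overline\Omega=\Omega\otimes\mathrm{Id}\,\big|_{\mathcal V^{(p)}}:\mathcal V^{(p)}\to\mathcal V^{(p)}_{new}$$ is an isomorphism of $L_{-2+\frac1p}(\mathfrak{sl}(2))$-modules.
   Context: Everything is over $\mathbb C$; $k=-2+\frac1p$. $V_{\widetilde L}$ is the generalized lattice vertex algebra of $\widetilde L=\mathbb Z\frac\gamma2$, $\langle\gamma,\gamma\rangle=2p$. For a vector $v$ write $Y(v,z)=\sum_n v_nz^{-n-1}$, so that $v_0=\int Y(v,z)\,dz$; lattice vertex operators $Y(e^\beta,z)$ are also used for $\beta$ outside the lattice, with values in the corresponding cosets. $\mathcal A^{(p)}=\mathrm{Ker}_{V_{\widetilde L}}\,e^{-\gamma/p}_0$ is the doublet vertex algebra, with Virasoro vector $\omega^{(p)}=\frac1{4p}\gamma(-1)^2+\frac{p-1}{2p}\gamma(-2)$. $\mathcal A^{(p)}_{new}=\mathrm{Ker}_{V_{\widetilde L}}\big(e^{-\gamma/p}_0-\frac1{p-1}e^{\gamma-\gamma/p}_0\big)$, with Virasoro vector $\omega^{(p)}_{new}=\omega^{(p)}+e^\gamma$. On $V_{\widetilde L}$ put $\Omega=\exp[e^\gamma_1]=\sum_{n\ge0}\frac{(e^\gamma_1)^n}{n!}$. $\Pi(0)^{1/2}=M(1)\otimes\mathbb C[\mathbb Z\frac c2]$, where $M(1)$ is the Heisenberg vertex algebra generated by $c,d$ with $\langle c,c\rangle=\langle d,d\rangle=0$, $\langle c,d\rangle=2$;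 $\mu=\frac d2+\frac k4c$, $\nu=\frac d2-\frac k4c$. The simple affine vertex algebra $L_k(\mathfrak{sl}(2))$ maps to $\mathcal A^{(p)}\otimes\Pi(0)^{1/2}$ (resp. $\mathcal A^{(p)}_{new}\otimes\Pi(0)^{1/2}$) by $e\mapsto e^c$, $h\mapsto2\mu(-1)$, $f\mapsto[(k+2)\omega'-\nu(-1)^2-(k+1)\nu(-2)]e^{-c}$ with $\omega'=\omega^{(p)}$ (resp. $\omega'=\omega^{(p)}_{new}$); this gives the $L_k(\mathfrak{sl}(2))$-actions. The screening operator is $S^{(p)}=s^{(p)}_0$, where $s^{(p)}=e^{\frac\gamma{2p}+\nu}$. The vertex algebra $\mathcal V^{(p)}$, known from earlier work, is realized as $\mathcal V^{(p)}=\mathrm{Ker}_{\mathcal A^{(p)}\otimes\Pi(0)^{1/2}}\,S^{(p)}$, and $\mathcal V^{(p)}_{new}$ is defined as $\mathcal V^{(p)}_{new}=\mathrm{Ker}_{\mathcal A^{(p)}_{new}\otimes\Pi(0)^{1/2}}\,S^{(p)}$. *)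

(* Defs.v *)
From HB Require Import structures.
From mathcomp Require Import all_boot all_order all_algebra finmap.
From mathcomp Require Import boolp classical_sets functions cardinality fsbigop.
From mathcomp Require Import monalg.

Set Implicit Arguments.
Unset Strict Implicit.
Unset Printing Implicit Defensive.

Import Order.TTheory GRing.Theory Num.Theory.
Local Open Scope classical_set_scope.
Local Open Scope ring_scope.

(* [\sum_(i \in A) u i] is the sum of a finitely supported family; all infinite
   sums below are finite on each vector. *)

Section Series.
Variables (F : numFieldType) (V : lmodType F).

(* For A(z) = \sum_(i >= 1) A_i z^i with operator coefficients:
   the coefficient of z^m in A(z)^k, respectively in exp(A(z)), applied to v.
   Only k <= m contributes to the latter, as A(z) has no constant term. *)
Fixpoint serpow (A : nat -> V -> V) (k m : nat) (v : V) : V :=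
  if k is k'.+1 then \sum_(1 <= i < m.+1) A i (serpow A k' (m - i) v)
  else if m == 0%N then v else 0.

Definition serexp (A : nat -> V -> V) (m : nat) (v : V) : V :=
  \sum_(k < m.+1) (k`!%:R)^-1 *: serpow A k m v.

(* A field a(z) = \sum_x a_x z^(-x-1), given by its modes x |-> a_x.  Rational
   modes are needed for lattice vertex operators with nonintegral exponents. *)
Definition fieldOn := rat -> V -> V.

Definition binz (n : int) (j : nat) : F :=
  (\prod_(i < j) (n - i%:Z)%:~R) / j`!%:R.

(* The n-th product of fields; Y(a_n b, z) is the n-th product of Y(a, z) and
   Y(b, z). *)
Definition nprod (n : int) (a b : fieldOn) : fieldOn := fun x v =>
  \sum_(j \in [set: nat])
    ((-1) ^+ j * binz n j) *:
      (a (n - j%:Z)%:~R (b (x + j%:R) v)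
       - (-1) ^ n *: b (n%:~R + x - j%:R) (a j%:R v)).

Definition fadd (a b : fieldOn) : fieldOn := fun x v => a x v + b x v.
Definition fscale (t : F) (a : fieldOn) : fieldOn := fun x v => t *: a x v.
Definition fid : fieldOn := fun x v => if x == -1 then v else 0.

Definition expop (X : V -> V) (v : V) : V :=
  \sum_(n \in [set: nat]) (n`!%:R)^-1 *: iter n X v.

End Series.

Section Fock.
Variables (F : numFieldType) (r : nat) (G : 'M[rat]_r).

Definition pair (a b : 'rV[rat]_r) : rat := (a *m G *m b^T) 0 0.

(* The basis of the direct sum of the Fock spaces M(1) (x) e^lambda, for lambda
   in the rational span h of the basis (b_i) with Gram matrix G.  The
   variable (i, n) of the monomial stands for b_i(-n-1).  The lattice Fock
   spaces and the cosets needed below are subspaces of this one. *)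
Definition fkey := ('rV[rat]_r * {cmonom ('I_r * nat)})%type.
Definition fock := {malg F[fkey]}.

Definition linext (K K' : choiceType) (g : K -> {malg F[K']})
  (v : {malg F[K]}) : {malg F[K']} :=
  \sum_(k <- msupp v) v@_k *: g k.

(* The mode h(n), [h(m), h'(n)] = m <h, h'> delta_(m+n,0). *)
Definition hmode (h : 'rV[rat]_r) (n : int) : fock -> fock :=
  linext (fun k : fkey => match n with
    | Posz 0 => ratr (pair h k.1) *: << k >>
    | Posz n'.+1 => \sum_(i < r)
        (n'.+1%:R * ratr (pair h (delta_mx 0 i)) * (k.2 (i, n'))%:R)
          *: << (k.1, divcm k.2 (ucm (i, n'))) >>
    | Negz n' => \sum_(i < r)
        ratr (h 0 i) *: << (k.1, mulcm k.2 (ucm (i, n'))) >>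
    end).

Definition heis (h : 'rV[rat]_r) : fieldOn fock := fun x v =>
  if x \is a Num.int then hmode h (numq x) v else 0.

Definition shift (b : 'rV[rat]_r) : fock -> fock :=
  linext (fun k : fkey => << (k.1 + b, k.2) >>).

(* Y(e^b, z) = e^b z^(b(0)) exp(\sum_(i >= 1) b(-i) z^i / i)
                            exp(- \sum_(i >= 1) b(i) z^(-i) / i),
   with trivial cocycle: e^b e^lambda = e^(b + lambda). *)
Definition vop (b : 'rV[rat]_r) : fieldOn fock := fun x =>
  linext (fun k : fkey =>
    \sum_(st \in [set st : nat * nat |
                   pair b k.1 + st.1%:R - st.2%:R = - x - 1])
      shift b
        (serexp (fun i v => (i%:R)^-1 *: hmode b (- i%:Z) v) st.1
          (serexp (fun i v => - ((i%:R)^-1 *: hmode b i%:Z v)) st.2 << k >>))).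

(* The field of h_1(-n_1) ... h_s(-n_s) e^b. *)
Definition vfield (hs : seq ('rV[rat]_r * nat)) (b : 'rV[rat]_r) :
    fieldOn fock :=
  foldr (fun hn : 'rV[rat]_r * nat => nprod (- hn.2%:Z) (heis hn.1))
    (vop b) hs.

(* The sum of the M(1) (x) e^(n b), n in Z. *)
Definition lattice_fock (b : 'rV[rat]_r) : set fock :=
  [set v | forall k, k \in msupp v -> exists n : int, k.1 = n%:~R *: b].

End Fock.

Section Tensor.
Variables (F : numFieldType) (K1 K2 : choiceType).
Notation V1 := {malg F[K1]}.
Notation V2 := {malg F[K2]}.
Notation T := {malg F[(K1 * K2)%type]}.

(* T is the tensor product of V1 and V2, and [tens u w] is u (x) w. *)
Definition tens (u : V1) (w : V2) : T :=
  \sum_(k1 <- msupp u) \sum_(k2 <- msupp w)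
    (u@_k1 * w@_k2) *: << (k1, k2) >>.

Definition tens_sub (A : set V1) (B : set V2) : set T :=
  [set v | exists2 s : seq (V1 * V2),
     (forall x, x \in s -> A x.1 /\ B x.2) & v = \sum_(x <- s) tens x.1 x.2].

(* f (x) Id *)
Definition tens_id (f : V1 -> V1) : T -> T :=
  linext (fun k : (K1 * K2)%type => tens (f << k.1 >>) << k.2 >>).

(* Y(u (x) w, z) = Y(u, z) (x) Y(w, z) *)
Definition tens_field (a : fieldOn V1) (b : fieldOn V2) : fieldOn T := fun x =>
  linext (fun k : (K1 * K2)%type =>
    \sum_(y \in [set: rat]) tens (a y << k.1 >>) (b (x - 1 - y) << k.2 >>)).

End Tensor.

Section Concrete.
Variables (F : numFieldType) (p : nat).

Definition level : rat := - 2%:R + p%:R^-1.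

Definition gramL : 'M[rat]_1 := (2 * p)%:R%:M.
Definition gamma : 'rV[rat]_1 := const_mx 1.

Definition gramPi : 'M[rat]_2 := \matrix_(i, j) (if i == j then 0 else 2%:R).
Definition c_ : 'rV[rat]_2 := delta_mx 0 0.
Definition d_ : 'rV[rat]_2 := delta_mx 0 1.
Definition mu : 'rV[rat]_2 := 2%:R^-1 *: d_ + (level / 4%:R) *: c_.
Definition nu : 'rV[rat]_2 := 2%:R^-1 *: d_ - (level / 4%:R) *: c_.

Notation VL := (fock F 1).
Notation VPi := (fock F 2).
Notation VT := {malg F[(fkey 1 * fkey 2)%type]}.

Definition eL (t : rat) : fieldOn VL := vop gramL (t *: gamma).

Definition VLtilde : set VL := lattice_fock (2%:R^-1 *: gamma).
Definition PiHalf : set VPi := lattice_fock (2%:R^-1 *: c_).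

Definition doublet : set VL :=
  [set v | VLtilde v /\ eL (- p%:R^-1) 0 v = 0].

Definition doublet_new : set VL :=
  [set v | VLtilde v /\
     eL (- p%:R^-1) 0 v - (p%:R - 1)^-1 *: eL (1 - p%:R^-1) 0 v = 0].

(* The fields of omega^(p) and omega^(p)_new. *)
Definition omega : fieldOn VL :=
  fadd (fscale ((4 * p)%:R)^-1
          (vfield gramL [:: (gamma, 1%N); (gamma, 1%N)] 0))
       (fscale ((p%:R - 1) / (2 * p)%:R) (vfield gramL [:: (gamma, 2%N)] 0)).

Definition omega_new : fieldOn VL := fadd omega (eL 1).

Definition Omega : VL -> VL := expop (eL 1 1).

Definition Omega_bar : VT -> VT := tens_id Omega.

Definition oneL : fieldOn VL := eL 0.

(* The fields of the images of e, h, f; [om] is the field of omega'. *)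
Definition fe : fieldOn VT := tens_field oneL (vop gramPi c_).
Definition fh : fieldOn VT :=
  tens_field oneL (vfield gramPi [:: (2%:R *: mu, 1%N)] 0).
Definition ff (om : fieldOn VL) : fieldOn VT :=
  fadd (fscale (ratr (level + 2%:R)) (tens_field om (vop gramPi (- c_))))
    (fadd
      (fscale (-1)
        (tens_field oneL (vfield gramPi [:: (nu, 1%N); (nu, 1%N)] (- c_))))
      (fscale (- ratr (level + 1))
        (tens_field oneL (vfield gramPi [:: (nu, 2%N)] (- c_))))).

(* [Lk_action a b]: some element of the affine vertex algebra acts by the field
   a when omega' = omega and by the field b when omega' = omega_new.
   The algebra is generated by e, h, f under the n-th products. *)
Inductive Lk_action : fieldOn VT -> fieldOn VT -> Prop :=
  | Lk_vac : Lk_action (@fid F VT) (@fid F VT)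
  | Lk_e : Lk_action fe fe
  | Lk_h : Lk_action fh fh
  | Lk_f : Lk_action (ff omega) (ff omega_new)
  | Lk_add a b a' b' : Lk_action a b -> Lk_action a' b' ->
      Lk_action (fadd a a') (fadd b b')
  | Lk_scale t a b : Lk_action a b -> Lk_action (fscale t a) (fscale t b)
  | Lk_nprod n a b a' b' : Lk_action a b -> Lk_action a' b' ->
      Lk_action (nprod n a a') (nprod n b b').

(* The screening operator s_0, s = e^(gamma/2p + nu). *)
Definition screening : VT -> VT :=
  tens_field (eL ((2 * p)%:R^-1)) (vop gramPi nu) 0.

(* On e^(n gamma/2) (x) e^(m c/2) the powers of z in Y(s, z) lie in
   (n + m)/2 + Z, so s_0 is an operator (the residue of an honest Laurent
   series) only on the span of the sectors with n + m even.  Ker S is taken in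
   that domain: were S declared to be 0 on the remaining sectors, these would
   lie entirely in Ker S, which would not be closed under n-th products, hence
   would not be a vertex algebra. *)
Definition screening_dom : set VT :=
  [set v | forall k, k \in msupp v ->
     pair gramL ((2 * p)%:R^-1 *: gamma) k.1.1 + pair gramPi nu k.2.1
       \is a Num.int].

Definition ker_screening (A : set VL) : set VT :=
  [set v | [/\ tens_sub A PiHalf v, screening_dom v & screening v = 0]].

Definition Vp : set VT := ker_screening doublet.
Definition Vp_new : set VT := ker_screening doublet_new.

Definition submodule (act : fieldOn VT -> Prop) (V : set VT) : Prop :=
  [/\ V 0,
      forall (t : F) u v, V u -> V v -> V (t *: u + v) &
      forall a (n : int) v, act a -> V v -> V (a n%:~R v)].

(* phi : V -> W is an isomorphism of modules, where [act a b] says that one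
   element of the algebra acts by a on V and by b on W. *)
Record module_iso (act : fieldOn VT -> fieldOn VT -> Prop)
    (V W : set VT) (phi : VT -> VT) : Prop := ModuleIso {
  iso_source : submodule (fun a => exists b, act a b) V;
  iso_target : submodule (fun b => exists a, act a b) W;
  iso_bij : set_bij V W phi;
  iso_linear : forall (t : F) u v, V u -> V v ->
    phi (t *: u + v) = t *: phi u + phi v;
  iso_equivariant : forall a b (n : int) v, act a b -> V v ->
    phi (a n%:~R v) = b n%:~R (phi v)
}.

End Concrete.

(* Main.v *)
From HB Require Import structures.
Require Import Defs.
From mathcomp Require Import all_boot all_order all_algebra finmap.
From mathcomp Require Import boolp classical_sets functions cardinality fsbigop.
From mathcomp Require Import monalg reals complex ring lra zify.

(* The operator X = e^gamma_1 is locally nilpotent on V_L~, and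
   [X, omega_y] = e^gamma_y,
   [X, e^(-gamma/p)_0] = - (p - 1)^-1 e^(gamma - gamma/p)_0,
   where X commutes with both right-hand sides.  So exp X intertwines omega and
   omega_new, and maps the kernel of the old screening onto that of the new one.
   As <gamma/2p + nu, gamma> = 1, X (x) Id anticommutes with S = s_0, whence
   Omega (x) Id preserves Ker S, with inverse exp(- X) (x) Id.

   Ker S is stable under the action: the modes of e anticommute with S and those
   of h commute with S.  For f put b = gamma/2p + nu and B = :b e^(-c):.  Then
     f = :u B: + (1 - 1/p) dB,  u = gamma/2p - nu + (1 - 1/p) c,  <u, b> = 0,
   and B_y is the commutator of S with the mode y of e^(- b - c).  Since
   S^2 = 0, the modes of B, hence those of f, anticommute with S.

   Every field of the algebra is obtained from e, h, f by n-th products, so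
   equivariance need only be checked on these three. *)

Set Implicit Arguments.
Unset Strict Implicit.
Unset Printing Implicit Defensive.

Import Order.TTheory GRing.Theory Num.Theory.
Local Open Scope classical_set_scope.
Local Open Scope ring_scope.

(** * Linear maps between free modules *)

(** The obstacle is the commutators of vertex operators: they are needed on both Fock spaces and on
    the tensor product, with rational modes. All three are instances of one record [fockSpace], and
    commutators of two vertex operators are proved by [fock_uniq] rather than by calculus in two
    formal variables: Heisenberg modes carry the difference of the two sides to differences of the
    same kind, so only vacuum coefficients remain, and these come from (z - w)^<a,b>. Only <a,b> >=
    0 and <a,b> = -2 occur. The pair u, B comes from a difference of squares. With g = gamma/2p and
    k + 2 = 1/p, the gamma part of (k + 2) omega is g(-1)^2 + (1 - 1/p) g(-2), and -(k + 1) = 1 -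
    1/p is also the coefficient of nu(-2). So f is (g(-1)^2 - nu(-1)^2 + (1 - 1/p) b(-2)) e^(-c)
    with b = g + nu, and b(-1) splits off. As <b, - b - c> = -2, the double pole of S with e^(- b -
    c) leaves B. The screenings leave V_L~, where the nilpotence of X is known; on their targets
    only powers of X are used, never its exponential. *)

Section LinearMaps.
Variable F : numFieldType.

Definition lin (V W : lmodType F) (f : V -> W) :=
  forall t u v, f (t *: u + v) = t *: f u + f v.

Section Lin.
Variables (V W : lmodType F) (f : V -> W).
Hypothesis f_lin : lin f.

Lemma linD u v : f (u + v) = f u + f v.
Proof. by rewrite -[u in LHS]scale1r f_lin scale1r. Qed.
Lemma lin0 : f 0 = 0.
Proof. by apply: (addrI (f 0)); rewrite -linD !addr0. Qed.
Lemma linZ t u : f (t *: u) = t *: f u.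
Proof. by rewrite -[t *: u]addr0 f_lin lin0 addr0. Qed.
Lemma linN u : f (- u) = - f u.
Proof. by rewrite -scaleN1r linZ scaleN1r. Qed.
Lemma linB u v : f (u - v) = f u - f v.
Proof. by rewrite linD linN. Qed.
Lemma lin_sum (I : Type) (s : seq I) (P : pred I) (u : I -> V) :
  f (\sum_(i <- s | P i) u i) = \sum_(i <- s | P i) f (u i).
Proof. by apply: (big_morph _ linD lin0). Qed.
(** Finite support is essential: an infinitely supported sum has the default value 0, while [f] may
    kill almost all of its terms. *)
Lemma lin_fsum (I : choiceType) (A : set I) (u : I -> V) :
    finite_set (A `&` [set i | u i != 0]) ->
  f (\sum_(i \in A) u i) = \sum_(i \in A) f (u i).
Proof.
move=> Afin; rewrite [in LHS]fsbig_supp.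
have -> : A `&` u @^-1` [set~ 0] = A `&` [set i | u i != 0].
  by apply/seteqP; split=> i [Ai /eqP ui]; split.
rewrite fsbig_finite// lin_sum -fsbig_finite//.
apply: fsbig_widen => [i []//|i [Ai /not_andP[//|/negP/negPn/eqP /= ->]]].
exact: lin0.
Qed.
End Lin.

Lemma lin_id (V : lmodType F) : lin (@id V). Proof. by []. Qed.
Lemma lin_zero (V W : lmodType F) : lin (fun _ : V => 0 : W).
Proof. by move=> t u v; rewrite scaler0 addr0. Qed.
Lemma lin_add (V W : lmodType F) (f g : V -> W) :
  lin f -> lin g -> lin (fun v => f v + g v).
Proof. by move=> lf lg t u v; rewrite lf lg scalerDr addrACA. Qed.
Lemma lin_scale (V W : lmodType F) s (f : V -> W) :
  lin f -> lin (fun v => s *: f v).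
Proof. by move=> lf t u v; rewrite lf scalerDr !scalerA mulrC. Qed.
Lemma lin_opp (V W : lmodType F) (f : V -> W) :
  lin f -> lin (fun v => - f v).
Proof. by move=> lf t u v; rewrite lf opprD scalerN. Qed.
Lemma lin_comp (U V W : lmodType F) (f : V -> W) (g : U -> V) :
  lin f -> lin g -> lin (fun v => f (g v)).
Proof. by move=> lf lg t u v; rewrite lg lf. Qed.
Lemma lin_bigsum (V W : lmodType F) I (s : seq I) (P : pred I) (f : I -> V -> W) :
  (forall i, lin (f i)) -> lin (fun v => \sum_(i <- s | P i) f i v).
Proof.
move=> lf t u v; rewrite scaler_sumr -big_split; apply: eq_bigr => i _.
exact: lf.
Qed.

End LinearMaps.

Section FreeModule.
Variable F : numFieldType.

Section OneKey.
Variable K : choiceType.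
Implicit Types v : {malg F[K]}.

Lemma malg_sum v : v = \sum_(k <- msupp v) v@_k *: << k >>.
Proof.
rewrite {1}(monalgE v); apply: eq_bigr => k _; apply/malgP => k'.
by rewrite mcoeffZ !mcoeffU mulrnAr mulr1.
Qed.

(** Lets several vectors be expanded over one common finite set of keys, which is how additivity of
    [linext] is obtained. *)
Lemma linext_msuppw (V : lmodType F) (g : K -> V) v (A : {fset K}) :
  (msupp v `<=` A)%fset ->
  \sum_(k <- msupp v) v@_k *: g k = \sum_(k <- A) v@_k *: g k.
Proof.
move=> vA; rewrite (big_fset_incl _ vA)// => k _ kv.
by rewrite mcoeff_outdom ?scale0r.
Qed.

Lemma linext_lin (K' : choiceType) (g : K -> {malg F[K']}) : lin (linext g).
Proof.
move=> t u v; rewrite /linext.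
pose A := (msupp u `|` msupp v)%fset.
have uvA : (msupp (t *: u + v) `<=` A)%fset.
  apply: (fsubset_trans (msuppD_le _ _)); apply: fsetUSS => //.
  exact: msuppZ_le.
rewrite (linext_msuppw _ uvA) (@linext_msuppw _ g u A) ?fsubsetUl//.
rewrite (@linext_msuppw _ g v A) ?fsubsetUr// scaler_sumr -big_split.
apply: eq_bigr => k _.
by rewrite mcoeffD mcoeffZ scalerDl scalerA.
Qed.

Lemma linextE (K' : choiceType) (g : K -> {malg F[K']}) k :
  linext g << k >> = g k.
Proof.
by rewrite /linext msuppU oner_eq0 big_seq_fset1 mcoeffUU scale1r.
Qed.

Lemma lin_eq (V : lmodType F) (f g : {malg F[K]} -> V) v :
  lin f -> lin g -> (forall k, k \in msupp v -> f << k >> = g << k >>) ->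
  f v = g v.
Proof.
move=> lf lg fg; rewrite (malg_sum v) (lin_sum lf) (lin_sum lg).
rewrite big_seq_cond [RHS]big_seq_cond; apply: eq_bigr => k /andP[kv _].
by rewrite (linZ lf) (linZ lg) fg.
Qed.

Lemma msupp1 (k : K) : msupp (<< k >> : {malg F[K]}) = [fset k]%fset.
Proof. by rewrite msuppU oner_eq0. Qed.

(** One predicate serves for homogeneous components, charge sectors, the lattice V_L~ and the domain
    of the screening operator. *)
Definition keyed (P : set K) v := forall k, k \in msupp v -> P k.

Lemma keyed0 P : keyed P 0.
Proof. by move=> k; rewrite msupp0. Qed.
Lemma keyedD P u v : keyed P u -> keyed P v -> keyed P (u + v).
Proof.
by move=> Pu Pv k /(fsubsetP (msuppD_le _ _)); rewrite in_fsetU => /orP[/Pu|/Pv].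
Qed.
Lemma keyedZ P t v : keyed P v -> keyed P (t *: v).
Proof. by move=> Pv k /(fsubsetP (msuppZ_le _ _)) /Pv. Qed.
Lemma keyedN P v : keyed P v -> keyed P (- v).
Proof. by rewrite -scaleN1r; exact: keyedZ. Qed.
Lemma keyed_sum P I (s : seq I) (Q : pred I) u :
  (forall i, Q i -> keyed P (u i)) -> keyed P (\sum_(i <- s | Q i) u i).
Proof.
by move=> Pu; apply: big_ind => //; [exact: keyed0|exact: keyedD].
Qed.
Lemma keyed_fsum P (I : choiceType) (A : set I) u :
  (forall i, A i -> keyed P (u i)) -> keyed P (\sum_(i \in A) u i).
Proof.
move=> Pu; rewrite big_seq_cond; apply: keyed_sum => i /andP[+ _].
by case: finite_supportP => // X XA _ _ iX; apply: Pu; exact: XA.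
Qed.
Lemma keyed1 (P : set K) k : P k -> keyed P << k >>.
Proof. by move=> Pk k'; rewrite msupp1 inE => /eqP ->. Qed.
Lemma keyedW (P Q : set K) v : P `<=` Q -> keyed P v -> keyed Q v.
Proof. by move=> PQ Pv k /Pv /PQ. Qed.
Lemma keyed_false v : keyed set0 v -> v = 0.
Proof.
move=> v0; rewrite (malg_sum v) big_seq_cond big1// => k /andP[/v0[]].
Qed.

End OneKey.

Lemma keyed_lin (K K' : choiceType) (P : set K) (Q : set K') (f : {malg F[K]} -> {malg F[K']}) v :
  lin f -> (forall k, P k -> keyed Q (f << k >>)) -> keyed P v -> keyed Q (f v).
Proof.
move=> lf PQ Pv; rewrite (malg_sum v) (lin_sum lf) big_seq_cond.
apply: keyed_sum => k /andP[/Pv/PQ kv _]; rewrite (linZ lf); exact: keyedZ.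
Qed.
End FreeModule.

Section Coefficients.
Variables (F : numFieldType) (K : choiceType) (k : K).
Implicit Types u v : {malg F[K]}.

Lemma coefD_eq u v s t : u@_k = s -> v@_k = t -> (u + v)@_k = s + t.
Proof. by move=> <- <-; rewrite mcoeffD. Qed.
Lemma coefN_eq u s : u@_k = s -> (- u)@_k = - s.
Proof. by move=> <-; rewrite mcoeffN. Qed.
Lemma coefZ_eq t u s : u@_k = s -> (t *: u)@_k = t * s.
Proof. by move=> <-; rewrite mcoeffZ. Qed.

End Coefficients.

(** Builds, by recursion on the syntax of [v], a proof that its coefficient at [k] is a ring
    expression in the coefficients of the atoms, so that [ring] sees field elements only. *)
Ltac coef_eq k v :=
  lazymatch v with
  | (@GRing.add _ ?a ?b) =>
      let pa := coef_eq k a in let pb := coef_eq k b in open_constr:(coefD_eq pa pb)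
  | (@GRing.opp _ ?a) => let pa := coef_eq k a in open_constr:(coefN_eq pa)
  | (@GRing.scale _ _ ?t ?a) => let pa := coef_eq k a in open_constr:(coefZ_eq t pa)
  | (@GRing.zero _) => open_constr:(@mcoeff0 _ _ k)
  | _ => constr:(erefl (mcoeff k v))
  end.

(* Linear identities between vectors, checked coefficient by coefficient. *)
Ltac malg_ring :=
  let k := fresh "k" in apply/malgP => k;
  lazymatch goal with |- mcoeff _ ?u = mcoeff _ ?v =>
    let pu := coef_eq k u in let pv := coef_eq k v in
    refine (etrans pu (etrans _ (esym pv))) end;
  ring.

(** * Series that are finite on each vector *)

Section FiniteSums.
Variables (F : numFieldType) (V : lmodType F).
Implicit Types (u : nat -> V) (s : V).

(** Eventually constant partial sums, unlike supports, pass through linear maps, sums and index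
    shifts, and the value is unique. Identities between series thus reduce to identities between
    terms. *)
Definition sumsto u s :=
  exists M0, forall M, (M0 <= M)%N -> \sum_(j < M) u j = s.

Lemma sumsto_fsum u s : sumsto u s -> \sum_(j \in [set: nat]) u j = s.
Proof.
move=> [M0 us]; rewrite -(us M0 (leqnn _)).
(* Two consecutive equal partial sums force the term between them to vanish. *)
have u0 j : (M0 <= j)%N -> u j = 0.
  move=> Mj; have := us j.+1 (leqW Mj); rewrite big_ord_recr /= us//.
  by move=> /(canRL (addKr _)); rewrite addNr.
rewrite fsbig_ord; apply/esym/fsbig_widen => // j [_ /= /negP].
by rewrite -leqNgt => /u0.
Qed.

Lemma sumsto_bound u M0 :
  (forall j, (M0 <= j)%N -> u j = 0) -> sumsto u (\sum_(j < M0) u j).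
Proof.
move=> u0; exists M0 => M MM.
rewrite -(subnKC MM) big_split_ord /= [X in _ + X]big1 ?addr0// => i _.
by rewrite u0// leq_addr.
Qed.

Lemma sumsto_fsumP u : (exists M0, forall j, (M0 <= j)%N -> u j = 0) ->
  sumsto u (\sum_(j \in [set: nat]) u j).
Proof.
by move=> [M0 /sumsto_bound us]; rewrite (sumsto_fsum us).
Qed.

Lemma sumsto_uniq u s s' : sumsto u s -> sumsto u s' -> s = s'.
Proof. by move=> /sumsto_fsum <- /sumsto_fsum <-. Qed.

Lemma eq_sumsto u u' s : u =1 u' -> sumsto u s -> sumsto u' s.
Proof.
move=> uu [M0 us]; exists M0 => M MM; rewrite -(us M MM).
by apply: eq_bigr => j _; rewrite uu.
Qed.

Lemma sumstoD u u' s s' :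
  sumsto u s -> sumsto u' s' -> sumsto (fun j => u j + u' j) (s + s').
Proof.
move=> [M us] [M' us']; exists (maxn M M') => N; rewrite geq_max => /andP[MN MN'].
by rewrite big_split /= us// us'.
Qed.

Lemma sumstoZ t u s : sumsto u s -> sumsto (fun j => t *: u j) (t *: s).
Proof. by move=> [M us]; exists M => N MN; rewrite -scaler_sumr us. Qed.

Lemma sumstoN u s : sumsto u s -> sumsto (fun j => - u j) (- s).
Proof. by move=> [M us]; exists M => N MN; rewrite sumrN us. Qed.

Lemma sumstoB u u' s s' :
  sumsto u s -> sumsto u' s' -> sumsto (fun j => u j - u' j) (s - s').
Proof. by move=> us us'; apply: sumstoD => //; apply: sumstoN. Qed.

Lemma sumsto1 i (v : V) : sumsto (fun j => if j == i then v else 0) v.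
Proof.
exists i.+1 => M iM; rewrite -big_mkcond /= (big_pred1 (Ordinal iM))// => j.
Qed.

Lemma sumsto0 : sumsto (fun=> 0) 0.
Proof. by exists 0%N => M _; rewrite big1. Qed.

Lemma sumstoS u s : sumsto (fun j => u j.+1) s <-> sumsto u (u 0%N + s).
Proof.
split=> -[M us].
  by exists M.+1 => -[//|N] MN; rewrite big_ord_recl /= us.
exists M => N MN; have := us N.+1 (leqW MN); rewrite big_ord_recl /=.
exact: addrI.
Qed.

Lemma sumsto_delay d u s : sumsto u s ->
  sumsto (fun t => if (d <= t)%N then u (t - d)%N else 0) s.
Proof.
move=> us; elim: d => [|d IH]; first by apply: eq_sumsto us => t; rewrite subn0.
by rewrite -[s]add0r; apply/(@sumstoS (fun t => if (d < t)%N then u (t - d.+1)%N else 0)).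
Qed.

End FiniteSums.

Lemma sumsto_lin (F : numFieldType) (V W : lmodType F) (f : V -> W) u s :
  lin f -> sumsto u s -> sumsto (fun j => f (u j)) (f s).
Proof. by move=> lf [M us]; exists M => N MN; rewrite -(lin_sum lf) us. Qed.

(** * Fock spaces *)

(* A Fock space and a tensor product of two of them are both instances, so that
   fields on the tensor product are handled by the same lemmas.  [fkeys] is a
   basis, graded by the charge [ch] and the degree [dg]; [hm h n] is h(n). *)
Record fockSpace (F : numFieldType) := FockSpace {
  fkeys : choiceType;
  charges : lmodType rat;
  pr : charges -> charges -> rat;
  ch : fkeys -> charges;
  dg : fkeys -> nat;
  vac : charges -> fkeys;
  hm : charges -> int -> {malg F[fkeys]} -> {malg F[fkeys]};
  prC : forall a b, pr a b = pr b a;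
  pr_linear : forall t a b c, pr (t *: a + b) c = t * pr a c + pr b c;
  ch_vac : forall l, ch (vac l) = l;
  dg_vac : forall l, dg (vac l) = 0%N;
  dg0_vac : forall k, dg k = 0%N -> k = vac (ch k);
  hm_lin : forall h n, lin (hm h n);
  hm_linear : forall t h h' n v, hm (t *: h + h') n v = ratr t *: hm h n v + hm h' n v;
  hm_hom : forall h n k, keyed [set k' | ch k' = ch k /\ (dg k')%:Z = (dg k)%:Z - n]
    (hm h n << k >>);
  hm0 : forall h k, hm h 0 << k >> = ratr (pr h (ch k)) *: << k >>;
  hm_comm : forall h h' m n v, hm h m (hm h' n v) =
    hm h' n (hm h m v) + (if m + n == 0 then ratr (m%:~R * pr h h') else 0) *: v;
  hm_gen : forall k, dg k != 0%N -> exists h n k', [/\ << k >> = hm h (Negz n) << k' >>,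
    ch k' = ch k & (dg k' < dg k)%N];
  hm_nondeg : forall v, (forall h n, hm h (Posz n.+1) v = 0) -> keyed [set k | dg k = 0%N] v
}.

Section FockTheory.
Variables (F : numFieldType) (S : fockSpace F).
Local Notation L := (charges S).
Local Notation V := {malg F[fkeys S]}.
Local Notation "<[ a , b ]>" := (@pr F S a b).
Implicit Types (h a b l : L) (n m : int) (x y q : rat) (X Y Z : fieldOn V) (v : V).

Lemma prDl a b c : <[a + b, c]> = <[a, c]> + <[b, c]>.
Proof. by rewrite -[a in LHS]scale1r pr_linear mul1r. Qed.
Lemma pr0l c : <[0, c]> = 0.
Proof. by apply: (addrI <[0, c]>); rewrite -prDl !addr0. Qed.
Lemma prZl t a c : <[t *: a, c]> = t * <[a, c]>.
Proof. by rewrite -[t *: a]addr0 pr_linear pr0l addr0. Qed.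
Lemma prNl a c : <[- a, c]> = - <[a, c]>.
Proof. by rewrite -scaleN1r prZl mulN1r. Qed.
Lemma prDr a b c : <[c, a + b]> = <[c, a]> + <[c, b]>.
Proof. by rewrite prC prDl !(prC _ c). Qed.
Lemma pr0r c : <[c, 0]> = 0. Proof. by rewrite prC pr0l. Qed.
Lemma prZr t a c : <[c, t *: a]> = t * <[c, a]>.
Proof. by rewrite prC prZl !(prC _ c). Qed.
Lemma prNr a c : <[c, - a]> = - <[c, a]>.
Proof. by rewrite prC prNl prC. Qed.

Lemma hmDl h h' n v : hm (h + h') n v = hm h n v + hm h' n v.
Proof. by rewrite -[h in LHS]scale1r hm_linear rmorph1 scale1r. Qed.
Lemma hm0l n v : hm (0 : L) n v = 0.
Proof. by apply: (addrI (hm (0 : L) n v)); rewrite -hmDl !addr0. Qed.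

(** The degree is rational because mode indices and pairings are. A nonzero vector then forces it to
    be a natural number ([hsp_nat]), which is the source of all truncation and integrality
    statements. *)
Definition hsp l q : V -> Prop := keyed [set k | ch k = l /\ (dg k)%:R = q].

Lemma hsp_key (k : fkeys S) : hsp (ch k) (dg k)%:R << k >>.
Proof. exact: keyed1. Qed.
Lemma hsp_vac l : hsp l 0 << vac l >>.
Proof. by apply: keyed1; rewrite /= ch_vac dg_vac. Qed.

Arguments hsp_key k : clear implicits.
Arguments hsp_vac l : clear implicits.

Lemma hsp_eq0 l q v : hsp l q v -> q < 0 -> v = 0.
Proof.
move=> vq q0; apply: keyed_false => k /vq /= [_ kq].
by move: q0; rewrite -kq ltNge ler0n.
Qed.

Lemma hsp_nat l q v : hsp l q v -> v != 0 -> exists d : nat, q = d%:R.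
Proof.
move=> vq v0; have [k kv] : exists k, k \in msupp v.
  apply: contrapT => nk; move/eqP: v0; apply; apply: keyed_false => k kv.
  by apply: nk; exists k.
by exists (dg k); case: (vq k kv).
Qed.

Lemma hm_hsp h n l q v : hsp l q v -> hsp l (q - n%:~R) (hm h n v).
Proof.
apply: keyed_lin; first exact: hm_lin.
move=> k /= [<- <-]; apply: (keyedW _ (@hm_hom F S h n k)) => k' /= [-> e].
by split=> //; rewrite -[(dg k')%:R]/((dg k')%:Z%:~R) e rmorphB.
Qed.

Arguments hm_hsp h n {l q v} _.

Lemma hm0_ch h l v : keyed [set k | ch k = l] v -> hm h 0 v = ratr <[h, l]> *: v.
Proof.
move=> vl; apply: (lin_eq (@hm_lin F S _ _) (lin_scale _ (@lin_id _ _))) => k /vl /= <-.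
exact: hm0.
Qed.

Lemma hsp_ch l q v : hsp l q v -> keyed [set k | ch k = l] v.
Proof. by apply: keyedW => k [<-]. Qed.

Lemma hm_vac h n l : (0 < n) -> hm h n << vac l >> = 0.
Proof.
move=> n0; have vl := hm_hsp h n (hsp_vac l); apply: (hsp_eq0 vl).
by rewrite sub0r oppr_lt0 ltr0z.
Qed.

Lemma hsp0_vac l v : hsp l 0 v -> v = v@_(vac l) *: << vac l >>.
Proof.
move=> vl; rewrite {1}(malg_sum v).
have vE : (msupp v `<=` [fset vac l])%fset.
  apply/fsubsetP => k /vl /= [kl k0]; rewrite inE -kl; apply/eqP/dg0_vac.
  by apply/eqP; rewrite -(eqr_nat rat) k0.
by rewrite (linext_msuppw _ vE) big_seq_fset1.
Qed.

Lemma hsp_vac0 l q v l' : hsp l q v -> q != 0 -> v@_(vac l') = 0.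
Proof.
move=> vq q0; apply: mcoeff_outdom; apply/negP => /vq /= [_].
by rewrite dg_vac => e; rewrite -e eqxx in q0.
Qed.

(* Creation modes generate the Fock space from the vacuum vectors, and a vector
   of positive degree is not killed by all annihilation modes; hence operators
   are determined by their commutators with the Heisenberg modes and by their
   vacuum coefficients. *)
Lemma fock_uniq (J : Type) (l l' : L) (nu : J -> rat) (D : J -> V -> V) :
    (forall j, lin (D j)) ->
    (forall j q v, hsp l q v -> hsp l' (q + nu j) (D j v)) ->
    (forall j h n q v, hsp l q v ->
      (forall j', nu j' = nu j - n%:~R -> D j' v = 0) ->
      hm h n (D j v) = D j (hm h n v)) ->
    (forall j, nu j = 0 -> (D j << vac l >>)@_(vac l') = 0) ->
  forall j v, keyed [set k | ch k = l] v -> D j v = 0.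
Proof.
(* [Dcov] may assume that the operators of the shifted index already vanish on [v]: in the
   applications these are exactly the terms produced by commuting with h(n). *)
move=> Dlin Dhom Dcov Dvac.
have Dv d : forall j, nu j = d%:R -> D j << vac l >> = 0.
  have [M dM] := ubnP d; elim: M d dM => // M IHM d dM j nuj.
  have Dj := Dhom j 0 _ (hsp_vac l); rewrite add0r nuj in Dj.
  have : keyed [set k | dg k = 0%N] (D j << vac l >>).
    apply: hm_nondeg => h n.
    rewrite (Dcov _ _ _ 0) ?hm_vac ?lin0//; first exact: hsp_vac.
    move=> j' nuj'; case: (ltnP d n.+1) => dn.
      apply: (hsp_eq0 (Dhom j' 0 _ (hsp_vac l))).
      by rewrite nuj' nuj add0r subr_lt0 ltr_nat.
    apply: (IHM (d - n.+1)%N); first by lia.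
    by rewrite nuj' nuj natrB.
  (* All annihilation modes kill the vector, so it has degree 0. For d > 0 it is also of degree d,
     hence zero; for d = 0 the vacuum coefficient decides. *)
  move=> D0; have [d0|d0] := eqVneq d 0%N.
    rewrite d0 in Dj nuj; rewrite (hsp0_vac Dj) Dvac ?scale0r//.
  apply: keyed_false => k kD; have := D0 k kD; have [_] /= := Dj k kD.
  by move=> /eqP; rewrite eqr_nat => /eqP -> /eqP; rewrite (negPf d0).
have Dvac0 j : D j << vac l >> = 0.
  have [//|D0] := eqVneq (D j << vac l >>) 0.
  have [d] := hsp_nat (Dhom j 0 _ (hsp_vac l)) D0; rewrite add0r; exact: Dv.
(* Induction on the degree of the argument, for all indices at once: a creation mode is split off
   and the shifted operators act on the smaller vector k'. *)
have Dk d : forall j k, ch k = l -> (dg k < d)%N -> D j << k >> = 0.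
  elim: d => // d IHd j k kl kd.
  have [k0|k0] := eqVneq (dg k) 0%N; first by rewrite (dg0_vac k0) kl.
  have [h [n [k' [-> k'l k'd]]]] := hm_gen k0.
  have k'0 j' : D j' << k' >> = 0 by apply: IHd; rewrite ?k'l//; lia.
  rewrite -(Dcov _ _ _ (dg k')%:R) ?k'0 ?(lin0 (@hm_lin F S _ _))//.
  by rewrite -kl -k'l; exact: hsp_key.
move=> j v vl; rewrite -(lin0 (@lin_zero F V V)).
apply: (@lin_eq _ _ _ _ (fun=> 0)) => // [|k /vl kl]; first exact: lin_zero.
exact: (Dk (dg k).+1).
Qed.

Definition heisF h : fieldOn V := fun x v =>
  if x \is a Num.int then hm h (numq x) v else 0.

Lemma heisF_int h n v : heisF h n%:~R v = hm h n v.
Proof. by rewrite /heisF intr_int numq_int. Qed.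

Lemma heisF_nat h (j : nat) v : heisF h j%:R v = hm h j v.
Proof. exact: (heisF_int h j v). Qed.

(** The term -<b,l> appears because the degree counts oscillators only, not the charge. The number d
    is -1 for e^b and 0 for a Heisenberg current, and an n-th product with a current subtracts n. *)
Record hfield b (d : rat) X : Prop := HField {
  hf_lin : forall x, lin (X x);
  hf_hom : forall l q v x, hsp l q v -> hsp (l + b) (q - x - <[b, l]> + d) (X x v)
}.

Lemma natr_gt (r : rat) : exists N : nat, r < N%:R.
Proof.
by exists (Num.bound `|r|); rewrite (le_lt_trans (ler_norm r))// archi_boundP.
Qed.

Lemma hf_trunc b d X : hfield b d X ->
  forall v x, exists M : nat, forall j, (M <= j)%N -> X (x + j%:R) v = 0.
Proof.
move=> [Xl Xh] v x; rewrite (malg_sum v).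
elim/big_ind : _ => [|u w [M uM] [M' wM']|k _].
- by exists 0%N => j _; rewrite lin0.
- exists (maxn M M') => j; rewrite geq_max => /andP[Mj M'j].
  by rewrite linD// uM// wM'// addr0.
- have [N rN] := natr_gt ((dg k)%:R - x - <[b, ch k]> + d).
  exists N => j Nj; rewrite linZ//.
  rewrite (hsp_eq0 (Xh _ _ _ (x + j%:R) (hsp_key k))) ?scaler0//.
  move: Nj; rewrite -(ler_nat rat); lra.
Qed.

Lemma hf_ch b d X l v x : hfield b d X -> keyed [set k | ch k = l] v ->
  keyed [set k | ch k = l + b] (X x v).
Proof.
move=> [Xl Xh]; apply: keyed_lin => // k /= kl.
by apply: hsp_ch; rewrite -kl; apply: Xh (hsp_key k).
Qed.

Lemma hm_trunc h v : exists M : nat, forall j, (M <= j)%N -> hm h j%:Z v = 0.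
Proof.
rewrite (malg_sum v).
elim/big_ind : _ => [|u w [M uM] [M' wM']|k _].
- by exists 0%N => j _; rewrite (lin0 (@hm_lin F S _ _)).
- exists (maxn M M') => j; rewrite geq_max => /andP[Mj M'j].
  by rewrite (linD (@hm_lin F S _ _)) uM// wM'// addr0.
- exists (dg k).+1 => j kj; rewrite (linZ (@hm_lin F S _ _)).
  rewrite (hsp_eq0 (hm_hsp h j%:Z (hsp_key k))) ?scaler0//.
  by rewrite subr_lt0 ltr_nat.
Qed.

Definition nprod_term n h X x v (j : nat) : V :=
  ((-1) ^+ j * binz F n j) *:
    (hm h (n - j%:Z) (X (x + j%:R) v)
     - (-1) ^ n *: X (n%:~R + x - j%:R) (hm h j v)).

(** Both halves of a term vanish for large j: X truncates on v, and h(j) annihilates v. *)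
Lemma nprodP b d X n h x v : hfield b d X ->
  sumsto (nprod_term n h X x v) (nprod n (heisF h) X x v).
Proof.
move=> Xf; have -> : nprod n (heisF h) X x v = \sum_(j \in [set: nat]) nprod_term n h X x v j.
  by apply: eq_fsbigr => j _; rewrite heisF_int heisF_nat.
apply: sumsto_fsumP.
have [M XM] := hf_trunc Xf v x; have [M' hM] := hm_trunc h v.
exists (maxn M M') => j; rewrite geq_max => /andP[Mj M'j].
rewrite /nprod_term XM// hM// (lin0 (@hm_lin F S _ _)) (lin0 (hf_lin Xf _)).
by rewrite scaler0 subr0 scaler0.
Qed.

Lemma nprod_term_lin b d X n h x j : hfield b d X ->
  lin (fun v => nprod_term n h X x v j).
Proof.
move=> [Xl Xh]; apply: lin_scale; apply: lin_add; first exact: lin_comp (hm_lin _ _) _.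
apply: lin_opp; apply: lin_scale; exact: lin_comp _ (hm_lin _ _).
Qed.

Lemma nprod_hfield b d X n h : hfield b d X -> hfield b (d - n%:~R) (nprod n (heisF h) X).
Proof.
move=> Xf; have [Xl Xh] := Xf; split.
  move=> x t u v; apply: sumsto_uniq (nprodP n h x (t *: u + v) Xf) _.
  have := sumstoD (sumstoZ t (nprodP n h x u Xf)) (nprodP n h x v Xf).
  by apply: eq_sumsto => j; rewrite (nprod_term_lin n h x j Xf).
move=> l q v x vq; rewrite /nprod; apply: keyed_fsum => j _.
apply: keyedZ; rewrite heisF_int heisF_nat; apply: keyedD.
  have := hm_hsp h (n - j%:Z) (Xh _ _ _ (x + j%:R) vq).
  apply: keyedW => k /= [-> ->]; split=> //.
  by rewrite rmorphB /=; ring.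
apply: keyedN; apply: keyedZ.
have := Xh _ _ _ (n%:~R + x - j%:R) (hm_hsp h j vq).
by apply: keyedW => k /= [-> ->]; split=> //; ring.
Qed.

End FockTheory.
Arguments hm_hsp {F S} h n {l q v} _.
Arguments hsp_key {F S} k.
Arguments hsp_vac {F S} l.
Arguments hf_hom {F S b d X} _ {l q v} x _.

(** * Normally ordered products *)

(** Locked so that nested normally ordered products are not unfolded into double series. *)
HB.lock Definition nop (F : numFieldType) (S : fockSpace F) (h : charges S)
    (X : fieldOn {malg F[fkeys S]}) : fieldOn {malg F[fkeys S]} :=
  nprod (-1) (heisF h) X.

Section NormalOrder.
Variables (F : numFieldType) (S : fockSpace F).
Local Notation L := (charges S).
Local Notation V := {malg F[fkeys S]}.
Local Notation "<[ a , b ]>" := (@pr F S a b).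
Implicit Types (h a b l : L) (n m : int) (x y q : rat) (X Y Z : fieldOn V) (v : V).

Lemma hspE l q q' v : q = q' -> hsp l q v -> hsp l q' v.
Proof. by move=> ->. Qed.
Arguments hspE {l} q {q' v} _ _.

Lemma charge_decomp (W : lmodType F) (D : V -> W) :
  lin D -> (forall l v, keyed [set k | ch k = l] v -> D v = 0) -> forall v, D v = 0.
Proof.
move=> Dl D0 v; apply: (@lin_eq _ _ _ D (fun=> 0)) => // [|k _]; first exact: lin_zero.
by apply: (D0 (ch k)); apply: keyed1.
Qed.

(** The relation [h(n), X_x] = <h,b> X_(x+n) of a field that is primary of charge b for the
    Heisenberg algebra. *)
Definition covariant b X := forall h n x v,
  hm h n (X x v) = X x (hm h n v) + ratr <[h, b]> *: X (x + n%:~R) v.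

Lemma nopE h X : nop h X = nprod (-1) (heisF h) X.
Proof. by rewrite unlock. Qed.

(** The binomial coefficient of -1 over j is (-1)^j, so all signs cancel and the usual normal
    ordering is left. *)
Lemma nprod_term1 h X x v j :
  nprod_term (-1) h X x v j = hm h (-1 - j%:Z) (X (x + j%:R) v) + X (x - 1 - j%:R) (hm h j v).
Proof.
rewrite /nprod_term; have -> : (-1) ^+ j * binz F (-1) j = 1.
  rewrite /binz; have -> : \prod_(i < j) ((- 1 - i%:Z)%:~R : F) = (-1) ^+ j * j`!%:R.
    elim: j => [|j IH]; first by rewrite big_ord0 expr0 mulr1.
    rewrite big_ord_recr /= IH factS natrM exprS rmorphB /= rmorphN /= -natr1.
    by rewrite -[(_ j%:Z)]/(j%:R : F); ring.
  by rewrite -mulrA divff ?mulr1 ?pnatr_eq0 -?lt0n ?fact_gt0// -exprD addnn -mul2n exprM sqrrN expr1n expr1n.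
by rewrite scale1r exprN1 invrN1 scaleN1r opprK [_ + x]addrC.
Qed.

Lemma nopP b d X h x v : hfield b d X ->
  sumsto (fun j => hm h (-1 - j%:Z) (X (x + j%:R) v) + X (x - 1 - j%:R) (hm h j v))
    (nop h X x v).
Proof.
by move=> Xf; rewrite nopE; apply: eq_sumsto (nprodP (-1) h x v Xf) => j; rewrite nprod_term1.
Qed.

Lemma nop_hfield b d X h : hfield b d X -> hfield b (d + 1) (nop h X).
Proof. by move=> /(nprod_hfield (-1) h); rewrite rmorphN /= opprK nopE. Qed.

Lemma hfield_add b d X X' : hfield b d X -> hfield b d X' -> hfield b d (fadd X X').
Proof.
move=> [Xl Xh] [Xl' Xh']; split=> [x|l q v x vq]; first exact: lin_add.
by apply: keyedD; [apply: Xh|apply: Xh'].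
Qed.

Lemma hfield_scale b d t X : hfield b d X -> hfield b d (fscale t X).
Proof.
move=> [Xl Xh]; split=> [x|l q v x vq]; first exact: lin_scale.
by apply: keyedZ; apply: Xh.
Qed.

(** Multiplication of X(z) by z^y. *)
Definition fshift y X : fieldOn V := fun x => X (x + y).

Lemma hfield_shift b d y X : hfield b d X -> hfield b (d - y) (fshift y X).
Proof.
move=> [Xl Xh]; split=> [x|l q v x vq]; first exact: Xl.
by apply: hspE (Xh _ _ _ (x + y) vq); ring.
Qed.

Lemma nop_add b d X X' h x v : hfield b d X -> hfield b d X' ->
  nop h (fadd X X') x v = nop h X x v + nop h X' x v.
Proof.
move=> Xf Xf'; apply: sumsto_uniq (nopP h x v (hfield_add Xf Xf')) _.
apply: eq_sumsto (sumstoD (nopP h x v Xf) (nopP h x v Xf')) => j.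
by rewrite /fadd (linD (@hm_lin F S _ _)) addrACA.
Qed.

Lemma nop_scale b d X t h x v : hfield b d X ->
  nop h (fscale t X) x v = t *: nop h X x v.
Proof.
move=> Xf; apply: sumsto_uniq (nopP h x v (hfield_scale t Xf)) _.
apply: eq_sumsto (sumstoZ t (nopP h x v Xf)) => j.
by rewrite /fscale (linZ (@hm_lin F S _ _)) scalerDr.
Qed.

Lemma nop_shift b d X y h x v : hfield b d X ->
  nop h (fshift y X) x v = nop h X (x + y) v.
Proof.
move=> Xf; apply: sumsto_uniq (nopP h x v (hfield_shift y Xf)) _.
apply: eq_sumsto (nopP h (x + y) v Xf) => j.
by rewrite /fshift; congr (hm _ _ (X _ _) + X _ _); ring.
Qed.

(** The commutator of h'(n) with X is left as an arbitrary field X', so that the lemma can be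
    iterated when X is itself a normally ordered product. *)
Lemma nop_bracket b d b' d' X X' h h' n : hfield b d X -> hfield b' d' X' ->
    (forall x v, hm h' n (X x v) = X x (hm h' n v) + X' x v) ->
  forall x v, hm h' n (nop h X x v) = nop h X x (hm h' n v) + nop h X' x v
    + ratr (n%:~R * <[h', h]>) *: X (x + n%:~R - 1) v.
Proof.
move=> Xf Xf' Xc x v; have [Xl Xh] := Xf; set r := ratr (_ * _).
have hml := @hm_lin F S.
apply: (sumsto_uniq (sumsto_lin (hml h' n) (nopP h x v Xf))).
(* The central term meets exactly one index: j = n - 1 in the creation half if n > 0, and j = -n in
   the annihilation half if n < 0. *)
have e : sumsto (fun j => (if n + (-1 - j%:Z) == 0 then r else 0) *: X (x + j%:R) v
    + (if n + j%:Z == 0 then r else 0) *: X (x - 1 - j%:R) v) (r *: X (x + n%:~R - 1) v).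
  rewrite /r; case: n @r {Xc} => [[|n]|n] r; rewrite /r.
  - have -> : ratr (0%:~R * <[h', h]>) = 0 :> F by rewrite mul0r rmorph0.
    rewrite scale0r; apply: eq_sumsto (sumsto0 _) => j.
    by rewrite !fun_if !if_same !scale0r addr0.
  - apply: eq_sumsto (sumsto1 n _) => j.
    have -> : (Posz n.+1 + (-1 - j%:Z) == 0) = (j == n) by lia.
    have -> : (Posz n.+1 + j%:Z == 0) = false by lia.
    rewrite scale0r addr0; case: eqVneq => [->|_]; last by rewrite scale0r.
    by congr (_ *: X _ _); rewrite -[(Posz _)%:~R]/(n.+1%:R : rat) -natr1; ring.
  - apply: eq_sumsto (sumsto1 n.+1 _) => j.
    have -> : (Negz n + (-1 - j%:Z) == 0) = false by lia.
    have -> : (Negz n + j%:Z == 0) = (j == n.+1) by lia.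
    rewrite scale0r add0r; case: eqVneq => [->|_]; last by rewrite scale0r.
    by congr (_ *: X _ _); rewrite NegzE rmorphN /=; ring.
have := sumstoD (sumstoD (nopP h x (hm h' n v) Xf) (nopP h x v Xf')) e.
apply: eq_sumsto => j; rewrite (linD (hml h' n)) (hm_comm h' h n (-1 - j%:Z)).
rewrite (Xc (x + j%:R)) (Xc (x - 1 - j%:R)) (hm_comm h' h n j).
rewrite (linD (Xl _)) (linZ (Xl _)) (linD (hml _ _)) -/r.
by malg_ring.
Qed.

Lemma nop_cov b d X h : hfield b d X -> covariant b X -> forall h' n x v,
  hm h' n (nop h X x v) = nop h X x (hm h' n v) + ratr <[h', b]> *: nop h X (x + n%:~R) v
    + ratr (n%:~R * <[h', h]>) *: X (x + n%:~R - 1) v.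
Proof.
move=> Xf Xc h' n x v; set r := ratr _.
rewrite (nop_bracket h Xf (hfield_scale r (hfield_shift n%:~R Xf)))//.
by rewrite (nop_scale _ _ _ _ (hfield_shift n%:~R Xf)) (nop_shift _ _ _ _ Xf).
Qed.

Lemma nop_nop_cov b d X a a' : hfield b d X -> covariant b X -> forall h n x v,
  hm h n (nop a (nop a' X) x v) = nop a (nop a' X) x (hm h n v)
    + ratr <[h, b]> *: nop a (nop a' X) (x + n%:~R) v
    + ratr (n%:~R * <[h, a']>) *: nop a X (x + n%:~R - 1) v
    + ratr (n%:~R * <[h, a]>) *: nop a' X (x + n%:~R - 1) v.
Proof.
move=> Xf Xc h n x v; have Nf := nop_hfield a' Xf.
have f1 := hfield_scale (ratr <[h, b]>) (hfield_shift n%:~R Nf).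
have f2 := hfield_scale (ratr (n%:~R * <[h, a']>)) (hfield_shift (n%:~R - 1) Xf).
have e : d - (n%:~R - 1) = d + 1 - n%:~R by ring.
rewrite e in f2.
rewrite (nop_bracket a Nf (hfield_add f1 f2)); last first.
  by move=> y w; rewrite (nop_cov a' Xf Xc) addrA /fadd /fscale /fshift addrA.
rewrite (nop_add _ _ _ f1 f2) (nop_scale _ _ _ _ (hfield_shift n%:~R Nf)).
rewrite (nop_scale _ _ _ _ (hfield_shift _ Xf)) (nop_shift _ _ _ _ Nf).
by rewrite (nop_shift _ _ _ _ Xf) !addrA.
Qed.

End NormalOrder.

(** * Lattice vertex operators *)

Section VertexOps.
Variables (F : numFieldType) (S : fockSpace F).
Local Notation L := (charges S).
Local Notation V := {malg F[fkeys S]}.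
Local Notation "<[ a , b ]>" := (@pr F S a b).
Implicit Types (h a b l : L) (n m : int) (x y q : rat) (X Y Z : fieldOn V) (v : V).

Local Notation hml := (@hm_lin F S).

(** These properties determine e^b(z) ([vo_uniq]) and are all that is used of it from here on. Since
    e^b(z) e^l starts with z^<b,l> e^(l+b), the leading mode is x = -1 - <b,l>. *)
Record vertex_op b X : Prop := VertexOp {
  vo_field : hfield b (-1) X;
  vo_cov : covariant b X;
  vo_vac : forall l, X (-1 - <[b, l]>) << vac l >> = << vac (l + b) >>
}.

Lemma mcoeff_lin k : lin (mcoeff k : V -> F^o).
Proof. by move=> t u v; rewrite mcoeffD mcoeffZ. Qed.

Lemma hm_cre_vac h n v l : n < 0 -> (hm h n v)@_(vac l) = 0.
Proof.
move=> n0; rewrite (malg_sum v) (lin_sum (hml h n)) (lin_sum (mcoeff_lin (vac l))).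
rewrite big1// => k _; rewrite (linZ (hml h n)) mcoeffZ [X in _ * X]mcoeff_outdom ?mulr0//.
apply/negP => kk; have /= [_] := @hm_hom F S h n k _ kk; rewrite dg_vac; lia.
Qed.

(** Creation modes have no vacuum coefficient and annihilation modes kill the vacuum vector, so only
    h(0) survives. *)
Lemma nop_vac b d X h x l l' : hfield b d X ->
  (nop h X x << vac l >>)@_(vac l') = ratr <[h, l]> * (X (x - 1) << vac l >>)@_(vac l').
Proof.
move=> Xf; have := sumsto_lin (mcoeff_lin (vac l')) (nopP h x << vac l >> Xf).
move=> /sumsto_uniq; apply; apply: eq_sumsto (sumsto1 0%N _) => j /=.
rewrite mcoeffD hm_cre_vac ?add0r; last by lia.
case: j => [|j]; last by rewrite hm_vac ?(lin0 (hf_lin Xf _)) ?mcoeff0//.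
by rewrite hm0 ch_vac (linZ (hf_lin Xf _)) mcoeffZ subr0.
Qed.

Lemma vo_coef b X x l : vertex_op b X ->
  (X x << vac l >>)@_(vac (l + b)) = (x == -1 - <[b, l]>)%:R.
Proof.
move=> [Xf _ Xv]; case: eqVneq => [->|xl]; first by rewrite Xv mcoeffUU.
have Xl := hf_hom Xf x (hsp_vac l); apply: (hsp_vac0 _ Xl).
by apply: contra_neq xl => e; lra.
Qed.

(* The translation property [(L(-1) v)(z) = d/dz v(z)] of [v = e^b]. *)
Lemma vo_deriv b X : vertex_op b X ->
  forall x v, nop b X x v = - ratr x *: X (x - 1) v.
Proof.
move=> XV; have [Xf Xc _] := XV; have Xl := hf_lin Xf; have Nl := nop_hfield b Xf.
move=> x v; apply/eqP; rewrite scaleNr -addr_eq0; apply/eqP.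
apply: (charge_decomp (D := fun v => nop b X x v + ratr x *: X (x - 1) v)).
  by apply: lin_add; [exact: (hf_lin Nl)|apply: lin_scale].
move=> {v} l; apply: (fock_uniq (l' := l + b) (nu := fun x => - x - <[b, l]>)
  (D := fun x v => nop b X x v + ratr x *: X (x - 1) v)).
- by move=> j; apply: lin_add; [exact: (hf_lin Nl)|apply: lin_scale].
- move=> j q v vq; apply: keyedD; last apply: keyedZ.
    by apply: hspE (hf_hom Nl j vq); ring.
  by apply: hspE (hf_hom Xf (j - 1) vq); ring.
- move=> j h n q v _ /(_ (j + n%:~R)) IH.
  have {}IH : nop b X (j + n%:~R) v = - (ratr (j + n%:~R) *: X (j + n%:~R - 1) v).
    by apply/eqP; rewrite -addr_eq0; apply/eqP/IH; ring.
  rewrite (linD (hml _ _)) (linZ (hml _ _)) (nop_cov b Xf Xc) (Xc h n (j - 1)) IH.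
  have -> : j - 1 + n%:~R = j + n%:~R - 1 by ring.
  by rewrite rmorphD rmorphM /=; malg_ring.
(* At the only mode of degree zero, x = -<b,l>, the normal ordering contributes <b,l> and the
   derivative x; they cancel. *)
- move=> j jl; have {}jl : j = - <[b, l]> by lra.
  rewrite mcoeffD mcoeffZ (nop_vac _ _ _ _ Xf) vo_coef// jl.
  have -> : - <[b, l]> - 1 = -1 - <[b, l]> by ring.
  by rewrite eqxx rmorphN /=; ring.
Qed.

(** The two orders have the same commutators with Heisenberg modes, and on vacuum coefficients each
    factor is a scalar, <h,l> or <h',l>, times a shift of the mode by one. *)
Lemma nop_comm b d X h h' : hfield b d X -> covariant b X ->
  forall x v, nop h (nop h' X) x v = nop h' (nop h X) x v.
Proof.
move=> Xf Xc x v; have Nh := nop_hfield h Xf; have Nh' := nop_hfield h' Xf.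
have NN := nop_hfield h Nh'; have NN' := nop_hfield h' Nh.
apply/eqP; rewrite -subr_eq0; apply/eqP.
pose D x v := nop h (nop h' X) x v - nop h' (nop h X) x v.
have Dl y : lin (D y) by apply: lin_add; [exact: (hf_lin NN)|apply: lin_opp; exact: (hf_lin NN')].
apply: (charge_decomp (D := D x)) => // l {}v.
apply: (fock_uniq (l' := l + b) (nu := fun x => - x - <[b, l]> + d + 2) (D := D)) => //.
- move=> j q w wq; apply: keyedD; last apply: keyedN.
    by apply: hspE (hf_hom NN j wq); ring.
  by apply: hspE (hf_hom NN' j wq); ring.
- move=> j a n q w _ /(_ (j + n%:~R)) IH; rewrite /D.
  have {}IH : nop h (nop h' X) (j + n%:~R) w = nop h' (nop h X) (j + n%:~R) w.
    by apply/eqP; rewrite -subr_eq0; apply/eqP/IH; ring.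
  by rewrite (linB (hml a n)) (nop_nop_cov h h' Xf Xc) (nop_nop_cov h' h Xf Xc) IH; malg_ring.
- move=> j _; rewrite /D mcoeffB (nop_vac _ _ _ _ Nh) (nop_vac _ _ _ _ Nh').
  by rewrite !(nop_vac _ _ _ _ Xf); ring.
Qed.

(** In particular e^0(z) is the identity field, on the tensor product as well as on the factors. *)
Lemma vo_uniq b X Y : vertex_op b X -> vertex_op b Y -> forall x v, X x v = Y x v.
Proof.
move=> XV YV x v; have [Xf Xc _] := XV; have [Yf Yc _] := YV.
apply/eqP; rewrite -subr_eq0; apply/eqP.
pose D x v := X x v - Y x v.
have Dl y : lin (D y) by apply: lin_add; [exact: (hf_lin Xf)|apply: lin_opp; exact: (hf_lin Yf)].
apply: (charge_decomp (D := D x)) => // l {}v.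
apply: (fock_uniq (l' := l + b) (nu := fun x => - x - <[b, l]> - 1) (D := D)) => //.
- move=> j q w wq; apply: keyedD; last apply: keyedN.
    by apply: hspE (hf_hom Xf j wq); ring.
  by apply: hspE (hf_hom Yf j wq); ring.
- move=> j a n q w _ /(_ (j + n%:~R)) IH; rewrite /D.
  have {}IH : X (j + n%:~R) w = Y (j + n%:~R) w.
    by apply/eqP; rewrite -subr_eq0; apply/eqP/IH; ring.
  by rewrite (linB (hml a n)) Xc Yc IH; malg_ring.
- by move=> j _; rewrite /D mcoeffB (vo_coef _ _ XV) (vo_coef _ _ YV) subrr.
Qed.

Lemma fid_vo : vertex_op 0 (@fid F V).
Proof.
split.
- split=> [x|l q v x vq]; rewrite /fid; case: eqVneq => [xE|_].
  + exact: lin_id.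
  + exact: lin_zero.
  + by rewrite pr0l addr0 xE; apply: hspE vq; ring.
  + exact: keyed0.
- by move=> h n x v; rewrite /fid pr0r rmorph0 scale0r addr0; case: eqP => _; rewrite ?(lin0 (hml _ _)).
- by move=> l; rewrite pr0l subr0 /fid eqxx addr0.
Qed.

Lemma vo0_fid X : vertex_op 0 X -> forall x v, X x v = if x == -1 then v else 0.
Proof. by move=> XV; exact: vo_uniq XV fid_vo. Qed.

Lemma eq_nop h X X' x v : (forall x v, X x v = X' x v) -> nop h X x v = nop h X' x v.
Proof. by move=> e; congr (nop _ _ _ _); apply/funext => y; apply/funext => w. Qed.

Lemma heisF_hfield h : hfield 0 0 (heisF h).
Proof.
split=> [x|l q v x vq]; rewrite /heisF; case: (boolP (x \is a Num.int)) => [/intrP[n xn]|_].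
- exact: hml.
- exact: lin_zero.
- rewrite xn numq_int; have := hm_hsp h n vq; rewrite addr0; apply: hspE.
  by rewrite pr0l; ring.
- exact: keyed0.
Qed.

Lemma nop_fid h x v : nop h (@fid F V) x v = heisF h x v.
Proof.
apply: sumsto_uniq (nopP h x v (vo_field fid_vo)) _; rewrite /fid /heisF.
(* The identity field has the single nonzero mode -1. For an integral mode m this selects j = m in
   the annihilation half or j = -m - 1 in the creation half; a nonintegral mode selects nothing. *)
case: ifPn => [/intrP[n ->]|xn].
  rewrite numq_int; case: n => n.
    apply: eq_sumsto (sumsto1 n _) => j.
    have -> : ((Posz n)%:~R + j%:R == -1 :> rat) = false.
      by apply/negbTE; rewrite gt_eqF// (@lt_le_trans _ _ 0)// addr_ge0// ler0n.
    have -> : ((Posz n)%:~R - 1 - j%:R == -1 :> rat) = (j == n).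
      by rewrite -(eqr_nat rat); apply/eqP/eqP; rewrite -[(Posz n)%:~R]/(n%:R : rat); lra.
    by rewrite (lin0 (hml _ _)) add0r; case: eqVneq => [->|].
  apply: eq_sumsto (sumsto1 n _) => j.
  have -> : ((Negz n)%:~R - 1 - j%:R == -1 :> rat) = false.
    apply/negbTE; rewrite lt_eqF// NegzE rmorphN /= -[(Posz _)%:~R]/(n.+1%:R : rat) -natr1.
    by have := ler0n rat j; have := ler0n rat n; lra.
  have -> : ((Negz n)%:~R + j%:R == -1 :> rat) = (j == n).
    rewrite -(eqr_nat rat) NegzE rmorphN /= -[(Posz _)%:~R]/(n.+1%:R : rat) -natr1.
    by apply/eqP/eqP; lra.
  rewrite addr0; case: eqVneq => [->|_]; last by rewrite (lin0 (hml _ _)).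
  by congr hm; rewrite NegzE; lia.
have nx (i : int) : (x == i%:~R) = false.
  by apply: contraNF xn => /eqP ->; exact: intr_int.
apply: eq_sumsto (sumsto0 _) => j.
rewrite (_ : (x + j%:R == -1) = (x == (-1 - j%:Z)%:~R)); last first.
  by rewrite rmorphB /= -[(Posz j)%:~R]/(j%:R : rat); apply/eqP/eqP; lra.
rewrite (_ : (x - 1 - j%:R == -1) = (x == (j%:Z)%:~R)); last first.
  by rewrite -[(Posz j)%:~R]/(j%:R : rat); apply/eqP/eqP; lra.
by rewrite !nx (lin0 (hml _ _)) addr0.
Qed.

Lemma nprod_heis_linear b d X n t h h' x v : hfield b d X ->
  nprod n (heisF (t *: h + h')) X x v
    = ratr t *: nprod n (heisF h) X x v + nprod n (heisF h') X x v.
Proof.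
move=> Xf; apply: sumsto_uniq (nprodP n _ x v Xf) _.
apply: eq_sumsto (sumstoD (sumstoZ (ratr t) (nprodP n h x v Xf)) (nprodP n h' x v Xf)) => j.
rewrite /nprod_term !hm_linear (linD (hf_lin Xf _)) (linZ (hf_lin Xf _)).
by move: (_ * binz _ _ _) ((-1) ^ n) => r s; malg_ring.
Qed.

Lemma nop_linear b d X t h h' x v : hfield b d X ->
  nop (t *: h + h') X x v = ratr t *: nop h X x v + nop h' X x v.
Proof. by rewrite !nopE; exact: nprod_heis_linear. Qed.

Lemma nopDl b d X h h' x v : hfield b d X ->
  nop (h + h') X x v = nop h X x v + nop h' X x v.
Proof. by move=> Xf; rewrite -[h in LHS]scale1r (nop_linear _ _ _ _ _ Xf) rmorph1 scale1r. Qed.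

Lemma nop0l b d X x v : hfield b d X -> nop 0 X x v = 0.
Proof.
by move=> Xf; apply: (addrI (nop 0 X x v)); rewrite -(nopDl _ _ _ _ Xf) !addr0.
Qed.

Lemma nopZl b d X t h x v : hfield b d X -> nop (t *: h) X x v = ratr t *: nop h X x v.
Proof.
by move=> Xf; rewrite -[t *: h]addr0 (nop_linear _ _ _ _ _ Xf) (nop0l _ _ Xf) addr0.
Qed.

Lemma nopNl b d X h x v : hfield b d X -> nop (- h) X x v = - nop h X x v.
Proof.
by move=> Xf; rewrite -scaleN1r (nopZl _ _ _ _ Xf) rmorphN rmorph1 scaleN1r.
Qed.

Lemma nprod_term2 h X x v j :
  nprod_term (-2) h X x v j = j.+1%:R *: (hm h (-2 - j%:Z) (X (x + j%:R) v)
    - X (x - 2 - j%:R) (hm h j v)).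
Proof.
rewrite /nprod_term; have -> : (-1) ^+ j * binz F (-2) j = j.+1%:R.
  rewrite /binz; have -> : \prod_(i < j) ((- 2 - i%:Z)%:~R : F) = (-1) ^+ j * j.+1`!%:R.
    elim: j => [|j IH]; first by rewrite big_ord0 expr0 mulr1.
    rewrite big_ord_recr /= IH (factS j.+1) natrM exprS rmorphB /= rmorphN /= -[j.+2%:R]natr1 -natr1.
    by rewrite -[(_ j%:Z)]/(j%:R : F) -[(_ (Posz 2))]/(2%:R : F); ring.
  rewrite mulrA mulrA -exprD addnn -mul2n exprM sqrrN expr1n expr1n mul1r factS natrM.
  by rewrite mulfK// pnatr_eq0 -lt0n fact_gt0.
rewrite -[(-1) ^ (-2)]/((-1) ^- 2 : F) sqrrN expr1n invr1 scale1r.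
by rewrite rmorphN /= [- _ + x]addrC.
Qed.

(* The Leibniz rule for the derivative of the normally ordered product
   [h(z) X(z)], solved for [h'(z) X(z)]. *)
Lemma nprod2_deriv b X h : vertex_op b X -> forall x v,
  nprod (-2) (heisF h) X x v
    = - ratr x *: nop h X (x - 1) v - nop h (nop b X) x v.
Proof.
move=> XV x v; have [Xf _ _] := XV; have Xl := hf_lin Xf.
have Nf := nop_hfield b Xf.
apply: (sumsto_uniq (nprodP (-2) h x v Xf)).
(* The two sides differ termwise by A (j+1) - A j. This telescopes to zero, as A 0 = 0 and A
   vanishes eventually. *)
pose A j := j%:R *: hm h (-1 - j%:Z) (X (x - 1 + j%:R) v).
have A0 : sumsto A (\sum_(j \in [set: nat]) A j).
  apply: sumsto_fsumP; have [M XM] := hf_trunc Xf v (x - 1).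
  by exists M => j Mj; rewrite /A XM// (lin0 (hml _ _)) scaler0.
have A1 : sumsto (fun j => A j.+1) (\sum_(j \in [set: nat]) A j).
  by apply/sumstoS; rewrite /A scale0r add0r; exact: A0.
have T := sumstoB (sumstoZ (- ratr x) (nopP h (x - 1) v Xf)) (nopP h x v Nf).
have := sumstoB (sumstoD T A1) A0; rewrite addrK; apply: eq_sumsto => j.
rewrite nprod_term2 /A !(vo_deriv XV).
have e1 : x - 1 + j.+1%:R = x + j%:R by rewrite -natr1; ring.
have e2 : -1 - j.+1%:Z = -2 - j%:Z by lia.
have e3 : x + j%:R - 1 = x - 1 + j%:R by ring.
have e4 : x - 1 - j%:R - 1 = x - 2 - j%:R by ring.
have e5 : x - 1 - 1 - j%:R = x - 2 - j%:R by ring.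
rewrite e1 e2 e3 e4 e5 !(linZ (hml _ _)).
rewrite !rmorphD !rmorphN /= !ratr_nat rmorph1 -natr1.
by malg_ring.
Qed.

(** Here the cut between the modes of h put on the left and those put on the right of X is at m
    instead of 0. Moving one mode across the cut costs the commutator <h,b> X_(z-1). *)
Lemma nop_shifted b X h : vertex_op b X -> forall m z v,
  sumsto (fun j : nat => hm h (m - 1 - j%:Z) (X (z - m%:~R + j%:R) v)
      + X (z - m%:~R - 1 - j%:R) (hm h (m + j%:Z) v))
    (nop h X z v + ratr (m%:~R * <[h, b]>) *: X (z - 1) v).
Proof.
move=> XV m z v; have [Xf Xc _] := XV; have Xl := hf_lin Xf.
pose A m (j : nat) := hm h (m - 1 - j%:Z) (X (z - m%:~R + j%:R) v).
pose B m (j : nat) := X (z - m%:~R - 1 - j%:R) (hm h (m + j%:Z) v).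
pose sA m := \sum_(j \in [set: nat]) A m j.
pose sB m := \sum_(j \in [set: nat]) B m j.
have As k : sumsto (A k) (sA k).
  apply: sumsto_fsumP; have [M XM] := hf_trunc Xf v (z - k%:~R).
  by exists M => j Mj; rewrite /A XM// (lin0 (hml _ _)).
have Bs k : sumsto (B k) (sB k).
  apply: sumsto_fsumP; have [M hM] := hm_trunc h v.
  exists (M + absz k)%N => j Mj; rewrite /B.
  have -> : k + j%:Z = (absz (k + j%:Z))%:Z by lia.
  by rewrite hM ?(lin0 (Xl _))//; lia.
have AS k : sA (k + 1) = A (k + 1) 0%N + sA k.
  apply: (sumsto_uniq (As _)); apply/sumstoS; apply: eq_sumsto (As k) => j.
  rewrite /A; congr (hm _ _ (X _ _)); first lia.
  by rewrite rmorphD /= -natr1; ring.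
have BS k : sB k = B k 0%N + sB (k + 1).
  apply: (sumsto_uniq (Bs _)); apply/sumstoS; apply: eq_sumsto (Bs (k + 1)) => j.
  rewrite /B; congr (X _ (hm _ _ _)); last lia.
  by rewrite rmorphD /= -natr1; ring.
(* The mode h(k) changes sides; iterating upwards and downwards from k = 0 reaches every integer
   cut. *)
have step k : sA (k + 1) + sB (k + 1) = sA k + sB k + ratr <[h, b]> *: X (z - 1) v.
  rewrite AS (BS k) /A /B.
  have -> : k + 1 - 1 - 0%:Z = k by lia.
  have -> : z - (k + 1)%:~R + 0%:R = z - k%:~R - 1 by rewrite rmorphD /=; ring.
  have -> : k + 0%:Z = k by lia.
  rewrite Xc subr0; have -> : z - k%:~R - 1 + k%:~R = z - 1 by ring.
  by malg_ring.
have e : sA m + sB m = nop h X z v + ratr (m%:~R * <[h, b]>) *: X (z - 1) v.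
  have base : sA 0 + sB 0 = nop h X z v.
    apply: (sumsto_uniq (sumstoD (As 0) (Bs 0))); apply: eq_sumsto (nopP h z v Xf) => j.
    by rewrite /A /B subr0 !add0r.
  elim/int_ind: m => [|k IH|k IH].
  - by rewrite base mul0r rmorph0 scale0r addr0.
  - rewrite -[k.+1]addn1 PoszD step IH rmorphD rmorph1 mulrDl mul1r rmorphD /=.
    by malg_ring.
  - have := step (- k.+1%:Z); have -> : - k.+1%:Z + 1 = - k%:Z by lia.
    rewrite IH => /esym/(canRL (addrK _)) ->.
    have -> : - (k%:Z) = - k.+1%:Z + 1 by lia.
    by rewrite rmorphD rmorph1 mulrDl mul1r [ratr (_ + <[_, _]>)]rmorphD /=; malg_ring.
by rewrite -e; exact: (sumstoD (As m) (Bs m)).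
Qed.

(** Commuting X past either factor h leaves a normally ordered product of h and X, with cut 0 for
    one factor and cut m for the other. The different cut is the origin of the term with m
    <h,b>^2. *)
Lemma nop_heis_comm b X h : vertex_op b X -> forall m y v,
  nop h (heisF h) m%:~R (X y v) = X y (nop h (heisF h) m%:~R v)
    + ratr (2 * <[h, b]>) *: nop h X (y + m%:~R) v
    + ratr (m%:~R * <[h, b]> ^+ 2) *: X (y + m%:~R - 1) v.
Proof.
move=> XV m y v; have [Xf Xc _] := XV; have Xl := hf_lin Xf.
have Hf := heisF_hfield h.
apply: (sumsto_uniq (nopP h m%:~R (X y v) Hf)).
have S1 := sumsto_lin (Xl y) (nopP h m%:~R v Hf).
have S2 := sumstoZ (ratr <[h, b]>) (nopP h (y + m%:~R) v Xf).
have S3 := sumstoZ (ratr <[h, b]>) (nop_shifted h XV m (y + m%:~R) v).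
have := sumstoD (sumstoD S1 S2) S3.
have -> : X y (nop h (heisF h) m%:~R v) + ratr <[h, b]> *: nop h X (y + m%:~R) v
  + ratr <[h, b]> *: (nop h X (y + m%:~R) v
      + ratr (m%:~R * <[h, b]>) *: X (y + m%:~R - 1) v)
  = X y (nop h (heisF h) m%:~R v) + ratr (2 * <[h, b]>) *: nop h X (y + m%:~R) v
    + ratr (m%:~R * <[h, b]> ^+ 2) *: X (y + m%:~R - 1) v.
  by rewrite expr2 !rmorphM /= ratr_nat; malg_ring.
apply: eq_sumsto => j.
have i1 : m%:~R + j%:R = (m + j%:Z)%:~R :> rat by rewrite rmorphD.
have i2 : m%:~R - 1 - j%:R = (m - 1 - j%:Z)%:~R :> rat by rewrite !rmorphB.
rewrite i1 i2 !heisF_int (linD (Xl y)).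
rewrite (Xc h (m + j%:Z) y) (Xc h j y) !(linD (hml _ _)) !(linZ (hml _ _)).
rewrite (Xc h (-1 - j%:Z) y) (Xc h (m - 1 - j%:Z) y).
have -> : y + (-1 - j%:Z)%:~R = y - 1 - j%:R by rewrite rmorphB rmorphN /=; ring.
have -> : y + m%:~R - m%:~R - 1 - j%:R = y - 1 - j%:R by ring.
have -> : y + (m + j%:Z)%:~R = y + m%:~R + j%:R by rewrite rmorphD addrA.
have -> : y + m%:~R - m%:~R + j%:R = y + j%:R by ring.
have -> : y + (m - 1 - j%:Z)%:~R = y + m%:~R - 1 - j%:R by rewrite !rmorphB /=; ring.
by malg_ring.
Qed.

End VertexOps.

(** * Commutators of two vertex operators *)

Section Products.
Variables (F : numFieldType) (S : fockSpace F).
Local Notation L := (charges S).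
Local Notation V := {malg F[fkeys S]}.
Local Notation "<[ a , b ]>" := (@pr F S a b).
Implicit Types (h a b l : L) (n : int) (x y q : rat) (X Y Z : fieldOn V) (v : V).
Local Notation hml := (@hm_lin F S).

Lemma vo_vac_mode b Y l y : vertex_op b Y ->
  (exists m : nat, y = -1 - <[b, l]> - m%:R) \/ Y y << vac l >> = 0.
Proof.
move=> [Yf _ _]; have [|Y0] := eqVneq (Y y << vac l >>) 0; [by right|left].
have [d dE] := hsp_nat (hf_hom Yf y (hsp_vac l)) Y0.
by exists d; rewrite -dE; ring.
Qed.

(* [c m] is the coefficient of [t^m] in [(1 - t)^N]; the recurrence is the
   differential equation of this power. *)
Lemma binomial_sum (N : F) (c : nat -> F) :
    (forall m, m.+1%:R * c m.+1 = (m%:R - N) * c m) ->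
  forall m, m%:R * c m = - N * \sum_(i < m) c i.
Proof.
move=> cS; elim=> [|m IH]; first by rewrite big_ord0 mul0r mulr0.
by rewrite cS mulrBl IH big_ord_recr /=; ring.
Qed.

(* [e^a(z) e^b(w)] has vacuum coefficient [z^<a,l> w^<b,l> (z - w)^<a,b>]. *)
Lemma vo_mul_coef a b X Y (c : nat -> F) : vertex_op a X -> vertex_op b Y ->
    c 0%N = 1 -> (forall m, m.+1%:R * c m.+1 = (m%:R - ratr <[a, b]>) * c m) ->
  forall m x l, (X x (Y (-1 - <[b, l]> - m%:R) << vac l >>))@_(vac (l + b + a))
    = if x == -1 - <[a, l]> - <[a, b]> + m%:R then c m else 0.
Proof.
move=> XV YV c0 cS m; have [Xf Xc _] := XV; have [Yf _ Yv] := YV.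
have Xl := hf_lin Xf; have Yl := hf_lin Yf.
have [M mM] := ubnP m; elim: M m mM => // M IH [|m] mM x l.
  rewrite subr0 Yv (vo_coef _ _ XV) addr0 c0 prDr (prC a b) opprD addrA.
  by case: ifP.
pose y := - <[b, l]> - m.+1%:R.
have -> : -1 - <[b, l]> - m.+1%:R = y - 1 by rewrite /y; ring.
pose phi x u := (X x u)@_(vac (l + b + a)) : F^o.
have phil z : lin (phi z) by apply: (lin_comp (@mcoeff_lin _ _ _) (Xl z)).
rewrite -/(phi x (Y (y - 1) << vac l >>)).
(* The translation property of Y gives the recursion: moving the creation modes b(-1-j) to the left
   through X leaves -<a,b> times coefficients with smaller m, while b(0) contributes <b,l>,
   subtracted next to turn -y into m + 1. *)
have S1 := sumsto_lin (phil x) (nopP b y << vac l >> Yf).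
rewrite (vo_deriv YV) (linZ (phil x)) in S1.
have S2 := sumstoB S1 (sumsto1 0%N (ratr <[b, l]> *: phi x (Y (y - 1) << vac l >>))).
rewrite -scalerBl -opprD -rmorphD in S2.
have yl : - ratr (y + <[b, l]>) = m.+1%:R :> F.
  have -> : y + <[b, l]> = - m.+1%:R by rewrite /y; ring.
  by rewrite rmorphN /= ratr_nat opprK.
rewrite yl in S2.
have m0 : m.+1%:R != 0 :> F by rewrite pnatr_eq0.
apply: (mulfI m0); apply: (sumsto_uniq S2).
have -> : m.+1%:R * (if x == -1 - <[a, l]> - <[a, b]> + m.+1%:R then c m.+1 else 0)
  = \sum_(j < m.+1) (if x == -1 - <[a, l]> - <[a, b]> + m.+1%:R
       then - ratr <[a, b]> * c (m - j)%N else 0) :> F.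
  case: eqVneq => [_|_]; last by rewrite mulr0 big1.
  rewrite (binomial_sum cS) -mulr_sumr; congr (_ * _).
  by rewrite (reindex_inj rev_ord_inj) /=; apply: eq_bigr => i _; rewrite subSS.
pose u (j : nat) : F^o := if (j < m.+1)%N then (if x == -1 - <[a, l]> - <[a, b]> + m.+1%:R
       then - ratr <[a, b]> * c (m - j)%N else 0) else 0.
have -> : \sum_(j < m.+1) (if x == -1 - <[a, l]> - <[a, b]> + m.+1%:R
       then - ratr <[a, b]> * c (m - j)%N else 0) = \sum_(j < m.+1) u j.
  by apply: eq_bigr => j _; rewrite /u ltn_ord.
have u0 j : (m.+1 <= j)%N -> u j = 0 by move=> mj; rewrite /u ltnNge mj.
apply: eq_sumsto (sumsto_bound u0) => j.
rewrite (linD (phil x)).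
have -> : phi x (hm b (-1 - j%:Z) (Y (y + j%:R) << vac l >>))
    = - ratr <[a, b]> * phi (x - 1 - j%:R) (Y (y + j%:R) << vac l >>).
  have := Xc b (-1 - j%:Z) x (Y (y + j%:R) << vac l >>).
  move=> /(congr1 (mcoeff (vac (l + b + a)))).
  rewrite hm_cre_vac ?mcoeffD ?mcoeffZ; last by lia.
  have -> : x + (-1 - j%:Z)%:~R = x - 1 - j%:R by rewrite rmorphB rmorphN /=; ring.
  by move=> /esym /eqP; rewrite addr_eq0 (prC b a) /phi => /eqP ->; rewrite mulNr.
have -> : phi x (Y (y - 1 - j%:R) (hm b j << vac l >>))
    = if j == 0%N then ratr <[b, l]> *: phi x (Y (y - 1) << vac l >>) else 0.
  case: j => [|j]; last by rewrite hm_vac// (lin0 (Yl _)) (lin0 (phil _)).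
  by rewrite subr0 hm0 ch_vac (linZ (Yl _)) (linZ (phil _)).
rewrite addrK /u; case: ltnP => jm.
  have -> : y + j%:R = -1 - <[b, l]> - (m - j)%N%:R.
    by rewrite /y natrB -?natr1; [ring|lia].
  rewrite /phi IH; last by lia.
  have -> : (x - 1 - j%:R == -1 - <[a, l]> - <[a, b]> + (m - j)%:R)
     = (x == -1 - <[a, l]> - <[a, b]> + m.+1%:R).
    by rewrite natrB -?natr1; [apply/eqP/eqP; lra|lia].
  by case: ifP; rewrite ?mulr0.
have -> : Y (y + j%:R) << vac l >> = 0.
  have Yh := hf_hom Yf (y + j%:R) (hsp_vac l); apply: (hsp_eq0 Yh).
  rewrite /y; move: jm; rewrite -(ler_nat rat) -natr1; lra.
by rewrite (lin0 (phil _)) mulr0.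
Qed.

(** The condition on x + y says that the product preserves degree 0, the only case in which
    [fock_uniq] asks for a vacuum coefficient. *)
Lemma vo_mul_vac a b X Y (c : nat -> F) : vertex_op a X -> vertex_op b Y ->
    c 0%N = 1 -> (forall m, m.+1%:R * c m.+1 = (m%:R - ratr <[a, b]>) * c m) ->
  forall x y l, x + y = -2 - <[a, l]> - <[b, l]> - <[a, b]> ->
    (exists2 m : nat, y = -1 - <[b, l]> - m%:R &
       (X x (Y y << vac l >>))@_(vac (l + b + a)) = c m)
    \/ (forall m : nat, y <> -1 - <[b, l]> - m%:R) /\
       (X x (Y y << vac l >>))@_(vac (l + b + a)) = 0.
Proof.
move=> XV YV c0 cS x y l xy.
case: (pselect (exists m : nat, y = -1 - <[b, l]> - m%:R)) => [[m ym]|ny].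
  left; exists m => //; rewrite ym (vo_mul_coef XV YV c0 cS) ifT//.
  by apply/eqP; rewrite ym in xy; lra.
right; split=> [m ym|]; first by apply: ny; exists m.
by have [//|->] := vo_vac_mode l y YV; rewrite (lin0 (hf_lin (vo_field XV) _)) mcoeff0.
Qed.

(** For N >= 0 the factor (z - w)^N is a polynomial, so no pole contributes, and exchanging z and w
    gives the sign. *)
Lemma vo_comm (N : nat) a b X Y : vertex_op a X -> vertex_op b Y -> <[a, b]> = N%:R ->
  forall x y v, X x (Y y v) = (-1) ^+ N *: Y y (X x v).
Proof.
move=> XV YV abN x y v; have [Xf Xc _] := XV; have [Yf Yc _] := YV.
have Xl := hf_lin Xf; have Yl := hf_lin Yf.
apply/eqP; rewrite -subr_eq0; apply/eqP.
pose D (j : rat * rat) v := X j.1 (Y j.2 v) - (-1) ^+ N *: Y j.2 (X j.1 v).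
have Dl j : lin (D j).
  by apply: lin_add; [exact: lin_comp|apply: lin_opp; apply: lin_scale; exact: lin_comp].
apply: (charge_decomp (D := D (x, y))) => // l {}v.
apply: (fock_uniq (l := l) (l' := l + b + a)
  (nu := fun j => - j.1 - j.2 - <[a, l]> - <[b, l]> - N%:R - 2) (D := D)) => // [j q w wq|j h n q w _ IH|j jl].
- apply: keyedD; last apply: keyedN; last apply: keyedZ.
    by apply: hspE (hf_hom Xf j.1 (hf_hom Yf j.2 wq)); rewrite prDr abN; ring.
  rewrite addrAC; apply: hspE (hf_hom Yf j.2 (hf_hom Xf j.1 wq)).
  by rewrite prDr (prC b a) abN; ring.
- have IH1 : X (j.1 + n%:~R) (Y j.2 w) = (-1) ^+ N *: Y j.2 (X (j.1 + n%:~R) w).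
    by apply/eqP; rewrite -subr_eq0; apply/eqP/(IH (j.1 + n%:~R, j.2)) => /=; ring.
  have IH2 : X j.1 (Y (j.2 + n%:~R) w) = (-1) ^+ N *: Y (j.2 + n%:~R) (X j.1 w).
    by apply/eqP; rewrite -subr_eq0; apply/eqP/(IH (j.1, j.2 + n%:~R)) => /=; ring.
  rewrite /D (linB (hml h n)) (linZ (hml h n)) Xc !Yc !(linD (Xl _)) !(linZ (Xl _)).
  rewrite Xc !(linD (Yl _)) !(linZ (Yl _)) IH1 IH2.
  by move: ((-1) ^+ N) => s; malg_ring.
(* The coefficients of (1 - t)^N, which vanish beyond N. *)
- pose c m : F := (-1) ^+ m * 'C(N, m)%:R.
  have c0 : c 0%N = 1 by rewrite /c bin0 mulr1.
  have cS m : m.+1%:R * c m.+1 = (m%:R - N%:R) * c m.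
    rewrite /c mulrCA -natrM mul_bin_left exprS natrM.
    have [mN|Nm] := leqP m N; first by rewrite natrB//; ring.
    by rewrite bin_small// !mulr0.
  rewrite /D mcoeffB mcoeffZ; apply/eqP; rewrite subr_eq0; apply/eqP.
  have cS1 m : m.+1%:R * c m.+1 = (m%:R - ratr <[a, b]>) * c m by rewrite abN ratr_nat.
  have cS2 m : m.+1%:R * c m.+1 = (m%:R - ratr <[b, a]>) * c m.
    by rewrite (prC b a) abN ratr_nat.
  have e1 : j.1 + j.2 = -2 - <[a, l]> - <[b, l]> - <[a, b]> by rewrite abN; lra.
  have e2 : j.2 + j.1 = -2 - <[b, l]> - <[a, l]> - <[b, a]> by rewrite (prC b a) abN; lra.
  have := vo_mul_vac YV XV c0 cS2 e2; rewrite [_ + a + b]addrAC.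
  have := vo_mul_vac XV YV c0 cS1 e1; rewrite abN in e1.
  move=> [[m ym ->]|[ny ->]] [[m' xm ->]|[nx ->]]; last by rewrite mulr0.
  (* The two expansions read the coefficients at m and at N - m; they agree by the symmetry of the
     binomial coefficients. *)
  + have mN : (m + m' = N)%N by apply/eqP; rewrite -(eqr_nat rat) natrD; apply/eqP; lra.
    rewrite /c -mN mulrA -exprD -addnA addnn exprD -[(-1) ^+ m'.*2]signr_odd odd_double mulr1.
    by rewrite -bin_sub ?addKn ?leq_addr.
  + rewrite mulr0 /c bin_small ?mulr0// ltnNge; apply/negP => mN.
    by apply: (nx (N - m)%N); rewrite natrB//; lra.
  + rewrite /c bin_small ?mulr0// ltnNge; apply/negP => mN.
    by apply: (ny (N - m')%N); rewrite natrB//; lra.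
Qed.

(** The two expansions of (z - w)^(-2) differ by a derivative of the delta function, whose residue
    gives both terms. If x + <a,l> is not an integer, X Y and Y X vanish on the sector l, while the
    right-hand terms in Z need not. *)
Lemma vo_comm_pole2 a b X Y Z : vertex_op a X -> vertex_op b Y -> vertex_op (a + b) Z ->
    <[a, b]> = -2 ->
  forall l x y v, x + <[a, l]> \is a Num.int -> keyed [set k | ch k = l] v ->
  X x (Y y v) = Y y (X x v) + (ratr x *: Z (x + y - 1) v + nop a Z (x + y) v).
Proof.
move=> XV YV ZV ab2 l x y v /intrP[i xi] vl.
have [Xf Xc _] := XV; have [Yf Yc _] := YV; have [Zf Zc _] := ZV.
have Xl := hf_lin Xf; have Yl := hf_lin Yf; have Zl := hf_lin Zf.
have Nf := nop_hfield a Zf; have Nl := hf_lin Nf.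
(* Indexing by the integer x + <a,l> builds the integrality into the family and is stable under the
   shifts by Heisenberg modes. *)
pose D (j : int * rat) v := let x := j.1%:~R - <[a, l]> in
  X x (Y j.2 v) - Y j.2 (X x v) - (ratr x *: Z (x + j.2 - 1) v + nop a Z (x + j.2) v).
have Dl j : lin (D j).
  apply: lin_add; last apply: lin_opp; apply: lin_add.
  - exact: lin_comp.
  - by apply: lin_opp; exact: lin_comp.
  - exact: lin_scale.
  - exact: Nl.
suff : D (i, y) v = 0.
  rewrite /D /=; have -> : i%:~R - <[a, l]> = x by rewrite -xi; ring.
  by move=> /eqP; rewrite subr_eq0 => /eqP <-; rewrite addrC subrK.
apply: (fock_uniq (l := l) (l' := l + b + a)
  (nu := fun j => - j.1%:~R - j.2 - <[b, l]>) (D := D)) => //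
  {vl xi v} [j q w wq|j h n q w _ IH|j jl].
- apply: keyedD; [apply: keyedD; [|apply: keyedN]|apply: keyedN; apply: keyedD; [apply: keyedZ|]].
  + by apply: hspE (hf_hom Xf _ (hf_hom Yf j.2 wq)); rewrite prDr ab2; ring.
  + rewrite addrAC; apply: hspE (hf_hom Yf j.2 (hf_hom Xf _ wq)).
    by rewrite prDr (prC b a) ab2; ring.
  + rewrite -addrA [b + a]addrC; apply: hspE (hf_hom Zf _ wq).
    by rewrite prDl; ring.
  + rewrite -addrA [b + a]addrC; apply: hspE (hf_hom Nf _ wq).
    by rewrite prDl; ring.
- have IH1 := IH (j.1 + n, j.2); have IH2 := IH (j.1, j.2 + n%:~R).
  rewrite /D /= in IH1 IH2 *.
  set x0 := j.1%:~R - <[a, l]> in IH1 IH2 *.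
  rewrite rmorphD /= in IH1.
  have ex : j.1%:~R + n%:~R - <[a, l]> = x0 + n%:~R by rewrite /x0; ring.
  rewrite ex in IH1; rewrite (linB (hml h n)) !(linD (hml h n)) (linN (hml h n)) (linZ (hml h n)).
  rewrite Xc !Yc Zc (nop_cov a Zf Zc) !(linD (Xl _)) !(linZ (Xl _)).
  rewrite Xc !(linD (Yl _)) !(linZ (Yl _)).
  have e1 : x0 + j.2 - 1 + n%:~R = x0 + j.2 + n%:~R - 1 by ring.
  have e2 : x0 + n%:~R + j.2 = x0 + j.2 + n%:~R by ring.
  have e3 : x0 + (j.2 + n%:~R) = x0 + j.2 + n%:~R by ring.
  rewrite e1; rewrite e2 in IH1; rewrite e3 in IH2.
  have {}IH1 := IH1 ltac:(ring); have {}IH2 := IH2 ltac:(ring).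
  (* The commutator of h(n) with D is <h,a> D_(x+n,y) + <h,b> D_(x,y+n). Both vanish by hypothesis
     and are inserted as zeros, leaving a linear identity. *)
  apply/eqP; rewrite -subr_eq0 -[X in _ == X](scaler0 _ (ratr <[h, a]>)).
  rewrite -[X in _ == _ *: X]IH1 -[X in X == _]addr0 -[X in _ + X == _](scaler0 _ (- ratr <[h, b]>)).
  rewrite -[X in _ + _ *: X == _]IH2; apply/eqP.
  rewrite prDr !rmorphM !rmorphD /=.
  by malg_ring.
- have {}jl : j.1%:~R = - j.2 - <[b, l]> by lra.
  rewrite /D /= !mcoeffB mcoeffD mcoeffZ (nop_vac _ _ _ _ Zf).
  have lab : vac (l + b + a) = vac (l + (a + b)) by rewrite -addrA [b + a]addrC.
  rewrite [X in _ - _ - (_ * X@__ + _)](_ : _ = Z (-1 - <[a + b, l]>) << vac l >>); last first.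
    by congr (Z _ _); rewrite jl prDl; ring.
  rewrite [X in _ - _ - (_ + _ * X@__)](_ : _ = Z (-1 - <[a + b, l]>) << vac l >>); last first.
    by congr (Z _ _); rewrite jl prDl; ring.
  rewrite lab (vo_coef _ _ ZV) eqxx -lab !mulr1 -rmorphD /= subrK ratr_int.
  (* The coefficients of (1 - t)^(-2). *)
  pose c m : F := m.+1%:R.
  have cS1 m : m.+1%:R * c m.+1 = (m%:R - ratr <[a, b]>) * c m.
    by rewrite ab2 rmorphN /= ratr_nat opprK mulrC /c -[m.+2%:R]natr1 -natr1; ring.
  have cS2 m : m.+1%:R * c m.+1 = (m%:R - ratr <[b, a]>) * c m by rewrite (prC b a).
  set x0 := j.1%:~R - <[a, l]>.
  have e1 : x0 + j.2 = -2 - <[a, l]> - <[b, l]> - <[a, b]> by rewrite ab2 /x0; lra.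
  have e2 : j.2 + x0 = -2 - <[b, l]> - <[a, l]> - <[b, a]> by rewrite (prC b a) ab2 /x0; lra.
  have := vo_mul_vac YV XV erefl cS2 e2; rewrite [_ + a + b]addrAC.
  have := vo_mul_vac XV YV erefl cS1 e1.
  have jr : (j.1)%:~R = ratr j.1%:~R :> F by rewrite ratr_int.
  (* The right side has vacuum coefficient x + <a,l>. If it is positive only X Y contributes, if
     negative only Y X, and if it is zero neither does; both together are impossible. *)
  move=> [[m ym ->]|[ny ->]] [[m' xm ->]|[nx ->]].
  + exfalso; have := ler0n rat m; have := ler0n rat m'; rewrite /x0 in xm; lra.
  + rewrite subr0 jr; have -> : j.1%:~R = m.+1%:R :> rat by rewrite -natr1 jl ym; ring.
    by rewrite ratr_nat subrr.
  + rewrite sub0r jr; have -> : j.1%:~R = - m'.+1%:R :> rat.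
      by rewrite -natr1; rewrite /x0 in xm; lra.
    by rewrite rmorphN /= ratr_nat opprK addNr.
  + rewrite subrr sub0r; have [j0|j0] := eqVneq j.1 0; first by rewrite j0 oppr0.
    exfalso; case ej : j.1 j0 => [[|k]|k] // _; rewrite ej in jl.
      by apply: (ny k); move: jl; rewrite -[(Posz _)%:~R]/(k.+1%:R : rat) -natr1; lra.
    apply: (nx k); rewrite /x0 ej; move: jl; rewrite NegzE rmorphN /=.
    by rewrite -[(Posz _)%:~R]/(k.+1%:R : rat) -natr1; lra.
Qed.

End Products.

(** * The Fock space of a Gram matrix *)

HB.lock Definition incr (J : choiceType) (m : cmonom J) (a : J) : cmonom J :=
  mulcm m (ucm a).
HB.lock Definition decr (J : choiceType) (m : cmonom J) (a : J) : cmonom J :=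
  divcm m (ucm a).

Section Monomials.
Variable I : choiceType.
Implicit Types (m : {cmonom I}) (a b c : I).

Lemma incrE m a c : incr m a c = (m c + (a == c))%N.
Proof. by rewrite unlock mulcmE ucmE. Qed.
Lemma decrE m a c : decr m a c = (m c - (a == c))%N.
Proof. by rewrite unlock divcmE ucmE. Qed.

Lemma decrK m a : m a != 0%N -> incr (decr m a) a = m.
Proof.
move=> ma; apply/eqP/cmP => c; rewrite incrE decrE.
by case: eqVneq => [<-|_]; rewrite ?subnK ?lt0n// subn0 addn0.
Qed.

Lemma incrK m a : decr (incr m a) a = m.
Proof. by apply/eqP/cmP => c; rewrite decrE incrE addnK. Qed.

Lemma decr_incr m a b : a != b -> decr (incr m b) a = incr (decr m a) b.
Proof.
move=> ab; apply/eqP/cmP => c; rewrite decrE !incrE decrE.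
by case: (eqVneq a c) ab => [<-|_ _]; rewrite ?subn0// eq_sym => /negPf ->; rewrite !addn0.
Qed.

Lemma decrAC m a b : decr (decr m a) b = decr (decr m b) a.
Proof. by apply/eqP/cmP => c; rewrite !decrE; exact: subnAC. Qed.

Lemma incrAC m a b : incr (incr m a) b = incr (incr m b) a.
Proof. by apply/eqP/cmP => c; rewrite !incrE; exact: addnAC. Qed.

Lemma decrN m a b : a != b -> decr m a b = m b.
Proof. by move=> /negPf ab; rewrite decrE ab subn0. Qed.

End Monomials.

Section FockModes.
Variables (F : numFieldType) (r : nat) (G : 'M[rat]_r).
Hypotheses (G_sym : G^T = G) (G_unit : G \in unitmx).
(* The keys of [fock F r] and their indices are kept abstract: unification
   would otherwise compare their choice structures over and over. *)
Variables (K J : choiceType) (kc : K -> 'rV[rat]_r) (km : K -> cmonom J).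
Variables (mk : 'rV[rat]_r -> cmonom J -> K).
Variables (ix : 'I_r -> nat -> J) (ji : J -> 'I_r) (jn : J -> nat).
Hypotheses (mkK : forall k, mk (kc k) (km k) = k).
Hypotheses (kcE : forall l m, kc (mk l m) = l) (kmE : forall l m, km (mk l m) = m).
Hypotheses (ixK : forall a, ix (ji a) (jn a) = a).
Hypotheses (jiE : forall i n, ji (ix i n) = i) (jnE : forall i n, jn (ix i n) = n).
Local Notation V := {malg F[K]}.
Implicit Types (k : K) (m : cmonom J) (a : J) (v : V).

(** Becomes convertible to [hmode] when the abstract keys are replaced by pairs. *)
Definition hmodeK (h : 'rV[rat]_r) (n : int) : V -> V :=
  linext (fun k => match n with
    | Posz 0 => ratr (pair G h (kc k)) *: << k >>
    | Posz n'.+1 => \sum_(i < r)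
        (n'.+1%:R * ratr (pair G h (delta_mx 0 i)) * (km k (ix i n'))%:R)
          *: << mk (kc k) (divcm (km k) (ucm (ix i n'))) >>
    | Negz n' => \sum_(i < r)
        ratr (h 0 i) *: << mk (kc k) (mulcm (km k) (ucm (ix i n'))) >>
    end).

(** [annih a] is differentiation in the variable a and [creat a] is multiplication by it. Nonzero
    Heisenberg modes are combinations of these, so their commutators reduce to the Weyl algebra. *)
Definition annih a : V -> V :=
  linext (fun k => (km k a)%:R *: << mk (kc k) (decr (km k) a) >>).
Definition creat a : V -> V := linext (fun k => << mk (kc k) (incr (km k) a) >>).

Lemma pairC b b' : pair G b b' = pair G b' b.
Proof.
have -> : pair G b b' = (b *m G *m b'^T)^T 0 0 by rewrite mxE.
by rewrite !trmx_mul trmxK G_sym mulmxA.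
Qed.

Lemma pair_linear t (u w z : 'rV[rat]_r) :
  pair G (t *: u + w) z = t * pair G u z + pair G w z.
Proof. by rewrite /pair !mulmxDl -!scalemxAl !mxE. Qed.

Lemma pair_delta b i : pair G b (delta_mx 0 i) = (b *m G) 0 i.
Proof.
rewrite /pair trmx_delta mxE (bigD1 i)//= [X in _ + X]big1 => [|j /negPf jj].
  by rewrite [delta_mx _ _ _ _]mxE !eqxx mulr1 addr0.
by rewrite [delta_mx _ _ _ _]mxE jj mulr0.
Qed.

Lemma pair_sum h h' : pair G h h' = \sum_i pair G h (delta_mx 0 i) * h' 0 i.
Proof.
rewrite {1}/pair mxE; apply: eq_bigr => i _.
by rewrite pair_delta [h'^T _ _]mxE.
Qed.

(** The variable with second index n stands for b_i(-n-1), hence the weight n + 1. *)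
Definition weight m : nat := (\sum_(a <- finsupp m) m a * (jn a).+1)%N.

Lemma weight_supp m (A : {fset J}) : (finsupp m `<=` A)%fset ->
  weight m = (\sum_(a <- A) m a * (jn a).+1)%N.
Proof.
move=> mA; rewrite /weight (big_fset_incl _ mA)// => a _.
by rewrite memNfinsupp => /eqP ->.
Qed.

Lemma weight_mul m a : weight (incr m a) = (weight m + (jn a).+1)%N.
Proof.
pose A := (a |` finsupp m)%fset.
have mA : (finsupp (incr m a) `<=` A)%fset.
  apply/fsubsetP => b; rewrite mem_finsupp incrE in_fset1U mem_finsupp.
  by rewrite [b == a]eq_sym; case: (eqVneq a b) => //= _; rewrite addn0.
rewrite (weight_supp mA) (@weight_supp m A) ?fsubsetU1//.
under eq_bigr do rewrite incrE mulnDl.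
rewrite big_split /=; congr addn.
rewrite (big_fsetD1 a) ?fset1U1//= eqxx mul1n big_seq_cond big1 ?addn0// => b.
by rewrite !inE eq_sym => /andP[/andP[/negPf -> _] _].
Qed.

Lemma weight_div m a : m a != 0%N -> weight m = (weight (decr m a) + (jn a).+1)%N.
Proof. by move=> ma; rewrite -weight_mul decrK. Qed.

Lemma weight_one : weight (@onecm J) = 0%N.
Proof. by rewrite /weight big1_seq// => a _; rewrite onecmE mul0n. Qed.

Lemma weight_gt0 m : weight m != 0%N -> exists a, m a != 0%N.
Proof.
move=> m0; apply: contrapT => ma; move/eqP: m0; apply.
rewrite /weight big1// => a _; suff -> : m a = 0%N by rewrite mul0n.
by apply/eqP; apply: contrapT => /negP am; apply: ma; exists a.
Qed.

Lemma weight_eq0 m : weight m = 0%N -> m = @onecm J.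
Proof.
move=> m0; apply/eqP/cmP => a; rewrite onecmE; apply/eqP; apply: contrapT => /negP am.
by have := weight_div am; rewrite m0; lia.
Qed.

Lemma annih_lin a : lin (annih a). Proof. exact: linext_lin. Qed.
Lemma creat_lin a : lin (creat a). Proof. exact: linext_lin. Qed.

Lemma annih1 a k : annih a << k >> = (km k a)%:R *: << mk (kc k) (decr (km k) a) >>.
Proof. exact: linextE. Qed.
Lemma creat1 a k : creat a << k >> = << mk (kc k) (incr (km k) a) >>.
Proof. exact: linextE. Qed.
Lemma annihE a l m : annih a << mk l m >> = (m a)%:R *: << mk l (decr m a) >>.
Proof. by rewrite annih1 kcE kmE. Qed.
Lemma creatE a l m : creat a << mk l m >> = << mk l (incr m a) >>.
Proof. by rewrite creat1 kcE kmE. Qed.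

Lemma annihC a b v : annih a (annih b v) = annih b (annih a v).
Proof.
apply: (@lin_eq _ _ _ (fun v => annih a (annih b v)) (fun v => annih b (annih a v)));
  [by apply: lin_comp; exact: annih_lin..|move=> k _].
rewrite -(mkK k); move: (kc k) (km k) => l m.
have [->//|ab] := eqVneq a b.
rewrite (annihE b l m) (annihE a l m) (linZ (annih_lin a)) (linZ (annih_lin b)).
rewrite (annihE a l (decr m b)) (annihE b l (decr m a)) (decrAC m b a).
rewrite 2!scalerA; congr (_ *: _).
have e1 : decr m a b = m b by exact: decrN.
have e2 : decr m b a = m a by rewrite eq_sym in ab; exact: decrN.
by rewrite e1 e2 mulrC.
Qed.

Lemma creatC a b v : creat a (creat b v) = creat b (creat a v).
Proof.
apply: (@lin_eq _ _ _ (fun v => creat a (creat b v)) (fun v => creat b (creat a v)));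
  [by apply: lin_comp; exact: creat_lin..|move=> k _].
rewrite -(mkK k); move: (kc k) (km k) => l m.
by rewrite (creatE b l m) (creatE a l m) (creatE a l (incr m b)) (creatE b l (incr m a)) (incrAC m b a).
Qed.

Lemma annih_creat a b v : annih a (creat b v) = creat b (annih a v) + (a == b)%:R *: v.
Proof.
apply: (@lin_eq _ _ _ (fun v => annih a (creat b v))
  (fun v => creat b (annih a v) + (a == b)%:R *: v)).
- by apply: lin_comp; [exact: annih_lin|exact: creat_lin].
- apply: lin_add; first by apply: lin_comp; [exact: creat_lin|exact: annih_lin].
  by apply: lin_scale; exact: lin_id.
move=> k _; rewrite -(mkK k); move: (kc k) (km k) => l m {k}.
rewrite (creatE b l m) (annihE a l m) (linZ (creat_lin b)) (annihE a l (incr m b)) (creatE b l (decr m a)).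
rewrite incrE [b == a]eq_sym; have [<-|ab] := eqVneq a b; last first.
  by rewrite scale0r addr0 addn0 decr_incr.
rewrite incrK natrD; have [->|ma] := eqVneq (m a) 0%N; first by malg_ring.
by rewrite decrK//; malg_ring.
Qed.

Lemma hmode_lin h n : lin (hmodeK h n : V -> V).
Proof. exact: linext_lin. Qed.

Lemma hmode_annih h n v : hmodeK h (Posz n.+1) v
  = \sum_i (n.+1%:R * ratr (pair G h (delta_mx 0 i))) *: annih (ix i n) v.
Proof.
apply: (@lin_eq _ _ _ _ (fun v => \sum_i _ *: annih (ix i n) v)) => [||k _].
- exact: hmode_lin.
- by apply: lin_bigsum => i; apply: lin_scale; exact: annih_lin.
rewrite /hmodeK linextE; apply: eq_bigr => i _.
by rewrite annih1 scalerA decr.unlock.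
Qed.

Lemma hmode_creat h n v : hmodeK h (Negz n) v
  = \sum_i ratr (h 0 i) *: creat (ix i n) v.
Proof.
apply: (@lin_eq _ _ _ _ (fun v => \sum_i _ *: creat (ix i n) v)) => [||k _].
- exact: hmode_lin.
- by apply: lin_bigsum => i; apply: lin_scale; exact: creat_lin.
rewrite /hmodeK linextE; apply: eq_bigr => i _.
by rewrite creat1 incr.unlock.
Qed.

Lemma hmode0 h k : hmodeK h 0 << k >> = ratr (pair G h (kc k)) *: (<< k >> : V).
Proof. by rewrite /hmodeK linextE. Qed.

Lemma hmode_hom h n k : keyed [set k' | kc k' = kc k /\
  (weight (km k'))%:Z = (weight (km k))%:Z - n] (hmodeK h n << k >> : V).
Proof.
case: n => [[|n]|n].
- by rewrite hmode0; apply: keyedZ; apply: keyed1; rewrite /= subr0.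
- rewrite hmode_annih; apply: keyed_sum => i _; apply: keyedZ.
  rewrite annih1; have [->|ka] := eqVneq (km k (ix i n)) 0%N.
    by rewrite scale0r; exact: keyed0.
  by apply: keyedZ; apply: keyed1; rewrite /= kcE kmE (weight_div ka) jnE; split=> //; lia.
- rewrite hmode_creat; apply: keyed_sum => i _; apply: keyedZ.
  by rewrite creat1; apply: keyed1;
    rewrite /= kcE kmE weight_mul jnE; split=> //; lia.
Qed.

Lemma hmode_linear t h h' n v :
  hmodeK (t *: h + h') n v = ratr t *: hmodeK h n v + hmodeK h' n v.
Proof.
case: n => [[|n]|n].
- apply: (@lin_eq _ _ _ _ (fun v => ratr t *: hmodeK h 0 v + hmodeK h' 0 v)) => [||k _].
  + exact: hmode_lin.
  + by apply: lin_add; [apply: lin_scale|]; exact: hmode_lin.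
  + by rewrite !hmode0 pair_linear rmorphD rmorphM /= scalerDl scalerA.
- rewrite !hmode_annih scaler_sumr -big_split; apply: eq_bigr => i _ /=.
  by rewrite pair_linear rmorphD rmorphM /= scalerA -scalerDl; congr (_ *: _); ring.
- rewrite !hmode_creat scaler_sumr -big_split; apply: eq_bigr => i _ /=.
  by rewrite !mxE rmorphD rmorphM /= scalerA -scalerDl.
Qed.

(** h(0) is multiplication by a function of the charge, which all modes preserve. *)
Lemma hmode0C h h' n v : hmodeK h 0 (hmodeK h' n v : V) = hmodeK h' n (hmodeK h 0 v).
Proof.
apply: (@lin_eq _ _ _ (fun v => hmodeK h 0 (hmodeK h' n v))
   (fun v => hmodeK h' n (hmodeK h 0 v))); [by apply: lin_comp; exact: hmode_lin..|].
move=> k _; rewrite hmode0 (linZ (hmode_lin _ _)).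
have kk := @hmode_hom h' n k.
apply: (@lin_eq _ _ _ (hmodeK h 0) (fun v => ratr (pair G h (kc k)) *: v)) => [||k' /kk /= [<- _]].
- exact: hmode_lin.
- by apply: lin_scale; exact: lin_id.
- exact: hmode0.
Qed.

(** Bilinear extension of a scalar commutator; with d = 0 it covers two modes of the same sign. *)
Lemma sum_comm (I I' : finType) (s : I -> F) (t : I' -> F) (f : I -> V -> V) (g : I' -> V -> V)
    (d : I -> I' -> F) v :
    (forall i, lin (f i)) -> (forall j, lin (g j)) ->
    (forall i j v, f i (g j v) = g j (f i v) + d i j *: v) ->
  \sum_i s i *: f i (\sum_j t j *: g j v)
    = \sum_j t j *: g j (\sum_i s i *: f i v) + (\sum_i \sum_j s i * t j * d i j) *: v.
Proof.
move=> fl gl fg.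
under eq_bigr => i _ do rewrite (lin_sum (fl i)) scaler_sumr.
under [X in _ = X + _]eq_bigr => j _ do rewrite (lin_sum (gl j)) scaler_sumr.
rewrite [X in _ = X + _]exchange_big /= scaler_suml -big_split /=.
apply: eq_bigr => i _; rewrite scaler_suml -big_split /=; apply: eq_bigr => j _.
by rewrite (linZ (fl i)) (linZ (gl j)) fg; malg_ring.
Qed.

Lemma hmode_annih_creat h h' (m n : nat) v : hmodeK h (Posz m.+1) (hmodeK h' (Negz n) v : V)
  = hmodeK h' (Negz n) (hmodeK h (Posz m.+1) v)
    + (if m == n then ratr ((Posz m.+1)%:~R * pair G h h') else 0) *: v.
Proof.
have fg (i j : 'I_r) u : annih (ix i m) (creat (ix j n) u)
    = creat (ix j n) (annih (ix i m) u) + (ix i m == ix j n)%:R *: u.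
  exact: annih_creat.
have ixP (i j : 'I_r) : (ix i m == ix j n) = (i == j) && (m == n).
  apply/eqP/andP => [e|[/eqP -> /eqP ->]//].
  by have := congr1 ji e; have := congr1 jn e; rewrite !jiE !jnE => -> ->.
have sE : \sum_i \sum_j m.+1%:R * ratr (pair G h (delta_mx 0 i)) * ratr (h' 0 j)
      * (ix i m == ix j n)%:R
    = (if m == n then ratr ((Posz m.+1)%:~R * pair G h h') else 0) :> F.
  under eq_bigr => i _ do under eq_bigr => j _ do rewrite ixP.
  case: eqVneq => [_|_]; last first.
    by rewrite big1// => i _; rewrite big1// => j _; rewrite andbF mulr0.
  rewrite rmorphM /= ratr_int pair_sum rmorph_sum mulr_sumr; apply: eq_bigr => i _.
  rewrite (bigD1 i)//= eqxx mulr1 big1 ?addr0 => [|j]; last first.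
    by rewrite eq_sym => /negPf ->; rewrite mulr0.
  by rewrite rmorphM /= mulrA.
rewrite !(hmode_annih, hmode_creat) -sE.
exact: (sum_comm (fun i => m.+1%:R * ratr (pair G h (delta_mx 0 i)))
  (fun j => ratr (h' 0 j)) v (fun i => annih_lin _) (fun j => creat_lin _) fg).
Qed.

Lemma hmode_comm h h' (m n : int) v : hmodeK h m (hmodeK h' n v : V) =
  hmodeK h' n (hmodeK h m v)
    + (if m + n == 0 then ratr (m%:~R * pair G h h') else 0) *: v.
Proof.
have sum0 (s t : 'I_r -> F) : \sum_i \sum_j s i * t j * 0 = 0.
  by rewrite big1// => i _; rewrite big1// => j _; rewrite mulr0.
case: m => [[|m]|m].
- have -> : ratr (0%:~R * pair G h h') = 0 :> F by rewrite mul0r rmorph0.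
  by rewrite hmode0C if_same scale0r addr0.
- case: n => [[|n]|n].
  + by rewrite hmode0C /= scale0r addr0.
  + rewrite !hmode_annih; have -> : (Posz m.+1 + Posz n.+1 == 0) = false by lia.
    have fg (i j : 'I_r) u : annih (ix i m) (annih (ix j n) u)
        = annih (ix j n) (annih (ix i m) u) + 0 *: u.
      by rewrite scale0r addr0; exact: annihC.
    have := sum_comm (fun i => m.+1%:R * ratr (pair G h (delta_mx 0 i)))
      (fun i => n.+1%:R * ratr (pair G h' (delta_mx 0 i))) v
      (fun i => annih_lin _) (fun j => annih_lin _) fg.
    by rewrite sum0.
  + have -> : (Posz m.+1 + Negz n == 0) = (m == n) by apply/eqP/eqP; lia.
    exact: hmode_annih_creat.
- case: n => [[|n]|n].
  + rewrite -hmode0C; have -> : (Negz m + Posz 0 == 0) = false by lia.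
    by rewrite scale0r addr0.
  + have -> : (Negz m + Posz n.+1 == 0) = (n == m) by apply/eqP/eqP; lia.
    rewrite hmode_annih_creat; case: eqVneq => [->|_]; last by malg_ring.
    rewrite pairC NegzE rmorphN /= mulNr rmorphN /=.
    by move: (ratr _) => s; malg_ring.
  + rewrite !hmode_creat; have -> : (Negz m + Negz n == 0) = false by lia.
    have fg (i j : 'I_r) u : creat (ix i m) (creat (ix j n) u)
        = creat (ix j n) (creat (ix i m) u) + 0 *: u.
      by rewrite scale0r addr0; exact: creatC.
    have := sum_comm (fun i => ratr (h 0 i)) (fun j => ratr (h' 0 j)) v
      (fun i => creat_lin _) (fun j => creat_lin _) fg.
    by rewrite sum0.
Qed.

Lemma hmode_gen k : weight (km k) != 0%N -> exists h n k',
  [/\ << k >> = hmodeK h (Negz n) (<< k' >> : V), kc k' = kc k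
    & (weight (km k') < weight (km k))%N].
Proof.
move=> /weight_gt0 [a ma].
exists (delta_mx 0 (ji a)), (jn a), (mk (kc k) (decr (km k) a)).
rewrite kcE kmE (weight_div ma); split=> //; last by lia.
rewrite hmode_creat (bigD1 (ji a))//= mxE !eqxx rmorph1 scale1r ixK big1 ?addr0 => [|j /negPf ja].
  by rewrite creatE decrK// mkK.
by rewrite mxE eqxx ja rmorph0 scale0r.
Qed.

Lemma hmode_nondeg v : (forall h n, hmodeK h (Posz n.+1) v = 0) ->
  keyed [set k | weight (km k) = 0%N] v.
Proof.
move=> hv k kv /=; apply/eqP; apply: contrapT => /negP /weight_gt0 [a ka].
have av : annih a v = 0.
  (* The vector of the dual basis, which exists as G is invertible: its mode is a nonzero multiple
     of the single derivative in a. *)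
  have := hv (delta_mx 0 (ji a) *m invmx G) (jn a); rewrite hmode_annih.
  under eq_bigr => j _ do rewrite pair_delta mulmxKV//.
  rewrite (bigD1 (ji a))//= mxE !eqxx rmorph1 mulr1 ixK big1 ?addr0 => [/eqP|j /negPf ja].
    by rewrite scaler_eq0 pnatr_eq0 /= => /eqP.
  by rewrite mxE eqxx ja rmorph0 mulr0 scale0r.
(* Removing one a from a monomial that contains it is injective, so this coefficient of the
   derivative is the coefficient of v at k times a nonzero exponent. *)
move/(congr1 (mcoeff (mk (kc k) (decr (km k) a)))): av.
rewrite mcoeff0 /annih /linext raddf_sum /= (big_fsetD1 k)//= big_seq_cond big1 => [|k'].
  move/eqP; rewrite addr0 !mcoeffZ mcoeffUU mulr1 mulf_eq0 pnatr_eq0 (negPf ka) orbF.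
  by rewrite mcoeff_eq0 kv.
rewrite andbT !inE /= => /andP[kk' _]; rewrite !mcoeffZ mcoeffU.
have [->|k'a] := eqVneq (km k' a) 0%N; first by rewrite mul0r mulr0.
case: eqVneq => [e|_]; last by rewrite !mulr0.
have e1 := congr1 kc e; have e2 := congr1 km e; rewrite !kcE !kmE in e1 e2.
by move: kk'; rewrite -(mkK k') -(mkK k) e1 -(decrK k'a) e2 decrK// eqxx.
Qed.

(** Transparent, so that charges, keys and modes compute and the concrete spaces of the statement
    are recognised by conversion. *)
Definition fock_space : fockSpace F.
Proof.
apply: (@FockSpace F K 'rV[rat]_r (pair G) kc (fun k => weight (km k))
  (fun l => mk l (@onecm J)) hmodeK) => //.
- exact: pairC.
- exact: pair_linear.
- by move=> l; rewrite kmE; exact: weight_one.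
- by move=> k /weight_eq0 e; rewrite -{1}(mkK k) e.
- exact: hmode_lin.
- exact: hmode_linear.
- exact: hmode_hom.
- exact: hmode0.
- exact: hmode_comm.
- exact: hmode_gen.
- exact: hmode_nondeg.
Defined.

End FockModes.

(** * Commutators with exponential series *)

Section ExponentialSeries.
Variables (F : numFieldType) (V : lmodType F) (A : nat -> V -> V).
Hypothesis A_lin : forall i, lin (A i).
Implicit Types (k m l i : nat) (v : V).

Lemma serpow_lin k m : lin (serpow A k m).
Proof.
elim: k m => [|k IH] m /=; first by case: (m == 0%N); [exact: lin_id|exact: lin_zero].
by apply: lin_bigsum => i; apply: lin_comp.
Qed.

Lemma serexp_lin m : lin (serexp A m).
Proof. by apply: lin_bigsum => k; apply: lin_scale; exact: serpow_lin. Qed.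

Lemma serpow_gt k m v : (m < k)%N -> serpow A k m v = 0.
Proof.
elim: k m v => [|k IH] m v //= mk; rewrite big_nat big1// => i /andP[i0 im].
by rewrite IH ?(lin0 (A_lin _))//; lia.
Qed.

Lemma serexp_wide M m v : (m < M)%N ->
  serexp A m v = \sum_(k < M) (k`!%:R)^-1 *: serpow A k m v.
Proof.
move=> mM; rewrite /serexp -!(big_mkord xpredT (fun k => (k`!%:R)^-1 *: serpow A k m v)).
rewrite (big_cat_nat (n := m.+1) (p := M))//= [X in _ + X]big_nat [X in _ + X]big1 ?addr0//.
by move=> k /andP[mk _]; rewrite serpow_gt ?scaler0.
Qed.

Section Bracket.
Variables (D : V -> V) (l : nat) (c : F).
Hypotheses (D_lin : lin D) (l_gt0 : (0 < l)%N).
Hypothesis DA : forall i v, (0 < i)%N ->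
  D (A i v) = A i (D v) + (if i == l then c *: v else 0).

(** Each of the k factors A(z) contributes its bracket c z^l with D, a scalar that passes through
    the remaining factors. *)
Lemma serpow_bracket k m v : D (serpow A k m v) = serpow A k m (D v)
  + (if (l <= m)%N then (k%:R * c) *: serpow A k.-1 (m - l) v else 0).
Proof.
elim: k m v => [|k IH] m v.
  by rewrite mul0r scale0r if_same addr0 /=; case: ifP => //; rewrite (lin0 D_lin).
rewrite /= (lin_sum D_lin).
(* f collects the k brackets inside the inner power, by induction, and g the bracket with the
   outermost factor. *)
pose f i := (if (l <= m - i)%N then (k%:R * c) *: A i (serpow A k.-1 (m - i - l) v) else 0).
pose g i := if i == l then c *: serpow A k (m - l) v else 0.
have -> : \sum_(1 <= i < m.+1) D (A i (serpow A k (m - i) v))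
  = \sum_(1 <= i < m.+1) (A i (serpow A k (m - i) (D v)) + f i + g i).
  rewrite big_nat [RHS]big_nat; apply: eq_bigr => i /andP[i0 im].
  rewrite DA// IH (linD (A_lin i)) /g; congr (_ + _ + _).
    by rewrite /f; case: ifP => _; rewrite ?(linZ (A_lin i)) ?(lin0 (A_lin i)).
  by case: eqVneq => // ->.
rewrite !big_split /= -addrA; congr (_ + _).
case: (leqP l m) => lm; last first.
  rewrite [X in X + _]big_nat [X in X + _]big1 => [|i _]; last by rewrite /f ifF//; lia.
  rewrite add0r big_nat big1// => i /andP[_ im]; rewrite /g ifF//; lia.
have -> : \sum_(1 <= i < m.+1) g i = c *: serpow A k (m - l) v.
  rewrite (big_cat_nat (n := l))//=; last by lia.
  rewrite big_nat [X in X + _]big1 => [|i /andP[_ il]]; last by rewrite /g ifF//; lia.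
  rewrite add0r big_ltn; last by lia.
  rewrite big_nat [X in _ + X]big1 => [|i /andP[il _]]; last by rewrite /g ifF//; lia.
  by rewrite addr0 /g eqxx.
have -> : \sum_(1 <= i < m.+1) f i = (k%:R * c) *: serpow A k (m - l) v.
  case: k IH @f @g => [|k] IH f g.
    by rewrite mul0r scale0r big1// => i _; rewrite /f mul0r scale0r if_same.
  rewrite (big_cat_nat (n := (m - l).+1))//=; last by lia.
  rewrite [X in _ + X]big_nat [X in _ + X]big1 => [|i /andP[il _]]; last first.
    by rewrite /f ifF//; lia.
  rewrite addr0 /= scaler_sumr big_nat [RHS]big_nat; apply: eq_bigr => i /andP[_ il].
  rewrite /f ifT; last by lia.
  by rewrite subnAC.
by rewrite -scalerDl -natr1 mulrDl mul1r.
Qed.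

(** Dividing k by k! lowers the index of the exponential series: the bracket of D with exp(A(z)) is
    c z^l exp(A(z)). *)
Lemma serexp_bracket m v : D (serexp A m v) = serexp A m (D v)
  + (if (l <= m)%N then c *: serexp A (m - l) v else 0).
Proof.
rewrite /serexp (lin_sum D_lin).
under eq_bigr => k _ do rewrite (linZ D_lin) serpow_bracket scalerDr.
rewrite big_split /=; congr (_ + _); case: (leqP l m) => lm; last first.
  by rewrite big1// => k _; rewrite scaler0.
rewrite -/(serexp A (m - l) v) (@serexp_wide m) ?scaler_sumr; last by lia.
rewrite big_ord_recl /= mul0r scale0r scaler0 add0r; apply: eq_bigr => k _.
rewrite /bump /= add1n !scalerA; congr (_ *: _).
by rewrite factS natrM invfM mulrACA mulVf ?pnatr_eq0// mul1r mulrC.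
Qed.

End Bracket.

Lemma serexp_comm (D : V -> V) : lin D ->
  (forall i v, (0 < i)%N -> D (A i v) = A i (D v)) ->
  forall m v, D (serexp A m v) = serexp A m (D v).
Proof.
move=> Dl DA m v; rewrite (@serexp_bracket D 1 0)// ?scale0r ?if_same ?addr0//.
by move=> i w i0; rewrite scale0r if_same addr0 DA.
Qed.

Lemma serexp0 v : serexp A 0 v = v.
Proof. by rewrite /serexp big_ord1 /= fact0 invr1 scale1r. Qed.

End ExponentialSeries.

(** * The exponential formula satisfies the axioms of a vertex operator *)

Section VertexOperator.
Variables (F : numFieldType) (S : fockSpace F).
Local Notation L := (charges S).
Local Notation V := {malg F[fkeys S]}.
Local Notation "<[ a , b ]>" := (@pr F S a b).
Variables (sh : L -> V -> V) (b : L).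
Hypothesis sh_lin : lin (sh b).
Hypothesis sh_hsp : forall l q v, hsp l q v -> hsp (l + b) q (sh b v).
Hypothesis sh_vac : forall l, sh b << vac l >> = << vac (l + b) >>.
Hypothesis sh_hm : forall h n v, n != 0 -> hm h n (sh b v) = sh b (hm h n v).
Implicit Types (h l : L) (x y q : rat) (v : V).
Local Notation hml := (@hm_lin F S).

Definition cre_coef i v : V := (i%:R)^-1 *: hm b (- i%:Z) v.
Definition ann_coef i v : V := - ((i%:R)^-1 *: hm b i%:Z v).

Definition vopS : fieldOn V := fun x =>
  linext (fun k : fkeys S =>
    \sum_(st \in [set st : nat * nat | <[b, ch k]> + st.1%:R - st.2%:R = - x - 1])
      sh b (serexp cre_coef st.1 (serexp ann_coef st.2 << k >>))).

Lemma cre_lin i : lin (cre_coef i). Proof. by apply: lin_scale; exact: hml. Qed.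
Lemma ann_lin i : lin (ann_coef i).
Proof. by apply: lin_opp; apply: lin_scale; exact: hml. Qed.

Lemma serexp_hsp (A : nat -> V -> V) (s : rat) :
    (forall i l q v, hsp l q v -> hsp l (q + s * i%:R) (A i v)) ->
  forall m l q v, hsp l q v -> hsp l (q + s * m%:R) (serexp A m v).
Proof.
move=> Ah m l q v vq; apply: keyed_sum => k _; apply: keyedZ.
move: (nat_of_ord k) => {}k; elim: k m => [|k IH] m /=.
  by case: eqVneq => [->|_]; [rewrite mulr0 addr0|exact: keyed0].
rewrite big_nat; apply: keyed_sum => i /andP[i0 im].
by apply: hspE (Ah i _ _ _ (IH (m - i)%N)); rewrite natrB; [ring|lia].
Qed.

Arguments serexp_hsp {A s} Ah m {l q v} vq : rename.

Lemma cre_hsp i l q v : hsp l q v -> hsp l (q + 1 * i%:R) (cre_coef i v).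
Proof.
by move=> vq; apply: keyedZ; apply: hspE (hm_hsp b (- i%:Z) vq); rewrite rmorphN /=; ring.
Qed.

Lemma ann_hsp i l q v : hsp l q v -> hsp l (q + -1 * i%:R) (ann_coef i v).
Proof.
move=> vq; apply: keyedN; apply: keyedZ; apply: hspE (hm_hsp b i%:Z vq).
by rewrite -[(Posz i)%:~R]/(i%:R : rat); ring.
Qed.

(** Zero off the natural numbers: this turns the sum over pairs (s, t) in [vopS] into a sum over t
    alone, with s = q determined by the mode and the charge. *)
Definition cre_exp q v : V := if q \is a Num.nat then serexp cre_coef (Num.truncn q) v else 0.

Lemma cre_exp_nat (m : nat) v : cre_exp m%:R v = serexp cre_coef m v.
Proof. by rewrite /cre_exp natr_nat natrK. Qed.

Lemma cre_exp_lin q : lin (cre_exp q).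
Proof.
rewrite /cre_exp; case: (q \is a Num.nat); last exact: lin_zero.
by apply: serexp_lin; exact: cre_lin.
Qed.

Lemma vopS_key x k :
  sumsto (fun t => sh b (cre_exp (- x - 1 - <[b, ch k]> + t%:R) (serexp ann_coef t << k >>)))
    (vopS x << k >>).
Proof.
set u := fun t : nat => _.
have -> : vopS x << k >> = \sum_(t \in [set: nat]) u t.
  rewrite /vopS linextE.
  (* The admissible pairs are parametrised by t; truncation is exact on the naturals, and the
     remaining t contribute 0. *)
  pose f t := (Num.truncn (- x - 1 - <[b, ch k]> + t%:R), t).
  rewrite (@reindex_fsbig _ _ _ _ _ f [set t | - x - 1 - <[b, ch k]> + t%:R \is a Num.nat]).
    rewrite -(@fsbig_widen _ _ _ _ [set t | - x - 1 - <[b, ch k]> + t%:R \is a Num.nat] setT)//.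
      by apply: eq_fsbigr => t; rewrite inE /= => tn; rewrite /u /cre_exp tn.
    move=> t [_ /= /negP tn]; rewrite /u /cre_exp (negPf tn); exact: lin0.
  split.
  - by move=> t /= tn; rewrite truncnK//; ring.
  - by move=> t t' _ _ [].
  - move=> [s t] /= e; have {}e : - x - 1 - <[b, ch k]> + t%:R = s%:R by rewrite -e; ring.
    by exists t; rewrite /f /= e ?natrK.
apply: sumsto_fsumP; exists (dg k).+1 => t kt; rewrite /u.
have kh := serexp_hsp ann_hsp t (hsp_key k).
rewrite (hsp_eq0 kh) ?(lin0 (cre_exp_lin _)) ?(lin0 sh_lin)//.
by move: kt; rewrite -(ltr_nat rat); lra.
Qed.

(** The bound on the series depends on the basis vector; a vector involves finitely many, so the
    maximum serves. *)
Lemma sumsto_keys (P : set (fkeys S)) (f : nat -> V -> V) (g : V -> V) :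
    (forall t, lin (f t)) -> lin g ->
    (forall k, P k -> sumsto (fun t => f t << k >>) (g << k >>)) ->
  forall v, keyed P v -> sumsto (fun t => f t v) (g v).
Proof.
move=> fl gl fg v Pv.
have [M vM] : exists M, forall k, k \in msupp v -> forall t, (M <= t)%N ->
    \sum_(j < t) f j << k >> = g << k >>.
  suff H (s : seq (fkeys S)) : (forall k, k \in s -> P k) ->
      exists M, forall k, k \in s -> forall t, (M <= t)%N ->
        \sum_(j < t) f j << k >> = g << k >>.
    exact: (H (enum_fset (msupp v))).
  elim: s => [|k s IH] sP; first by exists 0%N => k; rewrite in_nil.
  have [|M sM] := IH; first by move=> k' k's; apply: sP; rewrite inE k's orbT.
  have [M' kM'] := fg k (sP k (mem_head _ _)).
  exists (maxn M M') => k'; rewrite inE => /orP[/eqP ->|k's] t; rewrite geq_max => /andP[Mt M't].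
    exact: kM'.
  exact: sM.
exists M => t Mt; apply: (@lin_eq _ _ _ (fun v => \sum_(j < t) f j v) g) => // [|k kv].
  exact: lin_bigsum.
exact: vM.
Qed.

Lemma vopS_lin x : lin (vopS x). Proof. exact: linext_lin. Qed.

Lemma vopS_sum x l v : keyed [set k | ch k = l] v ->
  sumsto (fun t => sh b (cre_exp (- x - 1 - <[b, l]> + t%:R) (serexp ann_coef t v))) (vopS x v).
Proof.
apply: (sumsto_keys (f := fun t v => sh b (cre_exp _ (serexp ann_coef t v)))) => [t||k /= <-].
- apply: (lin_comp sh_lin); apply: (lin_comp (cre_exp_lin _)).
  by apply: serexp_lin; exact: ann_lin.
- exact: vopS_lin.
- exact: vopS_key.
Qed.

Lemma vopS_hsp l q v x : hsp l q v -> hsp (l + b) (q - x - 1 - <[b, l]>) (vopS x v).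
Proof.
move=> vq; have := vopS_sum x (hsp_ch vq) => /sumsto_fsum <-.
apply: keyed_fsum => t _; apply: sh_hsp; rewrite /cre_exp.
case: ifPn => [qn|_]; last exact: keyed0.
apply: hspE (serexp_hsp cre_hsp _ (serexp_hsp ann_hsp t vq)).
by rewrite truncnK//; ring.
Qed.

(** For n > 0, h(n) meets only the coefficient b(-n)/n of the exponent, with commutator <h,b>. *)
Lemma serexp_cre_hm h n m v : serexp cre_coef m (hm h n v)
    + (if (0 < n) && (n <= m%:Z) then ratr <[h, b]> *: serexp cre_coef (m - absz n) v else 0)
  = hm h n (serexp cre_coef m v).
Proof.
have comm i w : (0 < i)%N -> hm h n (cre_coef i w) = cre_coef i (hm h n w)
    + (if n == i%:Z then ratr <[h, b]> *: w else 0).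
  move=> i0; rewrite /cre_coef (linZ (hml _ _)) hm_comm scalerDr subr_eq0.
  congr (_ + _); case: eqVneq => [->|_]; last by rewrite scale0r scaler0.
  rewrite scalerA rmorphM /= -[(Posz i)%:~R]/(i%:R : rat) ratr_nat mulKf//.
  by rewrite pnatr_eq0 -lt0n.
case: n comm => [[|n]|n] comm.
- rewrite addr0; apply/esym/serexp_comm => [||i w i0]; [exact: cre_lin|exact: hml|].
  by rewrite comm// ifF ?addr0//; apply/negbTE; rewrite eq_sym -lt0n.
- have -> : (0 < Posz n.+1) && (Posz n.+1 <= m%:Z) = (n.+1 <= m)%N by [].
  apply/esym/(serexp_bracket cre_lin (hml _ _)) => // i w i0.
  by rewrite comm// [i == _]eq_sym.
- rewrite addr0; apply/esym/serexp_comm => [||i w i0].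
  + exact: cre_lin.
  + exact: hml.
  + by rewrite comm// addr0.
Qed.

Lemma serexp_ann_hm h n m v : serexp ann_coef m (hm h n v)
    + (if (n < 0) && (- n <= m%:Z) then ratr <[h, b]> *: serexp ann_coef (m - absz n) v else 0)
  = hm h n (serexp ann_coef m v).
Proof.
have comm i w : (0 < i)%N -> hm h n (ann_coef i w) = ann_coef i (hm h n w)
    + (if - n == i%:Z then ratr <[h, b]> *: w else 0).
  move=> i0; rewrite /ann_coef (linN (hml _ _)) (linZ (hml _ _)) hm_comm scalerDr opprD.
  congr (_ + _); have -> : (n + i%:Z == 0) = (- n == i%:Z) by apply/eqP/eqP; lia.
  case: eqVneq => [e|_]; last by rewrite scale0r scaler0 oppr0.
  have -> : n = - i%:Z by lia.
  rewrite scalerA rmorphN mulNr rmorphN mulrN scaleNr opprK.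
  rewrite rmorphM /= -[(Posz i)%:~R]/(i%:R : rat) ratr_nat mulKf//.
  by rewrite pnatr_eq0 -lt0n.
case: n comm => [n|n] comm.
- rewrite addr0; apply/esym/serexp_comm => [||i w i0]; [exact: ann_lin|exact: hml|].
  by rewrite comm// ifF ?addr0//; lia.
- have -> : (Negz n < 0) && (- Negz n <= m%:Z) = (n.+1 <= m)%N by [].
  apply/esym/(serexp_bracket ann_lin (hml _ _)) => // i w i0.
  rewrite comm//; congr (_ + _); have -> : (- Negz n == i%:Z) = (i == n.+1) by apply/eqP/eqP; lia.
  by [].
Qed.

Lemma cre_exp_hm_pos h (n : nat) q v : (0 < n)%N ->
  hm h n (cre_exp q v) = cre_exp q (hm h n v) + ratr <[h, b]> *: cre_exp (q - n%:R) v.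
Proof.
move=> n0; rewrite /cre_exp; case: (boolP (q \is a Num.nat)) => [/natrP[m ->]|qn].
  rewrite natrK -serexp_cre_hm ltz_nat n0 /= lez_nat; congr (_ + _).
  case: leqP => [nm|mn]; first by rewrite -natrB// natr_nat natrK.
  rewrite ifN ?scaler0//; apply/negP => /natr_ge0; rewrite subr_ge0 ler_nat; lia.
rewrite (lin0 (hml _ _)) add0r ifN ?scaler0//.
apply: contra qn => /natrP[m e]; have -> : q = (m + n)%:R by rewrite natrD -e subrK.
exact: natr_nat.
Qed.

Lemma cre_exp_hm_neg h n q v : n <= 0 -> hm h n (cre_exp q v) = cre_exp q (hm h n v).
Proof.
move=> n0; rewrite /cre_exp; case: (q \is a Num.nat); last exact: (lin0 (hml h n)).
by rewrite -serexp_cre_hm ifF ?addr0//; lia.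
Qed.

Arguments vopS_hsp {l q v} x _.

Lemma vopS_covariant : covariant b vopS.
Proof.
move=> h n x v; apply/eqP; rewrite -subr_eq0; apply/eqP.
pose D v := hm h n (vopS x v) - (vopS x (hm h n v) + ratr <[h, b]> *: vopS (x + n%:~R) v).
have vl := vopS_lin.
apply: (charge_decomp (D := D)) => [|l {}v vh].
  apply: lin_add; first exact: (lin_comp (hml h n) (vl x)).
  apply: lin_opp; apply: lin_add; first exact: (lin_comp (vl x) (hml h n)).
  by apply: lin_scale; exact: vl.
have hvh : keyed [set k | ch k = l] (hm h n v).
  refine (keyed_lin (hml h n) _ vh) => k /= <-.
  by apply: (keyedW _ (@hm_hom F S h n k)) => k' [].
apply/eqP; rewrite /D subr_eq0; apply/eqP.
(* h(0) sees neither series; its commutator comes from the charge b added by the shift. Positive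
   modes meet the creation series, negative ones the annihilation series. *)
have [n0|n0] := eqVneq n 0.
  have wh : keyed [set k | ch k = l + b] (vopS x v).
    refine (keyed_lin (vl x) _ vh) => k /= <-.
    exact: (hsp_ch (vopS_hsp x (hsp_key k))).
  rewrite n0 addr0 (hm0_ch h vh) (hm0_ch h wh) (linZ (vl x)) prDr rmorphD /=.
  by malg_ring.
apply: (sumsto_uniq (sumsto_lin (hml h n) (vopS_sum x vh))).
have S1 := vopS_sum x hvh; have S2 := sumstoZ (ratr <[h, b]>) (vopS_sum (x + n%:~R) vh).
have El t : lin (serexp ann_coef t) by apply: serexp_lin; exact: ann_lin.
case: n n0 {hvh D} S1 S2 => [n|n] n0 S1 S2.
  apply: eq_sumsto (sumstoD S1 S2) => t; rewrite sh_hm// cre_exp_hm_pos ?lt0n//.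
  rewrite (linD sh_lin) (linZ sh_lin) -serexp_ann_hm addr0.
  have -> : - x - 1 - <[b, l]> + t%:R - n%:R = - (x + (Posz n)%:~R) - 1 - <[b, l]> + t%:R.
    by rewrite -[(Posz n)%:~R]/(n%:R : rat); ring.
  by [].
(* The annihilation series loses n+1 from its index, so the sum for the shifted mode is delayed by
   n+1 terms to match. *)
have S3 : sumsto (fun t => if (n.+1 <= t)%N then ratr <[h, b]> *:
      sh b (cre_exp (- x - 1 - <[b, l]> + t%:R) (serexp ann_coef (t - n.+1) v)) else 0)
    (ratr <[h, b]> *: vopS (x + (Negz n)%:~R) v).
  apply: eq_sumsto (sumsto_delay n.+1 S2) => t; case: leqP => // nt.
  have -> : - (x + (Negz n)%:~R) - 1 - <[b, l]> + (t - n.+1)%:R = - x - 1 - <[b, l]> + t%:R.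
    by rewrite NegzE rmorphN /= -[(Posz _)%:~R]/(n.+1%:R : rat) natrB//; ring.
  by [].
apply: eq_sumsto (sumstoD S1 S3) => t; rewrite sh_hm// cre_exp_hm_neg//.
rewrite -serexp_ann_hm (linD (cre_exp_lin _)) (linD sh_lin); congr (_ + _).
have -> : (Negz n < 0) && (- Negz n <= t%:Z) = (n.+1 <= t)%N by lia.
case: ifP => _; last by rewrite (lin0 (cre_exp_lin _)) (lin0 sh_lin).
by rewrite (linZ (cre_exp_lin _)) (linZ sh_lin).
Qed.

Lemma vopS_vac l : vopS (-1 - <[b, l]>) << vac l >> = << vac (l + b) >>.
Proof.
have := vopS_key (-1 - <[b, l]>) (vac l); rewrite ch_vac => /sumsto_uniq; apply.
apply: eq_sumsto (sumsto1 0%N _) => t.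
have -> : - (-1 - <[b, l]>) - 1 - <[b, l]> + t%:R = t%:R by ring.
rewrite cre_exp_nat; case: t => [|t] /=; first by rewrite !serexp0 sh_vac.
have th := serexp_hsp ann_hsp t.+1 (hsp_vac l).
rewrite (hsp_eq0 th) ?(lin0 (serexp_lin cre_lin _)) ?(lin0 sh_lin)//.
by rewrite add0r mulN1r oppr_lt0 ltr0n.
Qed.

Lemma vopS_vertex_op : vertex_op b vopS.
Proof.
split; [split=> [x|l q v x vq]|exact: vopS_covariant|exact: vopS_vac].
- exact: vopS_lin.
- by apply: hspE (vopS_hsp x vq); ring.
Qed.

End VertexOperator.

(** * Tensor products *)

Section FSums.
Variables (F : numFieldType) (I : choiceType) (V : lmodType F).
Implicit Types f g : I -> V.

Definition fsupp f := finite_set [set i | f i != 0].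

Lemma fsum_seq f (s : seq I) : (forall i, i \notin s -> f i = 0) ->
  fsupp f /\ \sum_(i \in [set: I]) f i = \sum_(i <- undup s) f i.
Proof.
move=> f0; split.
  apply: (@sub_finite_set _ _ [set` s]); last exact: finite_seq.
  by move=> i /= fi; apply: contraT => /f0 fi0; rewrite fi0 eqxx in fi.
rewrite [RHS]fsbig_seq ?undup_uniq//; apply/esym/fsbig_widen => // i [_ /= /negP].
by rewrite mem_undup => /f0.
Qed.

Lemma fsuppP f : fsupp f -> exists s : seq I, forall i, i \notin s -> f i = 0.
Proof.
move=> /finite_seqP[s sE]; exists s => i si; apply: contraNeq si => fi.
by have : [set i | f i != 0] i by []; rewrite sE.
Qed.

Lemma fsum_add f g : fsupp f -> fsupp g ->
  fsupp (fun i => f i + g i) /\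
  \sum_(i \in [set: I]) (f i + g i) = \sum_(i \in [set: I]) f i + \sum_(i \in [set: I]) g i.
Proof.
move=> /fsuppP[s fs] /fsuppP[t gt].
have [f0 g0] : (forall i, i \notin s ++ t -> f i = 0) /\ (forall i, i \notin s ++ t -> g i = 0).
  by split=> i; rewrite mem_cat negb_or => /andP[/fs + /gt].
have fg0 i : i \notin s ++ t -> f i + g i = 0 by move=> st; rewrite f0// g0// addr0.
have [fgf ->] := fsum_seq fg0; split=> //.
by rewrite (fsum_seq f0).2 (fsum_seq g0).2 big_split.
Qed.

Lemma fsupp0 : fsupp (fun=> 0).
Proof. by have [] := @fsum_seq (fun=> 0) [::] (fun _ _ => erefl). Qed.

Lemma fsum_bigsum (f : nat -> I -> V) M : (forall j, fsupp (f j)) ->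
  \sum_(i \in [set: I]) \sum_(j < M) f j i = \sum_(j < M) \sum_(i \in [set: I]) f j i.
Proof.
move=> ff; suff [] : fsupp (fun i => \sum_(j < M) f j i) /\
  \sum_(i \in [set: I]) \sum_(j < M) f j i = \sum_(j < M) \sum_(i \in [set: I]) f j i by [].
elim: M => [|M [IH1 IH2]].
  rewrite big_ord0; split; last by apply: fsbig1 => i _; rewrite big_ord0.
  by apply: sub_finite_set fsupp0 => i /=; rewrite big_ord0.
rewrite big_ord_recr /= -IH2 -(fsum_add IH1 (ff M)).2; split.
  by apply: sub_finite_set (fsum_add IH1 (ff M)).1 => i /=; rewrite big_ord_recr.
by apply: eq_fsbigr => i _; rewrite big_ord_recr.
Qed.

Lemma fsum_lin (W : lmodType F) (D : V -> W) f : lin D -> fsupp f ->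
  D (\sum_(i \in [set: I]) f i) = \sum_(i \in [set: I]) D (f i).
Proof.
move=> Dl ff; apply: lin_fsum => //; apply: sub_finite_set ff => i [].
by [].
Qed.

Lemma fsum_single f i : (forall j, j != i -> f j = 0) -> \sum_(j \in [set: I]) f j = f i.
Proof.
move=> f0; have fi : forall j, j \notin [:: i] -> f j = 0 by move=> j; rewrite inE; exact: f0.
by rewrite (fsum_seq fi).2 big_seq1.
Qed.

End FSums.

Lemma fsupp_scale (F : numFieldType) (I : choiceType) (V : lmodType F) t (f : I -> V) :
  fsupp f -> fsupp (fun i => t *: f i).
Proof.
by apply: sub_finite_set => i /=; apply: contraNN => /eqP ->; rewrite scaler0.
Qed.

Lemma fsum_scale (F : numFieldType) (I : choiceType) (V : lmodType F) t (f : I -> V) :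
  fsupp f -> \sum_(i \in [set: I]) t *: f i = t *: \sum_(i \in [set: I]) f i.
Proof. by move=> ff; rewrite (fsum_lin (lin_scale t (@lin_id _ V)) ff). Qed.

(** The bound holds for all rational modes at once, unlike that of [hf_trunc]; sums over y in the
    tensor product need this. *)
Lemma hf_ub (F : numFieldType) (S : fockSpace F) b d (X : fieldOn {malg F[fkeys S]}) : hfield b d X ->
  forall u, exists N : nat, forall y, N%:R < y -> X y u = 0.
Proof.
move=> Xf u; rewrite (malg_sum u).
elim/big_ind : _ => [|u1 u2 [N N1] [N' N2]|k _].
- by exists 0%N => y _; rewrite (lin0 (hf_lin Xf y)).
- exists (maxn N N') => y; rewrite (linD (hf_lin Xf y)) => Ny.
  by rewrite N1 ?N2 ?addr0//; apply: le_lt_trans Ny; rewrite ler_nat ?leq_maxl ?leq_maxr.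
- have [N rN] := natr_gt ((dg k)%:R - pr b (ch k) + d).
  exists N => y Ny; rewrite (linZ (hf_lin Xf y)).
  by have kh := hf_hom Xf y (hsp_key k); rewrite (hsp_eq0 kh) ?scaler0//; lra.
Qed.

Lemma fsupp_lin (F : numFieldType) (I : choiceType) (V W : lmodType F) (D : V -> W)
  (f : I -> V) : lin D -> fsupp f -> fsupp (fun i => D (f i)).
Proof.
by move=> Dl; apply: sub_finite_set => i /=; apply: contraNN => /eqP ->; rewrite (lin0 Dl).
Qed.

Section TensorProduct.
Variables (F : numFieldType) (S1 S2 : fockSpace F) (K : choiceType).
Variables (p1 : K -> fkeys S1) (p2 : K -> fkeys S2) (mk : fkeys S1 -> fkeys S2 -> K).
Hypotheses (mkK : forall k, mk (p1 k) (p2 k) = k).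
Hypotheses (p1E : forall k1 k2, p1 (mk k1 k2) = k1) (p2E : forall k1 k2, p2 (mk k1 k2) = k2).
Local Notation V1 := {malg F[fkeys S1]}.
Local Notation V2 := {malg F[fkeys S2]}.
Local Notation T := {malg F[K]}.
Local Notation L := (charges S1 * charges S2)%type.
Implicit Types (u : V1) (w : V2) (v : T) (x y z : rat).

Definition tensK u w : T :=
  \sum_(k1 <- msupp u) \sum_(k2 <- msupp w) (u@_k1 * w@_k2) *: << mk k1 k2 >>.

Lemma tensK_linext u w :
  tensK u w = linext (fun k1 => linext (fun k2 => << mk k1 k2 >>) w) u.
Proof.
apply: eq_bigr => k1 _; rewrite scaler_sumr; apply: eq_bigr => k2 _.
by rewrite scalerA.
Qed.

Lemma tens_linl w : lin (fun u => tensK u w).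
Proof. by move=> t u u'; rewrite !tensK_linext linext_lin. Qed.

Lemma tens_linr u : lin (tensK u).
Proof.
have e w : tensK u w = \sum_(k1 <- msupp u) u@_k1 *: linext (fun k2 => << mk k1 k2 >>) w.
  exact: tensK_linext.
have ll : lin (fun w => \sum_(k1 <- msupp u) u@_k1 *: linext (fun k2 => << mk k1 k2 >>) w).
  apply: (@lin_bigsum F _ _ _ _ _ (fun k1 w => u@_k1 *: linext _ w)) => k1.
  by apply: lin_scale; exact: linext_lin.
by move=> t w w'; rewrite !e ll.
Qed.

Lemma tens1 k1 k2 : tensK << k1 >> << k2 >> = << mk k1 k2 >>.
Proof. by rewrite tensK_linext !linextE. Qed.

Lemma tens_key k : << k >> = tensK << p1 k >> << p2 k >>.
Proof. by rewrite tens1 mkK. Qed.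

Lemma tens_sum (f : V1 -> V1) (g : V2 -> V2) u w : lin f -> lin g ->
  tensK (f u) (g w) = \sum_(k1 <- msupp u) \sum_(k2 <- msupp w)
    (u@_k1 * w@_k2) *: tensK (f << k1 >>) (g << k2 >>).
Proof.
move=> fl gl; rewrite {1}(malg_sum u) (lin_sum fl) (lin_sum (tens_linl _)).
apply: eq_bigr => k1 _; rewrite (linZ fl) (linZ (tens_linl _)).
rewrite {1}(malg_sum w) (lin_sum gl) (lin_sum (tens_linr _)) scaler_sumr.
by apply: eq_bigr => k2 _; rewrite (linZ gl) (linZ (tens_linr _)) scalerA.
Qed.

Lemma lin_tens (D : T -> T) (f : V1 -> V2 -> T) :
    lin D -> (forall w, lin (f^~ w)) -> (forall u, lin (f u)) ->
    (forall k1 k2, D << mk k1 k2 >> = f << k1 >> << k2 >>) ->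
  forall u w, D (tensK u w) = f u w.
Proof.
move=> Dl fl fr Df u w.
apply: (@lin_eq _ _ _ (fun u => D (tensK u w)) (f^~ w)) => // [|k1 _].
  exact: lin_comp Dl (tens_linl w).
apply: (@lin_eq _ _ _ (fun w => D (tensK _ w))) => // [|k2 _].
  exact: lin_comp Dl (tens_linr _).
by rewrite tens1.
Qed.

Lemma keyed_tens (P : set (fkeys S1)) (Q : set (fkeys S2)) u w :
  keyed P u -> keyed Q w -> keyed [set k | P (p1 k) /\ Q (p2 k)] (tensK u w).
Proof.
move=> Pu Qw; rewrite /tensK big_seq_cond; apply: keyed_sum => k1 /andP[/Pu k1P _].
rewrite big_seq_cond; apply: keyed_sum => k2 /andP[/Qw k2Q _].
by apply: keyedZ; apply: keyed1; rewrite /= p1E p2E.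
Qed.

Definition hmT (h : L) (n : int) : T -> T := linext (fun k =>
  tensK (hm h.1 n << p1 k >>) << p2 k >> + tensK << p1 k >> (hm h.2 n << p2 k >>)).

Lemma hmT_lin h n : lin (hmT h n). Proof. exact: linext_lin. Qed.

Lemma hmT_tens h n u w :
  hmT h n (tensK u w) = tensK (hm h.1 n u) w + tensK u (hm h.2 n w).
Proof.
apply: (lin_tens (f := fun u w => tensK (hm h.1 n u) w + tensK u (hm h.2 n w))).
- exact: hmT_lin.
- move=> w'; apply: lin_add; last exact: tens_linl.
  exact: (lin_comp (tens_linl w') (@hm_lin F S1 _ _)).
- move=> u'; apply: lin_add; first exact: tens_linr.
  exact: (lin_comp (tens_linr u') (@hm_lin F S2 _ _)).
by move=> k1 k2; rewrite /hmT linextE p1E p2E.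
Qed.

(** Contraction with a dual basis vector of one factor; it reduces nondegeneracy of the tensor
    product to that of the factors. *)
Definition sliceR k2 v : V1 := linext (fun k => if p2 k == k2 then << p1 k >> else 0) v.
Definition sliceL k1 v : V2 := linext (fun k => if p1 k == k1 then << p2 k >> else 0) v.

Lemma sliceR_coef k2 v k1 : (sliceR k2 v)@_k1 = v@_(mk k1 k2).
Proof.
apply: (@lin_eq _ _ F^o (fun v => (sliceR k2 v)@_k1) (mcoeff (mk k1 k2))) => [||k _].
- by move=> t u w; rewrite /sliceR linext_lin mcoeffD mcoeffZ.
- by move=> t u w; rewrite mcoeffD mcoeffZ.
rewrite /sliceR linextE mcoeffU; case: eqVneq => [e|pk].
  rewrite mcoeffU; suff -> : (p1 k == k1) = (k == mk k1 k2) by [].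
  apply/eqP/eqP => [e'|->]; last by rewrite p1E.
  by rewrite -(mkK k) e e'.
by rewrite mcoeff0; case: eqVneq => // e; rewrite e p2E eqxx in pk.
Qed.

Lemma sliceL_coef k1 v k2 : (sliceL k1 v)@_k2 = v@_(mk k1 k2).
Proof.
apply: (@lin_eq _ _ F^o (fun v => (sliceL k1 v)@_k2) (mcoeff (mk k1 k2))) => [||k _].
- by move=> t u w; rewrite /sliceL linext_lin mcoeffD mcoeffZ.
- by move=> t u w; rewrite mcoeffD mcoeffZ.
rewrite /sliceL linextE mcoeffU; case: eqVneq => [e|pk].
  rewrite mcoeffU; suff -> : (p2 k == k2) = (k == mk k1 k2) by [].
  apply/eqP/eqP => [e'|->]; last by rewrite p2E.
  by rewrite -(mkK k) e e'.
by rewrite mcoeff0; case: eqVneq => // e; rewrite e p1E eqxx in pk.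
Qed.

Lemma tens_coef u w k1 k2 : (tensK u w)@_(mk k1 k2) = u@_k1 * w@_k2.
Proof.
apply: (@lin_eq _ _ F^o (fun u => (tensK u w)@_(mk k1 k2)) (fun u => u@_k1 * w@_k2)) => [||i1 _].
- by move=> t u1 u2; rewrite (tens_linl w) mcoeffD mcoeffZ.
- by move=> t u1 u2; rewrite mcoeffD mcoeffZ mulrDl -mulrA.
apply: (@lin_eq _ _ F^o (fun w => (tensK _ w)@_(mk k1 k2)) (fun w => _ * w@_k2)) => [||i2 _].
- by move=> t u1 u2; rewrite (tens_linr _) mcoeffD mcoeffZ.
- by move=> t u1 u2; rewrite mcoeffD mcoeffZ mulrDr mulrCA.
rewrite tens1 !mcoeffU -natrM mulnb.
suff -> : (mk i1 i2 == mk k1 k2) = (i1 == k1) && (i2 == k2) by [].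
apply/eqP/andP => [e|[/eqP -> /eqP ->]//].
by have := congr1 p1 e; have := congr1 p2 e; rewrite !p1E !p2E => -> ->.
Qed.

Lemma sliceR_tens k2 u w : sliceR k2 (tensK u w) = w@_k2 *: u.
Proof. by apply/malgP => k1; rewrite sliceR_coef tens_coef mcoeffZ mulrC. Qed.

Lemma sliceL_tens k1 u w : sliceL k1 (tensK u w) = u@_k1 *: w.
Proof. by apply/malgP => k2; rewrite sliceL_coef tens_coef mcoeffZ. Qed.

Definition prT (a b : L) : rat := pr a.1 b.1 + pr a.2 b.2.

Lemma hmT_hom h n k : keyed [set k' | (ch (p1 k'), ch (p2 k')) = (ch (p1 k), ch (p2 k)) :> L /\
  (dg (p1 k') + dg (p2 k'))%N%:Z = (dg (p1 k) + dg (p2 k))%N%:Z - n] (hmT h n << k >>).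
Proof.
rewrite /hmT linextE; apply: keyedD.
  apply: (keyedW _ (keyed_tens (@hm_hom _ _ h.1 n (p1 k)) (keyed1 (P := [set p2 k]) erefl))).
  by move=> k' /= [[-> e] ->]; split=> //; lia.
apply: (keyedW _ (keyed_tens (keyed1 (P := [set p1 k]) erefl) (@hm_hom _ _ h.2 n (p2 k)))).
by move=> k' /= [-> [-> e]]; split=> //; lia.
Qed.

Lemma hmT_comm h h' m n v : hmT h m (hmT h' n v) = hmT h' n (hmT h m v)
  + (if m + n == 0 then ratr (m%:~R * prT h h') else 0) *: v.
Proof.
set c := if _ then _ else _.
apply: (@lin_eq _ _ _ (fun v => hmT h m (hmT h' n v)) (fun v => hmT h' n (hmT h m v) + c *: v)).
- exact: (lin_comp (hmT_lin h m) (hmT_lin h' n)).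
- apply: lin_add; first exact: (lin_comp (hmT_lin h' n) (hmT_lin h m)).
  by apply: lin_scale; exact: lin_id.
move=> k _; rewrite tens_key !hmT_tens (linD (hmT_lin h m)) (linD (hmT_lin h' n)) !hmT_tens.
rewrite (hm_comm h.1 h'.1) (hm_comm h.2 h'.2).
rewrite (linD (tens_linl _)) (linZ (tens_linl _)) (linD (tens_linr _)) (linZ (tens_linr _)).
have -> : c = (if m + n == 0 then ratr (m%:~R * pr h.1 h'.1) else 0)
    + (if m + n == 0 then ratr (m%:~R * pr h.2 h'.2) else 0).
  rewrite /c /prT; case: ifP => _; last by rewrite addr0.
  by rewrite mulrDr rmorphD.
by malg_ring.
Qed.

Definition tens_space : fockSpace F.
Proof.
apply: (@FockSpace F K L prT (fun k => (ch (p1 k), ch (p2 k)))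
  (fun k => dg (p1 k) + dg (p2 k))%N (fun l => mk (vac l.1) (vac l.2)) hmT).
- by move=> a b; rewrite /prT prC [X in _ + X]prC.
- by move=> t a b c; rewrite /prT /= !pr_linear; ring.
- by move=> [l1 l2]; rewrite p1E p2E !ch_vac.
- by move=> l; rewrite p1E p2E !dg_vac.
- move=> k /eqP; rewrite addn_eq0 => /andP[/eqP k1 /eqP k2].
  by rewrite -[LHS]mkK (dg0_vac k1) (dg0_vac k2) !ch_vac.
- exact: hmT_lin.
- move=> t h h' n v.
  apply: (@lin_eq _ _ _ _ (fun v => ratr t *: hmT h n v + hmT h' n v)) => [||k _].
  + exact: hmT_lin.
  + by apply: lin_add; [apply: lin_scale|]; exact: hmT_lin.
  rewrite tens_key !hmT_tens /= !hm_linear (linD (tens_linl _)) (linZ (tens_linl _)).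
  by rewrite (linD (tens_linr _)) (linZ (tens_linr _)); malg_ring.
- exact: hmT_hom.
- move=> h k; rewrite tens_key hmT_tens !hm0 (linZ (tens_linl _)) (linZ (tens_linr _)).
  by rewrite /prT rmorphD /=; malg_ring.
- exact: hmT_comm.
(* A creation mode is split off the first factor if that has positive degree, and off the second
   otherwise. *)
- move=> k; have [k0|k0 _] := eqVneq (dg (p1 k)) 0%N; last first.
    have [h [n [k1 [e1 e2 e3]]]] := hm_gen k0.
    exists (h, 0), n, (mk k1 (p2 k)); rewrite !p1E !p2E e2; split=> //; last by rewrite ltn_add2r.
    by rewrite -tens1 hmT_tens /= hm0l (lin0 (tens_linr _)) addr0 -e1 -tens_key.
  have k0' := k0; rewrite k0 add0n => {}k0; have [h [n [k2 [e1 e2 e3]]]] := hm_gen k0.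
  exists (0, h), n, (mk (p1 k) k2); rewrite !p1E !p2E e2; split=> //; last by rewrite k0' add0n.
  by rewrite -tens1 hmT_tens /= hm0l (lin0 (tens_linl _)) add0r -e1 -tens_key.
- move=> v hv k kv /=; apply/eqP; rewrite addn_eq0; apply/andP; split; apply/eqP.
    have kR : p1 k \in msupp (sliceR (p2 k) v) by rewrite -mcoeff_neq0 sliceR_coef mkK mcoeff_neq0.
    move: (p1 k) kR; apply: hm_nondeg => h n.
    have sl : lin (sliceR (p2 k)) by exact: linext_lin.
    rewrite -[RHS](lin0 sl) -(hv (h, 0) n).
    apply: (@lin_eq _ _ _ (fun v => hm h n.+1 (sliceR _ v)) (fun v => sliceR _ (hmT _ _ v))).
    + exact: (lin_comp (@hm_lin F S1 _ _) sl).
    + exact: (lin_comp sl (hmT_lin _ _)).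
    move=> k' _; rewrite tens_key hmT_tens /= hm0l (lin0 (tens_linr _)) addr0 !sliceR_tens.
    exact: (linZ (@hm_lin F S1 _ _)).
  have kL : p2 k \in msupp (sliceL (p1 k) v) by rewrite -mcoeff_neq0 sliceL_coef mkK mcoeff_neq0.
  move: (p2 k) kL; apply: hm_nondeg => h n.
  have sl : lin (sliceL (p1 k)) by exact: linext_lin.
  rewrite -[RHS](lin0 sl) -(hv (0, h) n).
  apply: (@lin_eq _ _ _ (fun v => hm h n.+1 (sliceL _ v)) (fun v => sliceL _ (hmT _ _ v))).
  + exact: (lin_comp (@hm_lin F S2 _ _) sl).
  + exact: (lin_comp sl (hmT_lin _ _)).
  move=> k' _; rewrite tens_key hmT_tens /= hm0l (lin0 (tens_linl _)) add0r !sliceL_tens.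
  exact: (linZ (@hm_lin F S2 _ _)).
Defined.

Definition tens_fieldK (a : fieldOn V1) (b : fieldOn V2) : fieldOn T := fun x =>
  linext (fun k => \sum_(y \in [set: rat]) tensK (a y << p1 k >>) (b (x - 1 - y) << p2 k >>)).

Definition tens_idK (f : V1 -> V1) : T -> T :=
  linext (fun k => tensK (f << p1 k >>) << p2 k >>).

Lemma tens_idK_tens f u w : f u = \sum_(k1 <- msupp u) u@_k1 *: f << k1 >> ->
  tens_idK f (tensK u w) = tensK (f u) w.
Proof.
have il : lin (tens_idK f) by exact: linext_lin.
move=> ->; rewrite (lin_sum (tens_linl w)) {1}/tensK (lin_sum il).
apply: eq_bigr => k1 _; rewrite (lin_sum il) (linZ (tens_linl w)).
rewrite [in RHS](malg_sum w) (lin_sum (tens_linr _)) scaler_sumr.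
apply: eq_bigr => k2 _; rewrite (linZ il) (linZ (tens_linr _)) /tens_idK linextE p1E p2E.
by rewrite scalerA.
Qed.

Lemma tens_fieldK_lin a b x : lin (tens_fieldK a b x).
Proof. exact: linext_lin. Qed.

Section TensorFields.
Variables (b1 : charges S1) (b2 : charges S2) (d1 d2 : rat).
Variables (a : fieldOn V1) (b : fieldOn V2).
Hypotheses (af : hfield b1 d1 a) (bf : hfield b2 d2 b).

Lemma tens_fieldK_supp x u w : exists s : seq rat, forall y, y \notin s ->
  tensK (a y u) (b (x - 1 - y) w) = 0.
Proof.
have key k1 k2 : exists s : seq rat, forall y, y \notin s ->
    tensK (a y << k1 >>) (b (x - 1 - y) << k2 >>) = 0.
  (* The first factor is nonzero only for y = c1 - d with d a natural number, the degree of the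
     result; nonvanishing of the second factor bounds d by N. *)
  pose c1 := (dg k1)%:R - pr b1 (ch k1) + d1.
  have [N cN] := natr_gt (c1 + (dg k2)%:R - x + 1 - pr b2 (ch k2) + d2).
  exists [seq c1 - i%:R | i <- iota 0 N] => y ys.
  have [->|a0] := eqVneq (a y << k1 >>) 0; first by rewrite (lin0 (tens_linl _)).
  have [d dE] := hsp_nat (hf_hom af y (hsp_key k1)) a0.
  have kh := hf_hom bf (x - 1 - y) (hsp_key k2).
  rewrite (hsp_eq0 kh) ?(lin0 (tens_linr _))//.
  have {}ys : ~~ (d < N)%N.
    apply: contra ys => dN; apply/mapP; exists d; first by rewrite mem_iota.
    by rewrite /c1 -dE; ring.
  by move: ys; rewrite -leqNgt -(ler_nat rat) -dE; rewrite /c1 in cN *; lra.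
pose t (s1 : seq (fkeys S1)) (s2 : seq (fkeys S2)) := exists s : seq rat,
  forall y, y \notin s -> forall k1 k2, k1 \in s1 -> k2 \in s2 ->
    tensK (a y << k1 >>) (b (x - 1 - y) << k2 >>) = 0.
have tt s1 s2 : t s1 s2.
  elim: s1 => [|k1 s1 [s IH]]; first by exists [::] => y _ k1 k2; rewrite in_nil.
  suff [s' IH'] : t [:: k1] s2.
    exists (s ++ s') => y; rewrite mem_cat negb_or => /andP[ys ys'] i1 i2.
    rewrite inE => /orP[/eqP ->|i1s] i2s; last exact: IH.
    by apply: IH'; rewrite ?inE.
  elim: s2 {s IH} => [|k2 s2 [s IH]]; first by exists [::] => y _ ? k2 _; rewrite in_nil.
  have [s' k12] := key k1 k2.
  exists (s ++ s') => y; rewrite mem_cat negb_or => /andP[ys ys'] i1 i2 i1s.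
  rewrite inE => /orP[/eqP ->|i2s]; last exact: IH.
  by move: i1s; rewrite inE => /eqP ->; exact: k12.
have [s st] := tt (enum_fset (msupp u)) (enum_fset (msupp w)).
exists s => y ys; rewrite (tens_sum u w (hf_lin af y) (hf_lin bf _)).
rewrite big_seq_cond big1// => k1 /andP[k1u _]; rewrite big_seq_cond big1// => k2 /andP[k2w _].
by rewrite st ?scaler0.
Qed.

Lemma tens_field_fsupp x u w : fsupp (fun y => tensK (a y u) (b (x - 1 - y) w)).
Proof. by have [s /fsum_seq[]] := tens_fieldK_supp x u w. Qed.

Lemma tens_fieldK_tens x u w :
  tens_fieldK a b x (tensK u w) = \sum_(y \in [set: rat]) tensK (a y u) (b (x - 1 - y) w).
Proof.
apply: (lin_tens (f := fun u w => \sum_(y \in [set: rat]) tensK (a y u) (b (x - 1 - y) w))).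
- exact: tens_fieldK_lin.
- move=> {}w t u1 u2.
  rewrite -(fsum_scale _ (tens_field_fsupp x u1 w)).
  rewrite -(fsum_add (fsupp_scale _ (tens_field_fsupp x u1 w)) (tens_field_fsupp x u2 w)).2.
  by apply: eq_fsbigr => y _; rewrite (hf_lin af) (tens_linl _).
- move=> {}u t w1 w2.
  rewrite -(fsum_scale _ (tens_field_fsupp x u w1)).
  rewrite -(fsum_add (fsupp_scale _ (tens_field_fsupp x u w1)) (tens_field_fsupp x u w2)).2.
  by apply: eq_fsbigr => y _; rewrite (hf_lin bf) (tens_linr _).
by move=> k1 k2; rewrite /tens_fieldK linextE p1E p2E.
Qed.

Lemma tens_fieldK_swap x u w : \sum_(y \in [set: rat]) tensK (a y u) (b (x - 1 - y) w)
  = \sum_(y \in [set: rat]) tensK (a (x - 1 - y) u) (b y w).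
Proof.
rewrite (reindex_fsbigT (fun y => x - 1 - y)); last first.
  by exists (fun y => x - 1 - y) => y; ring.
by apply: eq_fsbigr => y _; congr (tensK _ (b _ _)); ring.
Qed.

(** The two modes y and x - 1 - y add up to x - 1, hence the extra 1. *)
Lemma tens_fieldK_hfield : @hfield F tens_space (b1, b2) (d1 + d2 + 1) (tens_fieldK a b).
Proof.
split=> [x|l q v x vq]; first exact: tens_fieldK_lin.
refine (keyed_lin (tens_fieldK_lin a b x) _ vq) => k /= [<- <-].
rewrite /tens_fieldK linextE; apply: keyed_fsum => y _.
apply: (keyedW _ (keyed_tens (hf_hom af y (hsp_key (p1 k))) (hf_hom bf (x - 1 - y) (hsp_key (p2 k))))).
move=> k' /= [[e1 e2] [e3 e4]]; split; first by rewrite e1 e3.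
by rewrite !natrD e2 e4 /prT /=; ring.
Qed.

End TensorFields.

Lemma fsum_comb (f g : rat -> T) (r s : F) : fsupp f -> fsupp g ->
  fsupp (fun y => r *: (f y - s *: g y)) /\
  \sum_(y \in [set: rat]) r *: (f y - s *: g y)
    = r *: (\sum_(y \in [set: rat]) f y - s *: \sum_(y \in [set: rat]) g y).
Proof.
move=> ff gg; have g1 := fsupp_scale (- s) gg; have [f1 e1] := fsum_add ff g1.
have e y : f y - s *: g y = f y + - s *: g y by rewrite scaleNr.
split; first by apply: fsupp_scale; apply: sub_finite_set f1 => y /=; rewrite e.
rewrite -scaleNr -(fsum_scale (- s) gg) -e1 -(fsum_scale r f1).
by apply: eq_fsbigr => y _; rewrite e.
Qed.

Section TensorVertexOp.
Variables (b1 : charges S1) (b2 : charges S2) (a : fieldOn V1) (b : fieldOn V2).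
Hypotheses (aV : vertex_op b1 a) (bV : vertex_op b2 b).

Lemma tens_covariant : @covariant F tens_space (b1, b2) (tens_fieldK a b).
Proof.
have [af ac _] := aV; have [bf bc _] := bV; have tl := tens_fieldK_lin a b.
move=> h n x v; rewrite -[hm h n]/(hmT h n) -[pr _ _]/(prT h (b1, b2)).
apply: (@lin_eq _ _ _ (fun v => hmT h n (tens_fieldK a b x v)) (fun v =>
  tens_fieldK a b x (hmT h n v) + ratr (prT h (b1, b2)) *: tens_fieldK a b (x + n%:~R) v)).
- exact: (lin_comp (hmT_lin h n) (tl x)).
- apply: lin_add; first exact: (lin_comp (tl x) (hmT_lin h n)).
  by apply: lin_scale; exact: tl.
move=> k _; rewrite tens_key hmT_tens (linD (tl x)) !(tens_fieldK_tens af bf).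
move: << p1 k >> << p2 k >> => u w.
rewrite (fsum_lin (hmT_lin h n) (tens_field_fsupp af bf x u w)).
rewrite /prT /= rmorphD /= scalerDl.
(* The shift by n of the mode of the first factor is absorbed by reindexing the sum over y. *)
have e1 : ratr (pr h.1 b1) *: \sum_(y \in [set: rat]) tensK (a y u) (b (x + n%:~R - 1 - y) w)
    = \sum_(y \in [set: rat]) ratr (pr h.1 b1) *: tensK (a (y + n%:~R) u) (b (x - 1 - y) w)
  /\ fsupp (fun y => ratr (pr h.1 b1) *: tensK (a (y + n%:~R) u) (b (x - 1 - y) w)).
  have bij : bijective (fun y : rat => y + n%:~R).
    by exists (fun y => y - n%:~R) => y; ring.
  have e y : x + n%:~R - 1 - (y + n%:~R) = x - 1 - y by ring.
  have ff : fsupp (fun y => tensK (a (y + n%:~R) u) (b (x - 1 - y) w)).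
    have [s sP] := tens_fieldK_supp af bf (x + n%:~R) u w.
    have [] // := @fsum_seq _ _ _ (fun y => tensK (a (y + n%:~R) u) (b (x - 1 - y) w))
      [seq y - n%:~R | y <- s].
    move=> y ys; rewrite -(e y); apply: sP; apply: contra ys => ys.
    by apply/mapP; exists (y + n%:~R) => //; ring.
  split; last exact: fsupp_scale.
  rewrite (fsum_scale _ ff) (reindex_fsbigT (fun y : rat => y + n%:~R) _ bij).
  by congr (_ *: _); apply: eq_fsbigr => y _; rewrite e.
rewrite e1.1 -(fsum_scale _ (tens_field_fsupp af bf (x + n%:~R) u w)).
have f1 := tens_field_fsupp af bf x (hm h.1 n u) w.
have f2 := tens_field_fsupp af bf x u (hm h.2 n w).
have f3 := e1.2.
have f4 := fsupp_scale (ratr (pr h.2 b2)) (tens_field_fsupp af bf (x + n%:~R) u w).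
have [f12 <-] := fsum_add f1 f2; have [f34 <-] := fsum_add f3 f4.
have [_ <-] := fsum_add f12 f34; apply: eq_fsbigr => y _.
rewrite hmT_tens ac bc (linD (tens_linl _)) (linZ (tens_linl _)).
rewrite (linD (tens_linr _)) (linZ (tens_linr _)).
have -> : x - 1 - y + n%:~R = x + n%:~R - 1 - y by ring.
by malg_ring.
Qed.

Lemma tens_vertex_op : @vertex_op F tens_space (b1, b2) (tens_fieldK a b).
Proof.
have [af ac av] := aV; have [bf bc bv] := bV; split; [|exact: tens_covariant|].
  have -> : (-1 : rat) = -1 + -1 + 1 by ring.
  exact: tens_fieldK_hfield.
move=> [l1 l2]; rewrite -[@pr F tens_space _ _]/(pr b1 l1 + pr b2 l2).
rewrite -[@vac F tens_space (l1, l2)]/(mk (vac l1) (vac l2)) -tens1 (tens_fieldK_tens af bf).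
rewrite (fsum_single (i := -1 - pr b1 l1)) => [|y yl].
  rewrite av; have -> : -1 - (pr b1 l1 + pr b2 l2) - 1 - (-1 - pr b1 l1) = -1 - pr b2 l2 by ring.
  by rewrite bv tens1.
have [->|a0] := eqVneq (a y << vac l1 >>) 0; first exact: (lin0 (tens_linl _)).
have [d dE] := hsp_nat (hf_hom af y (hsp_vac l1)) a0.
have kh := hf_hom bf (-1 - (pr b1 l1 + pr b2 l2) - 1 - y) (hsp_vac l2).
rewrite (hsp_eq0 kh) ?(lin0 (tens_linr _))//.
have d0 : 0 < d%:R :> rat.
  by rewrite lt0r ler0n andbT; apply: contra_neq yl => d0; rewrite d0 in dE; lra.
by lra.
Qed.

End TensorVertexOp.

Section TensorNprod.
Variables (b1 : charges S1) (b2 : charges S2) (d1 d2 : rat).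
Variables (a : fieldOn V1) (b : fieldOn V2).
Hypotheses (af : hfield b1 d1 a) (bf : hfield b2 d2 b).

(** The series over j of the n-th product and the sum over y of the tensor product are interchanged;
    this needs a bound on j valid for all y. *)
Lemma tens_nprod_r n h x v : tens_fieldK a (nprod n (heisF h) b) x v
  = nprod n (@heisF F tens_space (0, h)) (tens_fieldK a b) x v.
Proof.
have tf := tens_fieldK_hfield af bf; have nf := nprod_hfield n h bf.
have tnf := nprod_hfield (S := tens_space) n (0, h) tf.
apply: (lin_eq (hf_lin (tens_fieldK_hfield af nf) x) (hf_lin tnf x)) => k _.
rewrite tens_key (tens_fieldK_tens af nf); move: << p1 k >> << p2 k >> => u w.
pose t j y := tensK (a y u) (nprod_term n h b (x - 1 - y) w j).
have te j : fsupp (t j) /\ \sum_(y \in [set: rat]) t j y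
    = nprod_term (S := tens_space) n (0, h) (tens_fieldK a b) x (tensK u w) j.
  have tl := tens_fieldK_tens af bf; have tsu := tens_field_fsupp af bf.
  rewrite /nprod_term /t -![@hm F tens_space _ _]/(hmT _ _).
  rewrite (hmT_tens (0, h) j) /= hm0l (lin0 (tens_linl _)) add0r.
  rewrite (tl (x + j%:R)) (tl (n%:~R + x - j%:R)) (fsum_lin (hmT_lin _ _) (tsu _ u w)).
  have f1 := fsupp_lin (hmT_lin (0, h) (n - j%:Z)) (tsu (x + j%:R) u w).
  have f2 := tsu (n%:~R + x - j%:R) u (hm h j w).
  rewrite /nprod_term; move: ((-1) ^+ j * _) ((-1) ^ n) => r s.
  have [f12 <-] := fsum_comb r s f1 f2.
  have e y : r *: (hmT (0, h) (n - j%:Z) (tensK (a y u) (b (x + j%:R - 1 - y) w))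
        - s *: tensK (a y u) (b (n%:~R + x - j%:R - 1 - y) (hm h j w)))
      = tensK (a y u) (r *: (hm h (n - j%:Z) (b (x - 1 - y + j%:R) w)
          - s *: b (n%:~R + (x - 1 - y) - j%:R) (hm h j w))).
    rewrite hmT_tens /= hm0l (lin0 (tens_linl _)) add0r (linZ (tens_linr _)).
    rewrite (linB (tens_linr _)) (linZ (tens_linr _)).
    have -> : x - 1 - y + j%:R = x + j%:R - 1 - y by ring.
    by have -> : n%:~R + (x - 1 - y) - j%:R = n%:~R + x - j%:R - 1 - y by ring.
  split; first by apply: sub_finite_set f12 => y /=; rewrite e.
  by apply: eq_fsbigr => y _; rewrite e.
(* For y > N1 the first factor vanishes; for y <= N1 the mode of b exceeds N2 as soon as j >= N3,
   and h(j) kills w for j >= M. *)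
have [N1 aN] := hf_ub af u; have [N2 bN] := hf_ub bf w; have [M hM] := hm_trunc h w.
have [N3 N3x] := natr_gt (N2%:R - x + 1 + N1%:R).
have t0 j y : (maxn M N3 <= j)%N -> t j y = 0.
  rewrite geq_max => /andP[Mj Nj]; rewrite /t.
  have [yN|yN] := ltP N1%:R y; first by rewrite aN// (lin0 (tens_linl _)).
  rewrite /nprod_term hM// (lin0 (hf_lin bf _)) scaler0 subr0 bN; last first.
    by move: Nj; rewrite -(ler_nat rat); lra.
  by rewrite (lin0 (@hm_lin F S2 _ _)) scaler0 (lin0 (tens_linr _)).
apply/esym; apply: (sumsto_uniq (nprodP (S := tens_space) n (0, h) x (tensK u w) tf)).
have -> : \sum_(y \in [set: rat]) tensK (a y u) (nprod n (heisF h) b (x - 1 - y) w)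
    = \sum_(j < maxn M N3) nprod_term (S := tens_space) n (0, h) (tens_fieldK a b) x (tensK u w) j.
  under [RHS]eq_bigr => j _ do rewrite -(te j).2.
  rewrite -(fsum_bigsum _ (fun j => (te j).1)); apply: eq_fsbigr => y _.
  apply: (sumsto_uniq (sumsto_lin (@tens_linr (a y u)) (nprodP n h (x - 1 - y) w bf))).
  by apply: sumsto_bound => j; exact: t0.
apply: sumsto_bound => j Mj; rewrite -(te j).2.
by apply: fsbig1 => y _; exact: t0.
Qed.

Lemma tens_nprod_l n h x v : tens_fieldK (nprod n (heisF h) a) b x v
  = nprod n (@heisF F tens_space (h, 0)) (tens_fieldK a b) x v.
Proof.
have tf := tens_fieldK_hfield af bf; have nf := nprod_hfield n h af.
have tnf := nprod_hfield (S := tens_space) n (h, 0) tf.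
apply: (lin_eq (hf_lin (tens_fieldK_hfield nf bf) x) (hf_lin tnf x)) => k _.
rewrite tens_key (tens_fieldK_tens nf bf) tens_fieldK_swap.
move: << p1 k >> << p2 k >> => u w.
pose t j y := tensK (nprod_term n h a (x - 1 - y) u j) (b y w).
have te j : fsupp (t j) /\ \sum_(y \in [set: rat]) t j y
    = nprod_term (S := tens_space) n (h, 0) (tens_fieldK a b) x (tensK u w) j.
  have tl z u' w' : tens_fieldK a b z (tensK u' w')
      = \sum_(y \in [set: rat]) tensK (a (z - 1 - y) u') (b y w').
    by rewrite (tens_fieldK_tens af bf) tens_fieldK_swap.
  have tsu z u' w' : fsupp (fun y => tensK (a (z - 1 - y) u') (b y w')).
    have [s sP] := tens_fieldK_supp af bf z u' w'.
    have [] // := @fsum_seq _ _ _ (fun y => tensK (a (z - 1 - y) u') (b y w'))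
      [seq z - 1 - y | y <- s].
    move=> y ys; have e : z - 1 - (z - 1 - y) = y by ring.
    rewrite -{2}e; apply: sP; apply: contra ys => ys.
    by apply/mapP; exists (z - 1 - y).
  rewrite /nprod_term /t -![@hm F tens_space _ _]/(hmT _ _).
  rewrite (hmT_tens (h, 0) j) /= hm0l (lin0 (tens_linr _)) addr0.
  rewrite (tl (x + j%:R)) (tl (n%:~R + x - j%:R)) (fsum_lin (hmT_lin _ _) (tsu _ u w)).
  have f1 := fsupp_lin (hmT_lin (h, 0) (n - j%:Z)) (tsu (x + j%:R) u w).
  have f2 := tsu (n%:~R + x - j%:R) (hm h j u) w.
  rewrite /nprod_term; move: ((-1) ^+ j * _) ((-1) ^ n) => r s.
  have [f12 <-] := fsum_comb r s f1 f2.
  have e y : r *: (hmT (h, 0) (n - j%:Z) (tensK (a (x + j%:R - 1 - y) u) (b y w))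
        - s *: tensK (a (n%:~R + x - j%:R - 1 - y) (hm h j u)) (b y w))
      = tensK (r *: (hm h (n - j%:Z) (a (x - 1 - y + j%:R) u)
          - s *: a (n%:~R + (x - 1 - y) - j%:R) (hm h j u))) (b y w).
    rewrite hmT_tens /= hm0l (lin0 (tens_linr _)) addr0 (linZ (tens_linl _)).
    rewrite (linB (tens_linl _)) (linZ (tens_linl _)).
    have -> : x - 1 - y + j%:R = x + j%:R - 1 - y by ring.
    by have -> : n%:~R + (x - 1 - y) - j%:R = n%:~R + x - j%:R - 1 - y by ring.
  split; first by apply: sub_finite_set f12 => y /=; rewrite e.
  by apply: eq_fsbigr => y _; rewrite e.
have [N1 aN] := hf_ub af u; have [N2 bN] := hf_ub bf w; have [M hM] := hm_trunc h u.
have [N3 N3x] := natr_gt (N2%:R - x + 1 + N1%:R).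
have t0 j y : (maxn M N3 <= j)%N -> t j y = 0.
  rewrite geq_max => /andP[Mj Nj]; rewrite /t.
  have [yN|yN] := ltP N2%:R y; first by rewrite bN// (lin0 (tens_linr _)).
  rewrite /nprod_term hM// (lin0 (hf_lin af _)) scaler0 subr0 aN; last first.
    by move: Nj; rewrite -(ler_nat rat); lra.
  by rewrite (lin0 (@hm_lin F S1 _ _)) scaler0 (lin0 (tens_linl _)).
apply/esym; apply: (sumsto_uniq (nprodP (S := tens_space) n (h, 0) x (tensK u w) tf)).
have -> : \sum_(y \in [set: rat]) tensK (nprod n (heisF h) a (x - 1 - y) u) (b y w)
    = \sum_(j < maxn M N3) nprod_term (S := tens_space) n (h, 0) (tens_fieldK a b) x (tensK u w) j.
  under [RHS]eq_bigr => j _ do rewrite -(te j).2.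
  rewrite -(fsum_bigsum _ (fun j => (te j).1)); apply: eq_fsbigr => y _.
  apply: (sumsto_uniq (sumsto_lin (@tens_linl (b y w)) (nprodP n h (x - 1 - y) u af))).
  by apply: sumsto_bound => j; exact: t0.
apply: sumsto_bound => j Mj; rewrite -(te j).2.
by apply: fsbig1 => y _; exact: t0.
Qed.

Lemma tens_fid x v : tens_fieldK a (@fid F V2) x v = tens_idK (a x) v.
Proof.
apply: (@lin_eq _ _ _ (tens_fieldK a _ x) (tens_idK (a x))); [exact: linext_lin..|move=> k _].
rewrite /tens_fieldK /tens_idK !linextE (fsum_single (i := x)) /fid => [|y yx].
  by have -> : (x - 1 - x == -1) = true by apply/eqP; ring.
have -> : (x - 1 - y == -1) = false by apply: contra_neqF yx => /eqP e; lra.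
exact: (lin0 (tens_linr _)).
Qed.

End TensorNprod.

End TensorProduct.

(** * Exponentials of locally nilpotent operators *)

Section Exponential.
Variables (F : numFieldType) (K : choiceType).
Local Notation V := {malg F[K]}.
Variables (X : V -> V) (P : set K).
Hypothesis X_lin : lin X.
Hypothesis X_stable : forall v, keyed P v -> keyed P (X v).
Hypothesis X_nilp : forall k, P k -> exists M, forall m, (M <= m)%N -> iter m X << k >> = 0.
Implicit Types (u v w : V).

Lemma iter_lin n : lin (iter n X).
Proof. by elim: n => [|n IH] //=; exact: (lin_comp X_lin IH). Qed.

Lemma iter_stable n v : keyed P v -> keyed P (iter n X v).
Proof. by move=> Pv; elim: n => //= n; exact: X_stable. Qed.

Lemma nilp_uniform v : keyed P v -> exists M, forall k, k \in msupp v ->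
  forall m, (M <= m)%N -> iter m X << k >> = 0.
Proof.
move=> Pv; suff H (s : seq K) : (forall k, k \in s -> P k) ->
    exists M, forall k, k \in s -> forall m, (M <= m)%N -> iter m X << k >> = 0.
  exact: (H (enum_fset (msupp v)) Pv).
elim: s => [|k s IH] sP; first by exists 0%N => k; rewrite in_nil.
have [|M sM] := IH; first by move=> k' k's; apply: sP; rewrite inE k's orbT.
have [M' kM'] := X_nilp (sP k (mem_head _ _)).
exists (maxn M M') => k'; rewrite inE => /orP[/eqP ->|k's] m; rewrite geq_max => /andP[Mm M'm].
  exact: kM'.
exact: sM.
Qed.

Lemma nilp_vec v : keyed P v -> exists M, forall m, (M <= m)%N -> iter m X v = 0.
Proof.
move=> /nilp_uniform[M vM]; exists M => m Mm.
apply: (@lin_eq _ _ _ (iter m X) (fun=> 0)) => [||k kv]; first exact: iter_lin.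
  exact: lin_zero.
exact: vM.
Qed.

Definition exp_term v n : V := (n`!%:R)^-1 *: iter n X v.

Lemma exp_sum v : keyed P v -> sumsto (exp_term v) (expop X v).
Proof.
move=> /nilp_vec[M vM]; apply: sumsto_fsumP; exists M => n Mn.
by rewrite /exp_term vM ?scaler0.
Qed.

Lemma exp_keyed v : keyed P v -> keyed P (expop X v).
Proof.
by move=> Pv; apply: keyed_fsum => n _; apply: keyedZ; exact: iter_stable.
Qed.

(** Outside the span of P the series may be infinite and default to 0, so linearity of [expop] is
    available only in this restricted form. *)
Lemma exp_keys v : keyed P v -> expop X v = \sum_(k <- msupp v) v@_k *: expop X << k >>.
Proof.
move=> Pv; have [M vM] := nilp_uniform Pv.
apply: (sumsto_uniq (exp_sum Pv)); exists M => N MN.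
have tl : lin (fun v => \sum_(n < N) exp_term v n).
  by apply: lin_bigsum => n; apply: lin_scale; exact: iter_lin.
rewrite {1}(malg_sum v) (lin_sum tl) big_seq_cond [RHS]big_seq_cond.
apply: eq_bigr => k /andP[kv _]; rewrite (linZ tl); congr (_ *: _).
apply: (@sumsto_uniq _ _ (exp_term << k >>)); last exact: exp_sum (keyed1 (Pv k kv)).
apply: sumsto_bound => m Nm; rewrite /exp_term vM ?scaler0//.
exact: leq_trans MN Nm.
Qed.

(** The derivative of the exponential series is the series itself; the index is kept in step with
    that of X^n Y in [iter_conj]. *)
Lemma exp_delay (W : lmodType F) (Z : V -> W) v : lin Z -> keyed P v ->
  sumsto (fun n => n%:R *: ((n`!%:R)^-1 *: Z (iter n.-1 X v))) (Z (expop X v)).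
Proof.
move=> Zl Pv; have S2 := sumsto_lin Zl (exp_sum Pv).
pose u n := n%:R *: ((n`!%:R)^-1 *: Z (iter n.-1 X v)).
have -> : Z (expop X v) = u 0%N + Z (expop X v) by rewrite /u scale0r add0r.
apply/sumstoS; apply: eq_sumsto S2 => n.
rewrite /u /exp_term (linZ Zl) scalerA factS natrM invfM mulrA mulfV ?mul1r//.
by rewrite pnatr_eq0.
Qed.

Section Conjugation.
Variables (W : lmodType F) (Y Z : V -> W) (X' : W -> W).
Hypotheses (Y_lin : lin Y) (Z_lin : lin Z) (X'_lin : lin X').
Hypothesis XY : forall v, keyed P v -> X' (Y v) = Y (X v) + Z v.
Hypothesis XZ : forall v, keyed P v -> X' (Z v) = Z (X v).

(** The commutator Z of X with Y commutes with X, so only a term linear in n appears. *)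
Lemma iter_conj n v : keyed P v ->
  iter n X' (Y v) = Y (iter n X v) + n%:R *: Z (iter n.-1 X v).
Proof.
move=> Pv; elim: n => [|n IH]; first by rewrite scale0r addr0.
rewrite /= IH (linD X'_lin) (linZ X'_lin) XY; last exact: iter_stable.
rewrite XZ; last exact: iter_stable.
rewrite -addrA; congr (_ + _); case: n {IH} => [|n] /=; first by rewrite scale0r addr0 scale1r.
by rewrite -[n.+2%:R]natr1 scalerDl scale1r addrC.
Qed.

(** Formally exp(X') Y = (Y + Z) exp(X). Only the kernel is treated, since X' need not be locally
    nilpotent on W; its powers suffice because they all kill Y v = 0. *)
Lemma exp_kernel v : keyed P v -> Y v = 0 -> Y (expop X v) + Z (expop X v) = 0.
Proof.
move=> Pv Yv; have ev := exp_sum Pv; have S1 := sumsto_lin Y_lin ev.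
have S3 := exp_delay Z_lin Pv.
apply: (sumsto_uniq (sumstoD S1 S3)); apply: eq_sumsto (sumsto0 _) => n.
have X'0 m : iter m X' 0 = 0 by elim: m => //= m ->; exact: lin0.
have := iter_conj n Pv; rewrite Yv X'0 => e.
by rewrite /exp_term (linZ Y_lin) scalerA mulrC -scalerA -scalerDr -e scaler0.
Qed.
End Conjugation.

Lemma exp_conj (Y Z : V -> V) : lin Y -> lin Z ->
    (forall v, keyed P v -> X (Y v) = Y (X v) + Z v) ->
    (forall v, keyed P v -> X (Z v) = Z (X v)) -> (forall v, keyed P v -> keyed P (Y v)) ->
  forall v, keyed P v -> expop X (Y v) = Y (expop X v) + Z (expop X v).
Proof.
move=> Yl Zl XY XZ YP v Pv; have ev := exp_sum Pv; have S1 := sumsto_lin Yl ev.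
have S3 := exp_delay Zl Pv.
apply: (sumsto_uniq (exp_sum (YP v Pv))); apply: eq_sumsto (sumstoD S1 S3) => n.
rewrite /exp_term (iter_conj X_lin XY XZ n Pv) scalerDr (linZ Yl); congr (_ + _).
by rewrite !scalerA mulrC.
Qed.

Lemma exp_anticomm (W : lmodType F) (Y : V -> W) (X' : W -> W) : lin Y -> lin X' ->
    (forall v, keyed P v -> Y (X v) = - X' (Y v)) ->
  forall v, keyed P v -> Y v = 0 -> Y (expop X v) = 0.
Proof.
move=> Yl X'l YX v Pv Yv; apply: (sumsto_uniq (sumsto_lin Yl (exp_sum Pv))).
apply: eq_sumsto (sumsto0 _) => n; rewrite /exp_term (linZ Yl).
suff -> : Y (iter n X v) = 0 by rewrite scaler0.
by elim: n => //= n IH; rewrite YX ?IH ?(lin0 X'l) ?oppr0//; exact: iter_stable.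
Qed.

End Exponential.

(** The expansion of (1 - 1)^N divided by N!. *)
Lemma alternating_sum (F : numFieldType) (N : nat) :
  \sum_(m < N.+1) (-1) ^+ m / (m`!%:R * (N - m)`!%:R) = (N == 0%N)%:R :> F.
Proof.
have fN (n : nat) : n`!%:R != 0 :> F by rewrite pnatr_eq0 -lt0n fact_gt0.
apply: (mulfI (fN N)); rewrite mulr_sumr.
transitivity (\sum_(m < N.+1) ((1 : F) ^+ (N - m) * (-1) ^+ m) *+ 'C(N, m)).
  apply: eq_bigr => m _; rewrite expr1n mul1r -[RHS]mulr_natr mulrCA; congr (_ * _).
  have mN : (m <= N)%N by rewrite -ltnS.
  rewrite -(bin_fact mN) !natrM.
  by rewrite mulfK// mulf_neq0.
rewrite -exprDn addrN expr0n; case: eqP => [->|_]; last by rewrite mulr0.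
by rewrite fact0 mulr1.
Qed.

Lemma exp_opp (F : numFieldType) (K : choiceType) (X : {malg F[K]} -> {malg F[K]}) (P : set K) :
    lin X -> (forall v, keyed P v -> keyed P (X v)) ->
    (forall k, P k -> exists M, forall m, (M <= m)%N -> iter m X << k >> = 0) ->
  forall v, keyed P v -> expop (fun v => - X v) (expop X v) = v.
Proof.
move=> Xl XP Xn v Pv; pose X' v := - X v.
have X'l : lin X' by exact: lin_opp.
have X'P u : keyed P u -> keyed P (X' u) by move=> Pu; apply: keyedN; exact: XP.
have itX' m u : iter m X' u = (-1) ^+ m *: iter m X u.
  elim: m => [|m IH]; first by rewrite scale1r.
  by rewrite /= IH /X' (linZ Xl) exprS -scalerA scaleN1r.
have X'n k : P k -> exists M, forall m, (M <= m)%N -> iter m X' << k >> = 0.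
  by move=> /Xn[M kM]; exists M => m Mm; rewrite itX' kM// scaler0.
have [M vM] := nilp_vec Xl Xn Pv.
have eE : expop X v = \sum_(n < M) exp_term X v n.
  apply: (sumsto_uniq (exp_sum Xl Xn Pv)); apply: sumsto_bound => m Mm.
  by rewrite /exp_term vM ?scaler0.
have Pe := exp_keyed XP Pv.
have it0 m : (M <= m)%N -> iter m X (expop X v) = 0.
  move=> Mm; rewrite eE (lin_sum (iter_lin Xl m)) big1// => n _.
  rewrite (linZ (iter_lin Xl m)) -iterD vM ?scaler0//; lia.
rewrite -/X'; apply: (sumsto_uniq (exp_sum X'l X'n Pe)).
(* The part of exp(-X) exp(X) of total order N whose first factor has order m. *)
pose f m N : {malg F[K]} := ((-1) ^+ m / (m`!%:R * (N - m)`!%:R)) *: iter N X v.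
have vE : v = \sum_(N < M.+1) \sum_(m < N.+1) f m N.
  under eq_bigr => N _ do rewrite -scaler_suml alternating_sum.
  rewrite big_ord_recl /= scale1r big1 ?addr0// => i _.
  by rewrite scale0r.
have fE1 : \sum_(N < M.+1) \sum_(m < N.+1) f m N
    = \sum_(m < M.+1) \sum_(N < M.+1 | (m <= N)%N) f m N.
  rewrite [RHS](exchange_big_dep xpredT)//=; apply: eq_bigr => N _.
  rewrite (big_ord_widen M.+1 (fun m => f m N)); last exact: ltn_ord.
  by apply: eq_bigl => m; rewrite ltnS.
have fE (m : nat) : \sum_(N < M.+1 | (m <= N)%N) f m N = exp_term X' (expop X v) m.
  have ml : lin (fun u => (m`!%:R)^-1 *: ((-1) ^+ m *: iter m X u)).
    by do 2! apply: lin_scale; exact: iter_lin.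
  have := sumsto_delay m (sumsto_lin ml (exp_sum Xl Xn Pv)); rewrite -itX'.
  rewrite -/(exp_term X' (expop X v) m) => /sumsto_uniq e; apply/esym/e; rewrite big_mkcond /= => {e}.
  pose g N := if (m <= N)%N then f m N else 0.
  have g0 N : (M.+1 <= N)%N -> g N = 0.
    by move=> MN; rewrite /g /f vM ?scaler0 ?if_same//; lia.
  apply: eq_sumsto (sumsto_bound g0) => N; rewrite /g; case: ifP => // mN.
  rewrite /f /exp_term (linZ (iter_lin Xl m)) -iterD subnKC// !scalerA.
  by rewrite invfM mulrA; congr (_ * _ *: _); rewrite mulrC.
have e0 m : (M.+1 <= m)%N -> exp_term X' (expop X v) m = 0.
  by move=> Mm; rewrite -fE big1// => N; have := ltn_ord N; lia.
rewrite [X in sumsto _ X]vE fE1 (eq_bigr (exp_term X' (expop X v) \o @nat_of_ord _)).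
  exact: (sumsto_bound e0).
by move=> m _; exact: fE.
Qed.

(** * The doublet algebras *)

(** Degrees are integers, so a nonzero action forces integrality of the mode plus the pairing. *)
Lemma hf_nonint (F : numFieldType) (S : fockSpace F) (b : charges S) (d : rat)
    (X : fieldOn {malg F[fkeys S]}) : hfield b d X -> d \is a Num.int ->
  forall l x v, keyed [set k | ch k = l] v -> x + pr b l \isn't a Num.int -> X x v = 0.
Proof.
move=> Xf dZ l x v vl xn.
apply: (@lin_eq _ _ _ (X x) (fun=> 0)) => [||k /vl /= kl]; [exact: hf_lin Xf x|exact: lin_zero|].
have [//|X0] := eqVneq (X x << k >>) 0.
have [n nE] := hsp_nat (hf_hom Xf x (hsp_key k)) X0.
case/negP: xn; have -> : x + pr b l = (dg k)%:R + d - n%:R by rewrite -nE kl; ring.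
by rewrite rpredB ?rpredD ?rpred_nat.
Qed.

Section Lattice.
Variables (F : numFieldType) (S : fockSpace F) (gam : charges S) (p : nat).
Variable E : charges S -> fieldOn {malg F[fkeys S]}.
Hypotheses (p_ge2 : (2 <= p)%N) (gam_pr : pr gam gam = (2 * p)%:R).
Hypothesis EV : forall a, vertex_op a (E a).
Local Notation V := {malg F[fkeys S]}.
Local Notation "<[ a , b ]>" := (@pr F S a b).
Implicit Types (t s x y : rat) (v : V).
Local Notation hml := (@hm_lin F S).

Definition elat t : fieldOn V := E (t *: gam).
Definition halfL : set (fkeys S) :=
  [set k | exists n : int, ch k = n%:~R *: (2%:R^-1 *: gam)].
Definition omL : fieldOn V :=
  fadd (fscale ((4 * p)%:R)^-1
          (nprod (- 1%:Z) (heisF gam) (nprod (- 1%:Z) (heisF gam) (E 0))))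
       (fscale ((p%:R - 1) / (2 * p)%:R) (nprod (- 2%:Z) (heisF gam) (E 0))).

Lemma elatV t : vertex_op (t *: gam) (elat t). Proof. exact: EV. Qed.
Let elat_f t := vo_field (elatV t).

Lemma p_neq0 : p%:R != 0 :> rat. Proof. by rewrite pnatr_eq0; lia. Qed.

Lemma pr_gam t s : <[t *: gam, s *: gam]> = t * s * 2 * p%:R.
Proof. by rewrite prZl prZr gam_pr natrM; ring. Qed.

Lemma E0_fid : E 0 = @fid F V.
Proof. by apply/funext => x; apply/funext => v; rewrite (vo0_fid (EV 0)). Qed.

Lemma omL_hfield : hfield 0 1 omL.
Proof.
have f0 := vo_field (EV 0).
apply: hfield_add; apply: hfield_scale.
  have := nprod_hfield (- 1%:Z) gam (nprod_hfield (- 1%:Z) gam f0).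
  by rewrite rmorphN /= (_ : -1 - -1 - -1 = 1); last ring.
have := nprod_hfield (- 2%:Z) gam f0.
by rewrite rmorphN /= (_ : -1 - -2%:R = 1); last ring.
Qed.

Lemma omLE n v : omL n%:~R v = ratr (4 * p%:R)^-1 *: nop gam (heisF gam) n%:~R v
  - ratr ((p%:R - 1) / (2 * p%:R) * n%:~R) *: hm gam (n - 1) v.
Proof.
have NF : nop gam (@fid F V) = heisF gam.
  by apply/funext => x; apply/funext => w; exact: nop_fid.
have e1 : ((4 * p)%:R)^-1 = ratr (4 * p%:R)^-1 :> F.
  by rewrite fmorphV rmorphM /= !ratr_nat natrM.
have ff := vo_field (fid_vo S).
have N0 x w : nop (0 : charges S) (@fid F V) x w = 0 by rewrite (nop0l x w ff).
have NN : nop gam (nop 0 (@fid F V)) n%:~R v = 0.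
  rewrite (@eq_nop _ _ _ _ (fscale 0 (@fid F V))); last by move=> x w; rewrite N0 /fscale scale0r.
  by rewrite (nop_scale _ _ _ _ ff) scale0r.
rewrite /omL /fadd /fscale E0_fid -!nopE NF e1.
rewrite (nprod2_deriv gam (fid_vo S)) NN subr0 NF.
have -> : n%:~R - 1 = (n - 1)%:~R :> rat by rewrite rmorphB.
rewrite heisF_int scalerA -scaleNr.
have -> : (p%:R - 1) / (2 * p)%:R * - ratr n%:~R = - ratr ((p%:R - 1) / (2 * p%:R) * n%:~R) :> F.
  by rewrite !rmorphM fmorphV rmorphM rmorphB /= !ratr_nat rmorph1 natrM mulrN.
by [].
Qed.

(** e^(s gamma) is primary of conformal weight p s^2 - (p - 1) s. The weight is 1 for s = 1 and for
    s = -1/p, the two values used. *)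
Lemma omL_comm s (m : int) y v : s != 0 -> omL m%:~R (elat s y v) = elat s y (omL m%:~R v)
  + ratr (- y - m%:~R * (1 - p%:R * s ^+ 2 + (p%:R - 1) * s)) *: elat s (y + m%:~R - 1) v.
Proof.
move=> s0; have Xl := hf_lin (elat_f s); have [_ Xc _] := elatV s.
rewrite !omLE (nop_heis_comm gam (elatV s)) Xc (linB (Xl y)) !(linZ (Xl y)).
have -> : y + (m - 1)%:~R = y + m%:~R - 1 by rewrite rmorphB /=; ring.
have gs : <[gam, s *: gam]> = s * 2 * p%:R by rewrite prZr gam_pr natrM; ring.
(* By the translation property the product of gamma with e^(s gamma) is its derivative divided by
   s. *)
have -> : nop gam (elat s) (y + m%:~R) v = ratr (- s^-1 * (y + m%:~R)) *: elat s (y + m%:~R - 1) v.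
  have s0F : ratr s != 0 :> F by rewrite fmorph_eq0.
  apply: (scalerI s0F); rewrite -(nopZl _ _ _ _ (elat_f s)) (vo_deriv (elatV s)) scalerA.
  by rewrite -rmorphM /= -rmorphN; congr (ratr _ *: _); field.
rewrite gs; set w := elat s (y + m%:~R - 1) v.
have -> : ratr (- y - m%:~R * (1 - p%:R * s ^+ 2 + (p%:R - 1) * s))
   = ratr (4 * p%:R)^-1 * (ratr (2 * (s * 2 * p%:R)) * ratr (- s^-1 * (y + m%:~R)))
   + ratr (4 * p%:R)^-1 * ratr (m%:~R * (s * 2 * p%:R) ^+ 2)
   - ratr ((p%:R - 1) / (2 * p%:R) * m%:~R) * ratr (s * 2 * p%:R) :> F.
  rewrite -!rmorphM -rmorphD -rmorphB; congr (ratr _); have := p_neq0 => p0.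
  by field; rewrite p0 s0.
by malg_ring.
Qed.

Definition expX : V -> V := elat 1 1.
Lemma expX_lin : lin expX. Proof. exact: hf_lin (elat_f 1) 1. Qed.

Lemma halfL_shift b d X : hfield b d X -> (exists n : int, b = n%:~R *: (2%:R^-1 *: gam)) ->
  forall x v, keyed halfL v -> keyed halfL (X x v).
Proof.
move=> Xf [n bn] x v vL; apply: (keyed_lin (hf_lin Xf x) _ vL) => k [n' kn].
apply: (keyedW _ (hsp_ch (hf_hom Xf x (hsp_key k)))) => k' /= e.
by exists (n' + n); rewrite e kn bn -scalerDl rmorphD.
Qed.

Lemma expX_stable v : keyed halfL v -> keyed halfL (expX v).
Proof.
apply: (halfL_shift (elat_f 1)); exists 2; rewrite scalerA.
by congr (_ *: _); field.
Qed.

Lemma expX_iter s q v m : hsp (s *: gam) q v ->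
  hsp ((s + m%:R) *: gam) (q - 2 * m%:R - 2 * p%:R * s * m%:R - p%:R * m%:R * (m%:R - 1))
    (iter m expX v).
Proof.
move=> vq; elim: m => [|m IH]; first by rewrite addr0; apply: hspE vq; ring.
have := hf_hom (elat_f 1) 1 IH; rewrite -scalerDl -addrA natr1.
by apply: hspE; rewrite pr_gam -natr1; ring.
Qed.

Arguments expX_iter {s q v} m _.

(** Each application adds gamma to the charge, so the oscillator degree left after m steps contains
    -p m (m - 1) and eventually becomes negative. *)
Lemma expX_nilp k : halfL k -> exists M, forall m, (M <= m)%N -> iter m expX << k >> = 0.
Proof.
move=> [n kn]; pose s : rat := n%:~R / 2.
have ks : hsp (s *: gam) (dg k)%:R << k >>.
  by have := hsp_key k; rewrite kn scalerA.
have [A As] := natr_gt (- (2 * p%:R * s)).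
exists (A + dg k + 1)%N => m Mm; have mh := expX_iter m ks; apply: (hsp_eq0 mh).
have mA : A%:R + (dg k)%:R + 1 <= m%:R :> rat by rewrite -!natrD natr1 -addn1 ler_nat.
have p1 : 1 <= p%:R :> rat by rewrite ler1n; lia.
have A0 := ler0n rat A; have d0 := ler0n rat (dg k).
have m0 : 0 <= m%:R :> rat by [].
have e1 : 0 <= (p%:R - 1) * (m%:R - 1) :> rat by apply: mulr_ge0; lra.
have e2 : - 2 - 2 * p%:R * s - p%:R * (m%:R - 1) <= -1 by lra.
have : m%:R * (- 2 - 2 * p%:R * s - p%:R * (m%:R - 1)) <= m%:R * (-1) by exact: ler_wpM2l.
lra.
Qed.

Lemma expXN_stable v : keyed halfL v -> keyed halfL (- expX v).
Proof. by move=> vL; apply: keyedN; exact: expX_stable. Qed.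

Lemma expXN_lin : lin (fun v => - expX v).
Proof. exact: lin_opp expX_lin. Qed.

Lemma expXN_nilp k : halfL k -> exists M, forall m, (M <= m)%N ->
  iter m (fun v => - expX v) << k >> = 0.
Proof.
move=> /expX_nilp[M kM]; exists M => m /kM km.
suff -> : iter m (fun v => - expX v) << k >> = (-1) ^+ m *: iter m expX << k >>.
  by rewrite km scaler0.
elim: m {km} => [|m /= ->]; first by rewrite scale1r.
by rewrite (linZ expX_lin) exprS -scalerA scaleN1r.
Qed.

Lemma expXNN : (fun v => - - expX v) = expX.
Proof. by apply/funext => v; rewrite opprK. Qed.

Definition OmL : V -> V := expop expX.
Definition OmLN : V -> V := expop (fun v => - expX v).

Lemma OmLNK v : keyed halfL v -> OmLN (OmL v) = v.
Proof. exact: exp_opp expX_lin expX_stable expX_nilp v. Qed.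

Lemma OmLK v : keyed halfL v -> OmL (OmLN v) = v.
Proof.
by move=> vL; have := exp_opp expXN_lin expXN_stable expXN_nilp vL; rewrite expXNN.
Qed.

Lemma OmL_keyed v : keyed halfL v -> keyed halfL (OmL v).
Proof. exact: exp_keyed expX_stable v. Qed.
Lemma OmLN_keyed v : keyed halfL v -> keyed halfL (OmLN v).
Proof. exact: exp_keyed expXN_stable v. Qed.

Lemma halfL_int k : halfL k -> forall n : int, <[n%:~R *: gam, ch k]> \is a Num.int.
Proof.
move=> [m ->] n; rewrite scalerA pr_gam.
have -> : n%:~R * (m%:~R * 2%:R^-1) * 2 * p%:R = (n * m * p%:Z)%:~R :> rat.
  by rewrite !rmorphM /=; field.
exact: intr_int.
Qed.

Lemma elat1_nonint x v : x \isn't a Num.int -> keyed halfL v -> elat 1 x v = 0.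
Proof.
move=> xn vL; apply: (@lin_eq _ _ _ (elat 1 x) (fun=> 0)) => [||k /vL kL].
- exact: hf_lin (elat_f 1) x.
- exact: lin_zero.
apply: (hf_nonint (elat_f 1) _ (keyed1 (P := [set k' | ch k' = ch k]) erefl)) => //.
by have kZ := halfL_int kL 1; rewrite rpredDr.
Qed.

Lemma omL_nonint x v : x \isn't a Num.int -> omL x v = 0.
Proof.
move=> xn; apply: (charge_decomp (D := omL x)); first exact: hf_lin omL_hfield x.
by move=> l w wl; apply: (hf_nonint omL_hfield _ wl); rewrite ?pr0l ?addr0 ?rpred1.
Qed.

Lemma expX_elat x v : expX (elat 1 x v) = elat 1 x (expX v).
Proof.
rewrite /expX (@vo_comm _ _ (2 * p)%N _ _ _ _ (elatV 1) (elatV 1)).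
  by rewrite exprM sqrrN expr1n expr1n scale1r.
by rewrite pr_gam natrM; ring.
Qed.

Lemma OmL_omega x v : keyed halfL v -> OmL (omL x v) = omL x (OmL v) + elat 1 x (OmL v).
Proof.
move=> vL; apply: (exp_conj expX_lin expX_stable expX_nilp) => //.
- exact: hf_lin omL_hfield x.
- exact: hf_lin (elat_f 1) x.
(* As e^gamma has weight 1, the coefficient in [omL_comm] at y = 1 is -1, whatever m is. For
   nonintegral modes both fields vanish on V_L~. *)
- move=> w wL; case: (boolP (x \is a Num.int)) => [/intrP[m ->]|xn].
    rewrite /expX (omL_comm m 1 w (oner_neq0 _)).
    have -> : 1 + m%:~R - 1 = m%:~R :> rat by ring.
    have -> : -1 - m%:~R * (1 - p%:R * 1 ^+ 2 + (p%:R - 1) * 1) = -1 :> rat by ring.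
    by rewrite rmorphN rmorph1 scaleN1r subrK.
  by rewrite !omL_nonint// (elat1_nonint xn wL) (lin0 expX_lin) addr0.
- by move=> w _; exact: expX_elat.
- move=> w; apply: (halfL_shift omL_hfield); exists 0.
  by rewrite scale0r.
Qed.

Definition Qold := elat (- p%:R^-1) 0.
Definition Qadd v := - ((p%:R - 1)^-1 *: elat (1 - p%:R^-1) 0 v) : V.

Lemma Qold_lin : lin Qold. Proof. exact: hf_lin (elat_f _) 0. Qed.
Lemma Qadd_lin : lin Qadd.
Proof. by apply: lin_opp; apply: lin_scale; exact: hf_lin (elat_f _) 0. Qed.

Lemma expX_Qold v : keyed halfL v -> expX (Qold v) = Qold (expX v) + Qadd v.
Proof.
move=> vL; pose D v := expX (Qold v) - (Qold (expX v) + Qadd v).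
have Dl : lin D.
  apply: lin_add; first exact: lin_comp expX_lin Qold_lin.
  by apply: lin_opp; apply: lin_add; [exact: lin_comp Qold_lin expX_lin|exact: Qadd_lin].
apply/eqP; rewrite -subr_eq0; apply/eqP.
apply: (@lin_eq _ _ _ D (fun=> 0)) => // [|k /vL kL]; first exact: lin_zero.
have ZV : vertex_op (1 *: gam + - p%:R^-1 *: gam) (elat (1 - p%:R^-1)).
  by rewrite -scalerDl; exact: elatV.
have ab2 : <[1 *: gam, - p%:R^-1 *: gam]> = -2.
  by rewrite pr_gam; have := p_neq0 => p0; field.
have p10 : p%:R - 1 != 0 :> rat.
  by rewrite subr_eq0 -[1]/(1%:R) eqr_nat; lia.
have p1F : (p%:R - 1 : F) = ratr (p%:R - 1) by rewrite rmorphB rmorph1 /= ratr_nat.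
have kZ : 1 + <[1 *: gam, ch k]> \is a Num.int by rewrite rpredD ?rpred1//; exact: (halfL_int kL 1).
rewrite /D /expX /Qold (vo_comm_pole2 (elatV 1) (elatV _) ZV ab2 0 kZ (keyed1 (P := [set k' | ch k' = ch k]) erefl)).
(* Here the double-pole formula at x = 1, y = 0 gives Z_0 plus the mode 1 of the product of gamma
   with Z. With s = 1 - 1/p the latter is -Z_0 / s, and 1 - 1/s = -1/(p - 1). *)
set X := elat (1 - p%:R^-1); set s : rat := 1 - p%:R^-1.
have s0 : s != 0.
  by rewrite /s subr_eq0 eq_sym invr_eq1 -[1]/(1%:R) eqr_nat; lia.
have sF : ratr s != 0 :> F by rewrite fmorph_eq0.
have -> : nop (1 *: gam) X (1 + 0) << k >> = - ratr s^-1 *: X 0 << k >>.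
  apply: (scalerI sF); rewrite -(nopZl _ _ _ _ (elat_f s)) scale1r (vo_deriv (elatV s)).
  by rewrite addr0 subrr scalerA rmorph1 mulrN -rmorphM mulfV// rmorph1.
rewrite addr0 subrr rmorph1 /Qadd -/X p1F -fmorphV.
have -> : (p%:R - 1)^-1 = s^-1 - 1 :> rat.
  by rewrite /s; have := p_neq0 => p0; field; rewrite p0 p10.
by rewrite rmorphB rmorph1; malg_ring.
Qed.

Lemma expX_Qadd v : expX (Qadd v) = Qadd (expX v).
Proof.
have e : expX (elat (1 - p%:R^-1) 0 v) = elat (1 - p%:R^-1) 0 (expX v).
  rewrite /expX (@vo_comm _ _ (2 * (p - 1))%N _ _ _ _ (elatV 1) (elatV _)).
    by rewrite exprM sqrrN expr1n expr1n scale1r.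
  by rewrite pr_gam natrM natrB; [have := p_neq0 => p0; field|lia].
by rewrite /Qadd (linN expX_lin) (linZ expX_lin) e.
Qed.

Lemma OmL_doublet v : keyed halfL v -> Qold v = 0 -> Qold (OmL v) + Qadd (OmL v) = 0.
Proof.
exact: (exp_kernel expX_lin expX_stable expX_nilp Qold_lin Qadd_lin expX_lin expX_Qold
  (fun v _ => expX_Qadd v)).
Qed.

Lemma OmLN_doublet v : keyed halfL v -> Qold v + Qadd v = 0 -> Qold (OmLN v) = 0.
Proof.
(* The same argument for -X, starting from the new screening: the correction Z = -Qadd restores the
   old one. *)
move=> vL Qv; pose Y v := Qold v + Qadd v; pose Z v := - Qadd v.
have Yl : lin Y by apply: lin_add; [exact: Qold_lin|exact: Qadd_lin].
have Zl : lin Z by apply: lin_opp; exact: Qadd_lin.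
have XY w : keyed halfL w -> - expX (Y w) = Y (- expX w) + Z w.
  move=> wL; rewrite /Y /Z (linD expX_lin) expX_Qold// expX_Qadd.
  by rewrite (linN Qold_lin) (linN Qadd_lin); malg_ring.
have XZ w : keyed halfL w -> - expX (Z w) = Z (- expX w).
  by move=> _; rewrite /Z (linN expX_lin) expX_Qadd (linN Qadd_lin).
have := exp_kernel expXN_lin expXN_stable expXN_nilp Yl Zl expXN_lin XY XZ vL Qv.
by rewrite /Y /Z addrK.
Qed.

(** e^(-gamma/p) has weight 1, and the mode 0 of a primary field of weight 1 commutes with omega. *)
Lemma omL_Qold x v : Qold (omL x v) = omL x (Qold v).
Proof.
case: (boolP (x \is a Num.int)) => [/intrP[m ->]|xn]; last first.
  by rewrite !omL_nonint// (lin0 Qold_lin).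
have p0 := p_neq0.
rewrite /Qold omL_comm ?oppr_eq0 ?invr_eq0//.
have -> : - 0 - m%:~R * (1 - p%:R * (- p%:R^-1) ^+ 2 + (p%:R - 1) * - p%:R^-1) = 0 :> rat.
  by field.
by rewrite rmorph0 scale0r addr0.
Qed.

End Lattice.

(** * Equivariance is closed under n-th products *)

Section NprodClosure.
Variables (F : numFieldType) (V : lmodType F) (P : set V) (phi : V -> V).
Hypotheses (P0 : P 0) (P_lin : forall t u v, P u -> P v -> P (t *: u + v)).
Hypotheses (phi_lin : lin phi) (phi_inj : forall v, P v -> phi v = 0 -> v = 0).

Definition intertwined (a b : fieldOn V) := forall x v, P v ->
  P (a x v) /\ phi (a x v) = b x (phi v).

(* As [phi] is injective on [P], both families have the same support: if it is
   infinite, both sums have the junk value 0. *)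
Lemma intertwined_fsum (f g : nat -> V) :
    (forall j, P (f j) /\ phi (f j) = g j) ->
  P (\sum_(j \in [set: nat]) f j) /\
  phi (\sum_(j \in [set: nat]) f j) = \sum_(j \in [set: nat]) g j.
Proof.
move=> fg; have PD u v : P u -> P v -> P (u + v).
  by move=> Pu; rewrite -[u]scale1r; exact: P_lin.
split; first by apply: big_ind => // j _; have [] := fg j.
rewrite (lin_sum phi_lin).
have -> : finite_support 0 [set: nat] f = finite_support 0 [set: nat] g.
  rewrite /finite_support; set A := _ `&` _; set B := _ `&` _; suff -> : A = B by [].
  congr (_ `&` _); apply/funext => j /=; apply/propext.
  have [Pf <-] := fg j; split=> [fj /(phi_inj Pf)//|fj f0].
  by apply: fj; rewrite f0 (lin0 phi_lin).
by apply: eq_bigr => j _; have [] := fg j.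
Qed.

Lemma intertwined_nprod n a b a' b' : intertwined a b -> intertwined a' b' ->
  intertwined (nprod n a a') (nprod n b b').
Proof.
move=> ab ab' x v Pv; apply: intertwined_fsum => j.
have [P1 e1] := ab' (x + j%:R) v Pv; have [P2 e2] := ab (n - j%:Z)%:~R _ P1.
have [P3 e3] := ab j%:R v Pv; have [P4 e4] := ab' (n%:~R + x - j%:R) _ P3.
split; last by rewrite (linZ phi_lin) (linB phi_lin) (linZ phi_lin) e2 e1 e4 e3.
rewrite -[_ *: _]addr0; apply: P_lin => //.
by rewrite addrC -scaleNr; exact: P_lin.
Qed.

Lemma intertwined_fadd a b a' b' : intertwined a b -> intertwined a' b' ->
  intertwined (fadd a a') (fadd b b').
Proof.
move=> ab ab' x v Pv; have [P1 e1] := ab x v Pv; have [P2 e2] := ab' x v Pv.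
split; last by rewrite (linD phi_lin) e1 e2.
by rewrite /fadd -[a x v]scale1r; exact: P_lin.
Qed.

Lemma intertwined_fscale t a b : intertwined a b -> intertwined (fscale t a) (fscale t b).
Proof.
move=> ab x v Pv; have [P1 e1] := ab x v Pv.
split; last by rewrite (linZ phi_lin) e1.
by rewrite /fscale -[_ *: _]addr0; exact: P_lin.
Qed.

Lemma intertwined_fid : intertwined (@fid F V) (@fid F V).
Proof. by move=> x v Pv; rewrite /fid; case: (x == -1); rewrite ?(lin0 phi_lin). Qed.

End NprodClosure.

(** * Subspaces and exponentials on the tensor product *)

Section TensorSubspace.
Variables (F : numFieldType) (S1 S2 : fockSpace F) (K : choiceType).
Variables (p1 : K -> fkeys S1) (p2 : K -> fkeys S2) (mk : fkeys S1 -> fkeys S2 -> K).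
Hypotheses (mkK : forall k, mk (p1 k) (p2 k) = k).
Hypotheses (p1E : forall k1 k2, p1 (mk k1 k2) = k1) (p2E : forall k1 k2, p2 (mk k1 k2) = k2).
Local Notation V1 := {malg F[fkeys S1]}.
Local Notation V2 := {malg F[fkeys S2]}.
Local Notation T := {malg F[K]}.
Local Notation tensF := (tens_fieldK p1 p2 mk).
Implicit Types (y : rat) (u : V1) (w : V2) (v : T) (A : set V1) (B : set V2).

Definition tens_subK A B : set T :=
  [set v | exists2 s : seq (V1 * V2), (forall x, x \in s -> A x.1 /\ B x.2) &
     v = \sum_(x <- s) tensK mk x.1 x.2].

Lemma tens_subK0 A B : tens_subK A B 0.
Proof. by exists [::]; rewrite ?big_nil. Qed.

Lemma tens_subKD A B v v' :
  tens_subK A B v -> tens_subK A B v' -> tens_subK A B (v + v').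
Proof.
move=> [s sAB ->] [s' sAB' ->]; exists (s ++ s'); last by rewrite big_cat.
by move=> x; rewrite mem_cat => /orP[/sAB|/sAB'].
Qed.

Lemma tens_subK_sum A B I (s : seq I) (f : I -> T) :
  (forall i, tens_subK A B (f i)) -> tens_subK A B (\sum_(i <- s) f i).
Proof. by move=> fAB; apply: big_ind => //; [exact: tens_subK0|exact: tens_subKD]. Qed.

Lemma tens_subK1 A B u w : A u -> B w -> tens_subK A B (tensK mk u w).
Proof.
by move=> Au Bw; exists [:: (u, w)]; rewrite ?big_seq1// => x; rewrite inE => /eqP ->.
Qed.

Lemma tens_subKZ A B t v : (forall u, A u -> A (t *: u)) ->
  tens_subK A B v -> tens_subK A B (t *: v).
Proof.
move=> At [s sAB ->]; rewrite scaler_sumr big_seq_cond.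
apply: big_ind; [exact: tens_subK0|by move=> *; exact: tens_subKD|move=> x /andP[/sAB[xA xB] _]].
by rewrite -(linZ (tens_linl mk x.2)); apply: tens_subK1 => //; exact: At.
Qed.

Lemma tens_subK_lin A B A' B' (D : T -> T) : lin D ->
    (forall u w, A u -> B w -> tens_subK A' B' (D (tensK mk u w))) ->
  forall v, tens_subK A B v -> tens_subK A' B' (D v).
Proof.
move=> Dl DAB v [s sAB ->]; rewrite (lin_sum Dl) big_seq_cond.
apply: big_ind; [exact: tens_subK0|by move=> *; exact: tens_subKD|].
by move=> x /andP[/sAB[xA xB] _]; exact: DAB.
Qed.

Lemma tens_subK_eq A B (D D' : T -> T) : lin D -> lin D' ->
    (forall u w, A u -> B w -> D (tensK mk u w) = D' (tensK mk u w)) ->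
  forall v, tens_subK A B v -> D v = D' v.
Proof.
move=> Dl Dl' DD' v [s sAB ->]; rewrite (lin_sum Dl) (lin_sum Dl').
by apply: eq_big_seq => x /sAB[xA xB]; exact: DD'.
Qed.

Lemma tens_subK_keyed (P : set (fkeys S1)) (Q : set (fkeys S2)) v :
  tens_subK (keyed P) (keyed Q) v -> keyed [set k | P (p1 k) /\ Q (p2 k)] v.
Proof.
move=> [s sPQ ->]; rewrite big_seq_cond; apply: keyed_sum => x /andP[/sPQ[xP xQ] _].
exact: keyed_tens p1E p2E _ _ _ _ xP xQ.
Qed.

Lemma tens_subKW A A' B B' v : A `<=` A' -> B `<=` B' ->
  tens_subK A B v -> tens_subK A' B' v.
Proof. by move=> AA' BB' [s sAB ->]; exists s => // x /sAB[/AA' ? /BB' ?]. Qed.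

Lemma tens_subK_field b1 b2 d1 d2 (a : fieldOn V1) (b : fieldOn V2) A B :
    hfield b1 d1 a -> hfield b2 d2 b ->
    (forall x u, A u -> A (a x u)) -> (forall x w, B w -> B (b x w)) ->
  forall x v, tens_subK A B v -> tens_subK A B (tensF a b x v).
Proof.
move=> af bf aA bB x; apply: tens_subK_lin; first exact: tens_fieldK_lin.
move=> u w Au Bw; rewrite (tens_fieldK_tens p1E p2E af bf).
have [s s0] := tens_fieldK_supp mk af bf x u w.
rewrite (fsum_seq s0).2; apply: tens_subK_sum => y.
by apply: tens_subK1; [exact: aA|exact: bB].
Qed.

Section TensorExponential.
Local Notation tensI := (tens_idK p1 p2 mk).
Variables (X : V1 -> V1) (P : set (fkeys S1)).
Hypothesis X_lin : lin X.
Hypothesis X_stable : forall u, keyed P u -> keyed P (X u).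
Hypothesis X_nilp : forall k, P k -> exists M, forall m, (M <= m)%N -> iter m X << k >> = 0.

Lemma tens_idK_linear (f : V1 -> V1) u w : lin f -> tensI f (tensK mk u w) = tensK mk (f u) w.
Proof.
move=> fl; apply: (tens_idK_tens p1E p2E); rewrite {1}(malg_sum u) (lin_sum fl).
by apply: eq_bigr => k _; rewrite (linZ fl).
Qed.

Lemma tens_idK_iter n u w : iter n (tensI X) (tensK mk u w) = tensK mk (iter n X u) w.
Proof. by elim: n => //= n ->; exact: tens_idK_linear. Qed.

Let PT : set K := [set k | P (p1 k)].

Lemma tens_idK_stable v : keyed PT v -> keyed PT (tensI X v).
Proof.
apply: keyed_lin; first exact: linext_lin.
move=> k kP; rewrite (tens_key mkK k) (tens_idK_linear _ _ X_lin).
have kP1 : keyed P (<< p1 k >> : V1) by exact: (@keyed1 _ _ P (p1 k) kP).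
have := keyed_tens p1E p2E (X_stable kP1) (keyed1 (P := [set p2 k]) erefl).
by apply: keyedW => k' [].
Qed.

Lemma tens_idK_nilp k : PT k ->
  exists M, forall m, (M <= m)%N -> iter m (tensI X) << k >> = 0.
Proof.
move=> /X_nilp[M MX]; exists M => m /MX Xk.
by rewrite (tens_key mkK k) tens_idK_iter Xk (lin0 (tens_linl mk _)).
Qed.

Lemma tens_exp u w : keyed P u -> tensI (expop X) (tensK mk u w) = tensK mk (expop X u) w.
Proof. by move=> uP; apply: (tens_idK_tens p1E p2E); exact: (exp_keys X_lin X_nilp). Qed.

(** Makes relations between X (x) Id and the screening operator on the whole tensor product
    applicable to Omega (x) Id. *)
Lemma tens_idK_exp v : keyed PT v -> tensI (expop X) v = expop (tensI X) v.
Proof.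
have Tl : lin (tensI X) by exact: linext_lin.
move=> vP; rewrite (exp_keys Tl tens_idK_nilp vP) /tens_idK /linext.
apply: eq_big_seq => k /vP kP; congr (_ *: _).
have kP1 : keyed P (<< p1 k >> : V1) by exact: (@keyed1 _ _ P (p1 k) kP).
have e := exp_sum X_lin X_nilp kP1.
have kP' : keyed PT (<< k >> : T) by exact: (@keyed1 _ _ PT k kP).
have e' := exp_sum Tl tens_idK_nilp kP'.
apply: (sumsto_uniq (sumsto_lin (tens_linl mk << p2 k >>) e)).
apply: eq_sumsto e' => n; rewrite /exp_term (linZ (tens_linl mk _)) -tens_idK_iter.
by rewrite -(tens_key mkK k).
Qed.

End TensorExponential.

End TensorSubspace.

(** * The screening operator *)

Lemma nprod_heisZ (F : numFieldType) (S : fockSpace F) (b h : charges S) (e : rat)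
    (X : fieldOn {malg F[fkeys S]}) n t x v : hfield b e X ->
  nprod n (heisF (t *: h)) X x v = ratr t *: nprod n (heisF h) X x v.
Proof.
move=> Xf; have e0 : nprod n (heisF (0 : charges S)) X x v = 0.
  apply: (addrI (nprod n (heisF (0 : charges S)) X x v)).
  have := nprod_heis_linear n 1 0 0 x v Xf.
  by rewrite rmorph1 !scale1r !addr0 => <-.
by rewrite -[t *: h]addr0 (nprod_heis_linear _ _ _ _ _ _ Xf) e0 addr0.
Qed.

(** Besides h^2 - h'^2 = (h - h')(h + h'), the Leibniz rule replaces the derivative of h + h':
    differentiating e^(-c) yields the s c in the first factor, and the total derivative yields the
    last term. *)
Lemma difference_of_squares (F : numFieldType) (S : fockSpace F) (c h h' : charges S)
    (X : fieldOn {malg F[fkeys S]}) (s : rat) : vertex_op (- c) X -> forall x v,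
  nop h (nop h X) x v - nop h' (nop h' X) x v
    + ratr s *: (nprod (-2) (heisF h) X x v + nprod (-2) (heisF h') X x v)
  = nop (h - h' + s *: c) (nop (h + h') X) x v
    - ratr (s * x) *: nop (h + h') X (x - 1) v.
Proof.
move=> XV x v; have [Xf Xc _] := XV.
have f1 := nop_hfield h Xf; have f2 := nop_hfield h' Xf; have fc := nop_hfield c Xf.
have f12 := nop_hfield (h + h') Xf.
have N2 a : nprod (-2) (heisF a) X x v = - ratr x *: nop a X (x - 1) v + nop c (nop a X) x v.
  rewrite (nprod2_deriv a XV) (@eq_nop _ _ a (nop (- c) X) (fscale (-1) (nop c X))).
    by rewrite (nop_scale _ _ _ _ fc) scaleN1r opprK (nop_comm _ _ Xf Xc).
  by move=> y w; rewrite /fscale (nopNl _ _ _ Xf) scaleN1r.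
have NN a : nop a (nop (h + h') X) x v = nop a (nop h X) x v + nop a (nop h' X) x v.
  rewrite (@eq_nop _ _ a (nop (h + h') X) (fadd (nop h X) (nop h' X))); first exact: nop_add f1 f2.
  by move=> y w; rewrite /fadd (nopDl _ _ _ _ Xf).
rewrite !N2 (nopDl _ _ _ _ f12) (nopDl _ _ _ _ f12) (nopNl _ _ _ f12) (nopZl _ _ _ _ f12).
rewrite !NN (nop_comm h' h Xf Xc) (nopDl _ _ _ _ Xf) rmorphM.
by malg_ring.
Qed.

Section Screening.
Variables (F : numFieldType) (S1 S2 : fockSpace F) (K : choiceType).
Variables (p1 : K -> fkeys S1) (p2 : K -> fkeys S2) (mk : fkeys S1 -> fkeys S2 -> K).
Hypotheses (mkK : forall k, mk (p1 k) (p2 k) = k).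
Hypotheses (p1E : forall k1 k2, p1 (mk k1 k2) = k1) (p2E : forall k1 k2, p2 (mk k1 k2) = k2).
Local Notation V1 := {malg F[fkeys S1]}.
Local Notation V2 := {malg F[fkeys S2]}.
Local Notation T := {malg F[K]}.
Local Notation TS := (tens_space mkK p1E p2E).
Local Notation tensF := (tens_fieldK p1 p2 mk).
Local Notation L := (charges S1 * charges S2)%type.
Local Notation "<[ a , b ]>" := (@pr F TS a b).

Section FieldLinearity.
Variables (b1 b1' : charges S1) (b2 : charges S2) (d1 d1' d2 : rat).
Variables (a a' : fieldOn V1) (b : fieldOn V2).
Hypotheses (af : hfield b1 d1 a) (af' : hfield b1' d1' a') (bf : hfield b2 d2 b).

Lemma tens_fadd x v : tensF (fadd a a') b x v = tensF a b x v + tensF a' b x v.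
Proof.
apply: (@lin_eq _ _ _ (tensF (fadd a a') b x) (fun v => tensF a b x v + tensF a' b x v)).
- exact: tens_fieldK_lin.
- by apply: lin_add; exact: tens_fieldK_lin.
move=> k _; rewrite /tens_fieldK !linextE.
have f1 := tens_field_fsupp mk af bf x << p1 k >> << p2 k >>.
have f2 := tens_field_fsupp mk af' bf x << p1 k >> << p2 k >>.
rewrite -(fsum_add f1 f2).2; apply: eq_fsbigr => y _.
exact: (linD (tens_linl mk _)).
Qed.

Lemma tens_comb s s' x v : tensF (fadd (fscale s a) (fscale s' a')) b x v
  = s *: tensF a b x v + s' *: tensF a' b x v.
Proof.
apply: (@lin_eq _ _ _ (tensF (fadd (fscale s a) (fscale s' a')) b x)
  (fun v => s *: tensF a b x v + s' *: tensF a' b x v)).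
- exact: tens_fieldK_lin.
- by apply: lin_add; apply: lin_scale; exact: tens_fieldK_lin.
move=> k _; rewrite /tens_fieldK !linextE.
have f1 := tens_field_fsupp mk af bf x << p1 k >> << p2 k >>.
have f2 := tens_field_fsupp mk af' bf x << p1 k >> << p2 k >>.
rewrite -(fsum_scale s f1) -(fsum_scale s' f2).
rewrite -(fsum_add (fsupp_scale s f1) (fsupp_scale s' f2)).2; apply: eq_fsbigr => y _.
have tl := tens_linl mk (b (x - 1 - y) << p2 k >>).
by rewrite /fadd /fscale (linD tl) (linZ tl) (linZ tl).
Qed.

End FieldLinearity.

Variables (gam : charges S1) (c d : charges S2) (p : nat).
Variables (E1 : charges S1 -> fieldOn V1) (E2 : charges S2 -> fieldOn V2).
Hypotheses (p_ge2 : (2 <= p)%N) (gam_pr : pr gam gam = (2 * p)%:R).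
Hypotheses (cc : pr c c = 0) (dd : pr d d = 0) (cd : pr c d = 2).
Hypotheses (E1V : forall a, vertex_op a (E1 a)) (E2V : forall a, vertex_op a (E2 a)).
Implicit Types (x y : rat) (v : T).

Definition muP := 2%:R^-1 *: d + (level p / 4%:R) *: c.
Definition nuP := 2%:R^-1 *: d - (level p / 4%:R) *: c.
Definition beta : L := ((2 * p)%:R^-1 *: gam, nuP).

Definition oneP : fieldOn V1 := E1 (0 *: gam).
Definition scr : fieldOn T := tensF (elat gam E1 ((2 * p)%:R^-1)) (E2 nuP).
Definition feP : fieldOn T := tensF oneP (E2 c).
Definition fhP : fieldOn T :=
  tensF oneP (nprod (- 1%:Z) (heisF (2%:R *: muP)) (E2 0)).
Definition ffP (om : fieldOn V1) : fieldOn T :=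
  fadd (fscale (ratr (level p + 2%:R)) (tensF om (E2 (- c))))
    (fadd
      (fscale (-1)
        (tensF oneP (nprod (- 1%:Z) (heisF nuP) (nprod (- 1%:Z) (heisF nuP) (E2 (- c))))))
      (fscale (- ratr (level p + 1))
        (tensF oneP (nprod (- 2%:Z) (heisF nuP) (E2 (- c)))))).

Definition domP : set K := [set k |
  pr ((2 * p)%:R^-1 *: gam) (ch (p1 k)) + pr nuP (ch (p2 k)) \is a Num.int].

Let p0 : p%:R != 0 :> rat. Proof. by rewrite pnatr_eq0; lia. Qed.

Lemma oneP_fid : oneP = @fid F V1.
Proof. by rewrite /oneP scale0r (E0_fid E1V). Qed.

Lemma pr_nu_nu : pr nuP nuP = - level p / 2.
Proof.
rewrite /nuP !prDl !prDr !prNl !prNr !prZl !prZr cc dd cd (prC d c) cd.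
by field.
Qed.

Lemma pr_nu_c : pr nuP c = 1.
Proof. by rewrite /nuP prDl prNl !prZl cc (prC d c) cd; field. Qed.

Lemma pr_nu_mu : pr nuP muP = 0.
Proof.
rewrite /nuP /muP !prDl !prDr !prNl !prZl !prZr cc dd cd (prC d c) cd.
by field.
Qed.

Lemma pr_g_g : pr ((2 * p)%:R^-1 *: gam) ((2 * p)%:R^-1 *: gam) = (2 * p%:R)^-1.
Proof. by rewrite prZl prZr gam_pr natrM; field. Qed.

Lemma prTE (a b : L) : <[a, b]> = pr a.1 b.1 + pr a.2 b.2. Proof. by []. Qed.

(** <nu,nu> = -k/2 = 1 - 1/(2p) and gamma/2p has square 1/(2p). So s(z) anticommutes with itself,
    whence S^2 = 0. *)
Lemma pr_beta : <[beta, beta]> = 1.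
Proof. by rewrite prTE /= pr_g_g pr_nu_nu /level; field. Qed.

Lemma scrV : @vertex_op F TS beta scr.
Proof. by apply: tens_vertex_op; [exact: elatV|exact: E2V]. Qed.

Local Notation Scr := (scr 0).
Lemma scr_lin x : lin (scr x). Proof. exact: hf_lin (vo_field scrV) x. Qed.

Lemma scr_anti b X : @vertex_op F TS b X -> <[beta, b]> = 1 ->
  forall x y v, scr x (X y v) = - X y (scr x v).
Proof.
by move=> XV e x y v; rewrite (@vo_comm _ _ 1 _ _ _ _ scrV XV e) expr1 scaleN1r.
Qed.

Lemma scr_sqr v : Scr (Scr v) = 0.
Proof.
have /eqP := scr_anti scrV pr_beta 0 0 v.
by rewrite -subr_eq0 opprK -mulr2n -scaler_nat scaler_eq0 pnatr_eq0 /= => /eqP.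
Qed.

Lemma scr_fe x v : Scr (feP x v) = - feP x (Scr v).
Proof.
apply: (@scr_anti (0, c)); last by rewrite prTE /= pr0r add0r pr_nu_c.
by rewrite /feP oneP_fid; apply: tens_vertex_op; [exact: fid_vo|exact: E2V].
Qed.

Lemma fhP_E x v : fhP x v = @heisF F TS (0, 2%:R *: muP) x v.
Proof.
rewrite /fhP oneP_fid (E0_fid E2V).
rewrite (tens_nprod_r mkK p1E p2E (vo_field (fid_vo S1)) (vo_field (fid_vo S2))) -nopE.
have fT : @vertex_op F TS 0 (tensF (@fid F V1) (@fid F V2)).
  by apply: tens_vertex_op; exact: fid_vo.
have -> : tensF (@fid F V1) (@fid F V2) = @fid F T.
  by apply/funext => y; apply/funext => w; exact: (vo0_fid fT).
exact: (@nop_fid F TS).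
Qed.

Lemma scr_hm (h : L) n v : <[h, beta]> = 0 -> Scr (hmT p1 p2 mk h n v) = hmT p1 p2 mk h n (Scr v).
Proof.
move=> hb; have := vo_cov scrV h n 0 v.
by rewrite hb rmorph0 scale0r addr0; exact: esym.
Qed.

Lemma scr_fh x v : Scr (fhP x v) = fhP x (Scr v).
Proof.
rewrite !fhP_E /heisF; case: (boolP (x \is a Num.int)) => [_|_]; last exact: lin0 (scr_lin 0).
by apply: scr_hm; rewrite prTE /= pr0l add0r prZl prC pr_nu_mu mulr0.
Qed.

Lemma domP_lin (D : T -> T) (b : L) : lin D ->
    (forall l v, keyed [set k | (ch (p1 k), ch (p2 k)) = l :> L] v ->
       keyed [set k | (ch (p1 k), ch (p2 k)) = l + b :> L] (D v)) ->
    <[beta, b]> \is a Num.int ->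
  forall v, keyed domP v -> keyed domP (D v).
Proof.
move=> Dl Dh bZ v vD; apply: (keyed_lin Dl _ vD) => k kD.
have kk : keyed [set k' | (ch (p1 k'), ch (p2 k')) = (ch (p1 k), ch (p2 k)) :> L] (<< k >> : T).
  by refine (keyed1 _).
refine (keyedW _ (Dh _ _ kk)) => k' [e1 e2]; rewrite /domP /= e1 e2 !prDr addrACA.
by rewrite rpredD.
Qed.

Lemma domP_field b e X : @hfield F TS b e X -> <[beta, b]> \is a Num.int ->
  forall x v, keyed domP v -> keyed domP (X x v).
Proof.
move=> Xf bZ x; apply: (@domP_lin _ b) => //; first exact: hf_lin Xf x.
by move=> l v vl; exact (@hf_ch F TS b e X l v x Xf vl).
Qed.

Lemma domP_hm (h : L) n v : keyed domP v -> keyed domP (hmT p1 p2 mk h n v).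
Proof.
have Hf := @heisF_hfield F TS h.
move=> vD; have := @domP_field _ _ _ Hf _ n%:~R v vD.
by rewrite heisF_int pr0r rpred0 => /(_ isT).
Qed.

Local Notation emP := (tensF oneP (E2 (- c))).
Let gT : L := ((2 * p)%:R^-1 *: gam, 0).
Let nT : L := (0, nuP).
Let cT : L := (0, c).
(** The field B; below, [yP] is e^(- b - c) and [u0] is u. *)
Let bP := @nop F TS beta emP.
Let yP := tensF (elat gam E1 (- (2 * p)%:R^-1)) (E2 (- nuP - c)).
Let u0 : L := gT - nT + (1 - p%:R^-1) *: cT.

Let emV : @vertex_op F TS (- cT) emP.
Proof.
rewrite oneP_fid -[- cT]/((- 0, - c) : L) oppr0.
by apply: tens_vertex_op; [exact: fid_vo|exact: E2V].
Qed.
Let ef := vo_field emV.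

(** The double-pole formula for b and - b - c at x = 0, where the term in x drops out. The domain
    supplies the integrality of <b,l>. *)
Lemma bP_scr y v : keyed domP v -> bP y v = Scr (yP y v) - yP y (Scr v).
Proof.
move=> vD; have Nf := nop_hfield (S := TS) beta ef.
have yV : @vertex_op F TS (- (2 * p)%:R^-1 *: gam, - nuP - c) yP.
  by apply: tens_vertex_op; [exact: elatV|exact: E2V].
have zV : @vertex_op F TS (beta + (- (2 * p)%:R^-1 *: gam, - nuP - c)) emP.
  have -> : beta + (- (2 * p)%:R^-1 *: gam, - nuP - c) = - cT :> L; last exact: emV.
  rewrite /beta /cT; congr (_, _) => /=.
    by rewrite scaleNr addrN oppr0.
  by rewrite addrA addrN add0r.
have ab2 : <[beta, ((- (2 * p)%:R^-1 *: gam, - nuP - c) : L)]> = -2.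
  rewrite prTE /= scaleNr prNr pr_g_g prDr !prNr pr_nu_nu pr_nu_c /level.
  by field.
have yl := hf_lin (vo_field yV) y.
have Dl : lin (fun v => Scr (yP y v) - yP y (Scr v)).
  apply: lin_add; first exact: (lin_comp (scr_lin 0) yl).
  by apply: lin_opp; exact: (lin_comp yl (scr_lin 0)).
apply: (lin_eq (hf_lin Nf y) Dl) => k /vD kD.
have kZ : 0 + <[beta, ch (f := TS) k]> \is a Num.int by rewrite add0r.
have kk : keyed [set k' | ch (f := TS) k' = ch (f := TS) k] (<< k >> : T) by refine (keyed1 _).
rewrite (vo_comm_pole2 scrV yV zV ab2 y kZ kk) rmorph0 scale0r add0r add0r.
by rewrite addrAC subrr add0r.
Qed.

(** With B = S Y - Y S and S^2 = 0, both sides equal -S Y S. *)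
Lemma scr_bP y v : keyed domP v -> Scr (bP y v) = - bP y (Scr v).
Proof.
move=> vD; have sD : keyed domP (Scr v).
  by apply: (domP_field (vo_field scrV)) => //; rewrite pr_beta rpred1.
have yl : lin (yP y) by exact: tens_fieldK_lin.
have e1 := bP_scr y vD; have e2 := bP_scr y sD.
have s1 := scr_sqr v; have s2 := scr_sqr (yP y v).
rewrite s1 (lin0 yl) subr0 in e2; rewrite e1 e2.
by rewrite (linB (scr_lin 0)) s2 sub0r.
Qed.

(** The sum is 1/(2p) + k/2 + (1 - 1/p) = 0: the coefficient of c forced by the factorisation of f
    is the one that makes the modes of u commute with S. *)
Lemma pr_u0_beta : <[u0, beta]> = 0.
Proof.
rewrite prTE /u0 /= !scaler0 addr0 subr0 pr_g_g add0r prDl prNl pr_nu_nu prZl.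
by rewrite (prC c) pr_nu_c /level; field.
Qed.

Let nopPE (h : L) (X : fieldOn T) : nprod (-1) (@heisF F TS h) X = @nop F TS h X.
Proof. by rewrite nopE. Qed.

(** With gamma = 2p [gT] and k + 2 = 1/p, the coefficients of (k + 2) omega become 1 and 1 - 1/p =
    -(k + 1), matching those of nu up to the sign of the square, so [difference_of_squares]
    applies. *)
Lemma ffPE x v : ffP (omL gam p E1) x v
  = @nop F TS u0 bP x v - ratr ((1 - p%:R^-1) * x) *: bP (x - 1) v.
Proof.
have of0 : hfield 0 (-1) oneP by rewrite oneP_fid; exact: vo_field (fid_vo S1).
have ec := vo_field (E2V (- c)).
have o1 : E1 0 = oneP by rewrite oneP_fid (E0_fid E1V).
have Lp n h d1 d2 a b b1 b2 : hfield b1 d1 a -> hfield b2 d2 b ->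
    tensF (nprod n (heisF h) a) b = nprod n (@heisF F TS (h, 0)) (tensF a b).
  by move=> af bf; apply/funext => y; apply/funext => w; exact: tens_nprod_l af bf n h y w.
have Rp n h d1 d2 a b b1 b2 : hfield b1 d1 a -> hfield b2 d2 b ->
    tensF a (nprod n (heisF h) b) = nprod n (@heisF F TS (0, h)) (tensF a b).
  by move=> af bf; apply/funext => y; apply/funext => w; exact: tens_nprod_r af bf n h y w.
have g1 := nprod_hfield (-1) gam of0.
have n1 := nprod_hfield (-1) nuP ec.
have [f1 f2] : hfield 0 1 (nprod (-1) (heisF gam) (nprod (-1) (heisF gam) oneP)) /\
    hfield 0 1 (nprod (-2) (heisF gam) oneP).
  split.
    by have := nprod_hfield (-1) gam g1; have -> : -1 - (-1)%:~R - (-1)%:~R = 1 :> rat by ring.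
  by have := nprod_hfield (-2) gam of0; have -> : -1 - (-2)%:~R = 1 :> rat by ring.
pose G : L := (gam, 0).
have om : tensF (omL gam p E1) (E2 (- c)) x v
    = ratr (4 * p%:R)^-1 *: @nop F TS G (@nop F TS G emP) x v
      + ratr ((p%:R - 1) / (2 * p%:R)) *: nprod (-2) (@heisF F TS G) emP x v.
  have e1 : (4 * p)%:R^-1 = ratr (4 * p%:R)^-1 :> F.
    by rewrite fmorphV rmorphM /= !ratr_nat natrM.
  have e2 : (p%:R - 1) / (2 * p)%:R = ratr ((p%:R - 1) / (2 * p%:R)) :> F.
    by rewrite rmorphM fmorphV rmorphM rmorphB /= !ratr_nat rmorph1 natrM.
  have LB := Lp (-2) gam _ _ _ _ _ _ of0 ec.
  have LA : tensF (nprod (-1) (heisF gam) (nprod (-1) (heisF gam) oneP)) (E2 (- c))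
      = @nop F TS G (@nop F TS G emP).
    by rewrite (Lp _ _ _ _ _ _ _ _ g1 ec) (Lp _ _ _ _ _ _ _ _ of0 ec) !nopPE.
  rewrite /omL o1 e1 e2; have := tens_comb f1 f2 ec _ _ x v.
  by rewrite LA LB; exact.
have GE : G = (2 * p%:R) *: gT.
  by rewrite /G /gT; congr (_, _); rewrite /= ?scaler0// scalerA natrM mulfV ?scale1r// mulf_neq0.
have ng := nop_hfield (S := TS) gT ef.
have N1 : @nop F TS G (@nop F TS G emP) x v
    = ratr ((2 * p%:R) ^+ 2) *: @nop F TS gT (@nop F TS gT emP) x v.
  rewrite GE (nopZl _ _ _ _ (nop_hfield (S := TS) _ ef)).
  rewrite (@eq_nop _ TS gT _ (fscale (ratr (2 * p%:R)) (@nop F TS gT emP))).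
    by rewrite (nop_scale _ _ _ _ ng) scalerA -rmorphM expr2.
  by move=> y w; rewrite (nopZl _ _ _ _ ef).
have N2 : nprod (-2) (@heisF F TS G) emP x v
    = ratr (2 * p%:R) *: nprod (-2) (@heisF F TS gT) emP x v.
  by rewrite GE; exact: (@nprod_heisZ F TS _ gT _ _ (-2) (2 * p%:R) x v ef).
have om' := etrans om (congr2 (fun a b => ratr (4 * p%:R)^-1 *: a
  + ratr ((p%:R - 1) / (2 * p%:R)) *: b) N1 N2).
have bE : beta = gT + nT by rewrite /beta /gT /nT; congr (_, _); rewrite /= ?addr0 ?add0r.
have dsq := difference_of_squares (S := TS) gT nT (1 - p%:R^-1) emV x v.
have LN1 : tensF oneP (nprod (-1) (heisF nuP) (nprod (-1) (heisF nuP) (E2 (- c))))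
    = @nop F TS nT (@nop F TS nT emP).
  by rewrite (Rp _ _ _ _ _ _ _ _ of0 n1) (Rp _ _ _ _ _ _ _ _ of0 ec) !nopPE.
have LN2 := Rp (-2) nuP _ _ _ _ _ _ of0 ec.
rewrite /bP bE; refine (etrans _ dsq).
rewrite /ffP /fadd /fscale LN1 LN2 om'.
have -> : ratr (level p + 2%:R) = ratr p%:R^-1 :> F by congr ratr; rewrite /level; ring.
have -> : ratr (level p + 1) = - ratr (1 - p%:R^-1) :> F.
  by rewrite -rmorphN; congr ratr; rewrite /level; ring.
have e1 : ratr p%:R^-1 * (ratr (4 * p%:R)^-1 * ratr ((2 * p%:R) ^+ 2)) = 1 :> F.
  by rewrite -!rmorphM -[RHS](rmorph1 (@ratr F)); congr ratr; field.
have e2 : ratr p%:R^-1 * (ratr ((p%:R - 1) / (2 * p%:R)) * ratr (2 * p%:R))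
    = ratr (1 - p%:R^-1) :> F.
  by rewrite -!rmorphM; congr ratr; field.
have key (r0 r1 r2 r3 r4 s : F) (A B C D : T) : r0 * (r1 * r2) = 1 -> r0 * (r3 * r4) = s ->
    r0 *: (r1 *: (r2 *: A) + r3 *: (r4 *: B)) + (-1 *: C + - - s *: D) = A - C + s *: (B + D).
  move=> h1 h2; rewrite scalerDr (scalerA r1) (scalerA r0) (scalerA r3) (scalerA r0) h1 h2.
  by malg_ring.
exact: key.
Qed.

Lemma scr_ff x v : keyed domP v ->
  Scr (ffP (omL gam p E1) x v) = - ffP (omL gam p E1) x (Scr v).
Proof.
move=> vD; rewrite !ffPE.
have bf := nop_hfield (S := TS) beta ef.
have P1 := @nopP F TS _ _ _ u0 x v bf.
have P2 := @nopP F TS _ _ _ u0 x (Scr v) bf.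
have e1 : Scr (@nop F TS u0 bP x v) = - @nop F TS u0 bP x (Scr v).
  apply: (sumsto_uniq (sumsto_lin (scr_lin 0) P1)); apply: eq_sumsto (sumstoN P2) => j.
  rewrite (linD (scr_lin 0)) (scr_hm _ _ pr_u0_beta) (scr_bP _ vD).
  rewrite (scr_bP _ (@domP_hm _ _ _ vD)) (scr_hm _ _ pr_u0_beta).
  by rewrite (linN (hmT_lin p1 p2 mk u0 _)) opprD.
have e2 := scr_bP (x - 1) vD.
rewrite (linB (scr_lin 0)) (linZ (scr_lin 0)) e1 e2 scalerN.
by rewrite opprD.
Qed.

Implicit Types (u : V1) (w : V2).
Local Notation tensI := (tens_idK p1 p2 mk).
Local Notation HL := (keyed (halfL gam)).
Local Notation PiH := (keyed (halfL c)).
Local Notation om := (omL gam p E1).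

Definition doubP : set V1 := [set u | HL u /\ Qold gam p E1 u = 0].
Definition doubNP : set V1 := [set u | HL u /\ Qold gam p E1 u + Qadd gam p E1 u = 0].
Definition kerP (A : set V1) : set T :=
  [set v | [/\ tens_subK mk A PiH v, keyed domP v & Scr v = 0]].
Definition phiP : T -> T := tensI (OmL gam E1).
Definition psiP : T -> T := tensI (OmLN gam E1).

Let X := expX gam E1.
Let XN := fun u => - X u.
Let PT : set K := [set k | halfL gam (p1 k)].
Let Xl : lin X := expX_lin gam E1V.
Let Xs u : HL u -> HL (X u). Proof. exact: expX_stable. Qed.
Let Xn := expX_nilp p_ge2 gam_pr E1V.
Let XNl : lin XN := expXN_lin gam E1V.
Let XNs u : HL u -> HL (XN u). Proof. exact: expXN_stable. Qed.
Let XNn := expXN_nilp p_ge2 gam_pr E1V.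

Let beta1 : @pr F TS beta (1 *: gam, 0) = 1.
Proof.
by rewrite prTE /= pr0r addr0 scale1r prZl gam_pr mulVf// natrM mulf_neq0.
Qed.

Lemma tens_expX_fid v : tensI X v = tensF (elat gam E1 1) (@fid F V2) 1 v.
Proof. by rewrite tens_fid. Qed.

Let XTV : @vertex_op F TS (1 *: gam, 0) (tensF (elat gam E1 1) (@fid F V2)).
Proof. by apply: tens_vertex_op; [exact: elatV|exact: fid_vo]. Qed.

Lemma scr_expX v : Scr (tensI X v) = - tensI X (Scr v).
Proof. by rewrite !tens_expX_fid; exact: (scr_anti XTV beta1). Qed.

Lemma tens_expXN v : tensI XN v = - tensI X v.
Proof.
apply: (@lin_eq _ _ _ (tensI XN) (fun v => - tensI X v)); first exact: linext_lin.
  by apply: lin_opp; exact: linext_lin.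
move=> k _; rewrite (tens_key mkK k) (tens_idK_linear p1E p2E _ _ XNl).
by rewrite (tens_idK_linear p1E p2E _ _ Xl) (linN (tens_linl mk _)).
Qed.

Lemma phiPE v : keyed PT v -> phiP v = expop (tensI X) v.
Proof. exact: (tens_idK_exp mkK p1E p2E Xl Xn). Qed.

Lemma psiPE v : keyed PT v -> psiP v = expop (tensI XN) v.
Proof. exact: (tens_idK_exp mkK p1E p2E XNl XNn). Qed.

Lemma scr_phiP v : keyed PT v -> Scr v = 0 -> Scr (phiP v) = 0.
Proof.
move=> vP; rewrite phiPE//.
have Tl : lin (tensI X) by exact: linext_lin.
apply: (exp_anticomm Tl (tens_idK_stable mkK p1E p2E Xl Xs)
  (tens_idK_nilp mkK p1E p2E Xl Xn) _ (X' := tensI X) _ _ vP).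
- exact: scr_lin.
- exact: linext_lin.
- by move=> w _; exact: scr_expX.
Qed.

Lemma scr_psiP v : keyed PT v -> Scr v = 0 -> Scr (psiP v) = 0.
Proof.
move=> vP; rewrite psiPE//.
have Tl : lin (tensI XN) by exact: linext_lin.
apply: (exp_anticomm Tl (tens_idK_stable mkK p1E p2E XNl XNs)
  (tens_idK_nilp mkK p1E p2E XNl XNn) _ (X' := tensI XN) _ _ vP).
- exact: scr_lin.
- exact: linext_lin.
- by move=> w _; have Sl : lin Scr := scr_lin 0; rewrite !tens_expXN (linN Sl) scr_expX.
Qed.

Lemma dom_expX v : keyed domP v -> keyed domP (tensI X v).
Proof.
move=> vD; rewrite tens_expX_fid; apply: (domP_field (vo_field XTV)) => //.
by rewrite beta1 rpred1.
Qed.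

Lemma dom_phiP v : keyed PT v -> keyed domP v -> keyed domP (phiP v).
Proof. by move=> vP; rewrite phiPE//; exact: exp_keyed dom_expX v. Qed.

Lemma dom_psiP v : keyed PT v -> keyed domP v -> keyed domP (psiP v).
Proof.
move=> vP; rewrite psiPE//; refine (@exp_keyed _ _ _ domP _ v) => w wD.
by rewrite tens_expXN; apply: keyedN; exact: dom_expX.
Qed.

Lemma doubP_Z t u : doubP u -> doubP (t *: u).
Proof.
move=> [uH Qu]; split; first exact: keyedZ.
by rewrite (linZ (Qold_lin _ _ E1V)) Qu scaler0.
Qed.

Lemma doubNP_Z t u : doubNP u -> doubNP (t *: u).
Proof.
move=> [uH Qu]; split; first exact: keyedZ.
by rewrite (linZ (Qold_lin _ _ E1V)) (linZ (Qadd_lin _ _ E1V)) -scalerDr Qu scaler0.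
Qed.

Let Sl : lin Scr := scr_lin 0.

Lemma kerP_lin (A : set V1) : (forall t u, A u -> A (t *: u)) ->
  forall t v v', kerP A v -> kerP A v' -> kerP A (t *: v + v').
Proof.
move=> AZ t v v' [vs vD vS] [vs' vD' vS']; split.
- by apply: tens_subKD => //; apply: tens_subKZ => //; exact: AZ.
- by apply: keyedD => //; exact: keyedZ.
- by rewrite Sl vS vS' scaler0 addr0.
Qed.

Lemma kerP0 (A : set V1) : kerP A 0.
Proof. by split; [exact: tens_subK0|exact: keyed0|exact: lin0 Sl]. Qed.

Let phl : lin phiP. Proof. exact: linext_lin. Qed.
Let psl : lin psiP. Proof. exact: linext_lin. Qed.

Lemma phi_tens u w : HL u -> phiP (tensK mk u w) = tensK mk (OmL gam E1 u) w.
Proof. exact: (tens_exp p1E p2E Xl Xn). Qed.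

Lemma psi_tens u w : HL u -> psiP (tensK mk u w) = tensK mk (OmLN gam E1 u) w.
Proof. exact: (tens_exp p1E p2E XNl XNn). Qed.

Let doubP_H : doubP `<=` HL. Proof. by move=> u []. Qed.
Let doubNP_H : doubNP `<=` HL. Proof. by move=> u []. Qed.

Lemma tens_subK_PT (A : set V1) v : A `<=` HL -> tens_subK mk A PiH v -> keyed PT v.
Proof.
move=> AH vA; have := tens_subK_keyed p1E p2E (tens_subKW AH (fun w Pw => Pw) vA).
by apply: keyedW => k [].
Qed.

Lemma phiP_ker v : kerP doubP v -> kerP doubNP (phiP v).
Proof.
move=> [vA vD vS]; have vP := tens_subK_PT doubP_H vA; split; last exact: scr_phiP.
  apply: (tens_subK_lin phl _ vA) => u w [uH Qu] wH; rewrite phi_tens//.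
  apply: tens_subK1 => //; split; first exact: OmL_keyed.
  exact: OmL_doublet.
exact: dom_phiP.
Qed.

Lemma psiP_ker v : kerP doubNP v -> kerP doubP (psiP v).
Proof.
move=> [vA vD vS]; have vP := tens_subK_PT doubNP_H vA; split; last exact: scr_psiP.
  apply: (tens_subK_lin psl _ vA) => u w [uH Qu] wH; rewrite psi_tens//.
  apply: tens_subK1 => //; split; first exact: OmLN_keyed.
  exact: OmLN_doublet.
exact: dom_psiP.
Qed.

Lemma phiPK v : kerP doubP v -> psiP (phiP v) = v.
Proof.
move=> [vA _ _]; apply: (tens_subK_eq (lin_comp psl phl) (@lin_id _ _) _ vA) => u w [uH _] _.
rewrite (phi_tens w uH) (psi_tens w (u := OmL gam E1 u)); last exact: OmL_keyed.
by rewrite (OmLNK p_ge2 gam_pr E1V uH).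
Qed.

Lemma psiPK v : kerP doubNP v -> phiP (psiP v) = v.
Proof.
move=> [vA _ _]; apply: (tens_subK_eq (lin_comp phl psl) (@lin_id _ _) _ vA) => u w [uH _] _.
rewrite (psi_tens w uH) (phi_tens w (u := OmLN gam E1 u)); last exact: OmLN_keyed.
by rewrite (OmLK p_ge2 gam_pr E1V uH).
Qed.

Lemma tens_fid_l b2 e2 (b : fieldOn V2) : hfield b2 e2 b ->
  forall x u w, tensF (@fid F V1) b x (tensK mk u w) = tensK mk u (b x w).
Proof.
move=> bf x u w; rewrite (tens_fieldK_tens p1E p2E (vo_field (fid_vo S1)) bf).
rewrite (fsum_single (i := -1)) => [|y /negbTE y1].
  by rewrite /fid eqxx; congr (tensK mk u (b _ w)); ring.
by rewrite /fid y1; exact: lin0 (tens_linl mk _).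
Qed.

Lemma PiH_field e (n : int) (b : fieldOn V2) : hfield (n%:~R *: (2%:R^-1 *: c)) e b ->
  forall x w, PiH w -> PiH (b x w).
Proof. by move=> bf x w; apply: (halfL_shift bf); exists n. Qed.

Lemma doubP_om x u : doubP u -> doubP (om x u).
Proof.
move=> [uH Qu]; split; last first.
  by rewrite (omL_Qold p_ge2 gam_pr E1V) Qu (lin0 (hf_lin (omL_hfield gam p E1V) x)).
by apply: (halfL_shift (omL_hfield gam p E1V)) => //; exists 0; rewrite scale0r.
Qed.

Section Currents.
Variables (e : rat) (n : int) (b : fieldOn V2).
Hypothesis bf : hfield (n%:~R *: (2%:R^-1 *: c)) e b.
Let bH := PiH_field bf.

Lemma fid_tens_sub x v : tens_subK mk doubP PiH v ->
  tens_subK mk doubP PiH (tensF (oneP) b x v).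
Proof.
rewrite (oneP_fid).
apply: (tens_subK_field p1E p2E (vo_field (fid_vo S1)) bf) => // y u uD.
rewrite /fid; case: (y == -1) => //.
by rewrite -(scale0r u); exact: doubP_Z.
Qed.

Lemma om_tens_sub x v : tens_subK mk doubP PiH v ->
  tens_subK mk doubP PiH (tensF om b x v).
Proof.
apply: (tens_subK_field p1E p2E (omL_hfield gam p E1V) bf) => //.
exact: doubP_om.
Qed.

Lemma phi_fid x v : tens_subK mk doubP PiH v ->
  phiP (tensF (oneP) b x v) = tensF (oneP) b x (phiP v).
Proof.
rewrite (oneP_fid); have tl := tens_fieldK_lin p1 p2 mk (@fid F V1) b x.
apply: (tens_subK_eq (lin_comp phl tl) (lin_comp tl phl)) => u w [uH _] _.
by rewrite (phi_tens w uH) !(tens_fid_l bf) phi_tens.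
Qed.

Lemma phi_om x v : tens_subK mk doubP PiH v ->
  phiP (tensF om b x v) = tensF (fadd om (elat gam E1 1)) b x (phiP v).
Proof.
have omf := omL_hfield gam p E1V; have Ef := vo_field (elatV gam E1V 1).
have tl := tens_fieldK_lin p1 p2 mk om b x.
have tl' := tens_fieldK_lin p1 p2 mk (fadd om (elat gam E1 1)) b x.
apply: (tens_subK_eq (lin_comp phl tl) (lin_comp tl' phl)) => u w [uH _] _.
rewrite (phi_tens w uH) (tens_fadd omf Ef bf).
rewrite (tens_fieldK_tens p1E p2E omf bf) (tens_fieldK_tens p1E p2E omf bf).
rewrite (tens_fieldK_tens p1E p2E Ef bf).
have s1 := tens_field_fsupp mk omf bf x u w.
have s2 := tens_field_fsupp mk omf bf x (OmL gam E1 u) w.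
have s3 := tens_field_fsupp mk Ef bf x (OmL gam E1 u) w.
rewrite -(fsum_add s2 s3).2 (fsum_lin phl s1); apply: eq_fsbigr => y _.
have oH : HL (om y u) by apply: (halfL_shift omf) => //; exists 0; rewrite scale0r.
rewrite (phi_tens _ oH) (OmL_omega p_ge2 gam_pr E1V y uH).
exact: (linD (tens_linl mk _)).
Qed.

End Currents.

Let c_half (n : int) : n%:~R *: c = (n * 2)%:~R *: (2%:R^-1 *: c).
Proof. by rewrite scalerA rmorphM; congr (_ *: _); field. Qed.

Let c_field a (n : int) e X0 : hfield a e X0 -> a = n%:~R *: c ->
  hfield ((n * 2)%:~R *: (2%:R^-1 *: c)) e X0.
Proof. by move=> Xf an; rewrite -c_half -an. Qed.

Let dom_tens a b1 b2 d1 d2 (b : fieldOn V2) : hfield b1 d1 a -> hfield b2 d2 b ->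
    b1 = 0 -> pr nuP b2 \is a Num.int ->
  forall x v, keyed domP v -> keyed domP (tensF a b x v).
Proof.
move=> af bf b10 bZ x v; apply: (domP_field (tens_fieldK_hfield mkK p1E p2E af bf)).
by rewrite prTE /= b10 pr0r add0r.
Qed.

Let nu_c : pr nuP c = 1. Proof. exact: pr_nu_c. Qed.

Let onef : hfield 0 (-1) (oneP).
Proof. by rewrite (oneP_fid); exact: vo_field (fid_vo S1). Qed.

Let tens0 a b x : tensF a b x 0 = 0.
Proof. exact: lin0 (tens_fieldK_lin _ _ _ a b x). Qed.

Let doubZ t v : tens_subK mk doubP PiH v -> tens_subK mk doubP PiH (t *: v).
Proof. by apply: tens_subKZ => u; exact: doubP_Z. Qed.

Let kerD := kerP doubP.

Lemma fe_intertwined : intertwined kerD phiP feP feP.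
Proof.
have cf := c_field (n := 1) (vo_field (E2V c)) (esym (scale1r c)).
move=> x v [vA vD vS]; split; last exact: (phi_fid cf x vA).
split; first exact: (fid_tens_sub cf x vA).
  by apply: (dom_tens onef (vo_field (E2V c))) => //; rewrite nu_c rpred1.
rewrite (scr_fe) vS.
by rewrite /feP tens0 oppr0.
Qed.

Lemma fh_intertwined : intertwined kerD phiP fhP fhP.
Proof.
have bf := nprod_hfield (- 1%:Z) (2%:R *: muP) (vo_field (E2V 0)).
have cf := c_field (n := 0) bf (esym (scale0r c)).
move=> x v [vA vD vS]; split; last exact: (phi_fid cf x vA).
split; first exact: (fid_tens_sub cf x vA).
  by apply: (dom_tens onef bf) => //; rewrite pr0r rpred0.
rewrite (scr_fh) vS.
exact: tens0.
Qed.

Lemma ff_intertwined : intertwined kerD phiP (ffP om) (ffP (fadd om (elat gam E1 1))).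
Proof.
have Ef := vo_field (E2V (- c)).
have n1 := nprod_hfield (- 1%:Z) nuP (nprod_hfield (- 1%:Z) nuP Ef).
have n2 := nprod_hfield (- 2%:Z) nuP Ef.
have cN : - c = (-1)%:~R *: c by rewrite rmorphN rmorph1 scaleN1r.
have ec := c_field (n := -1) Ef cN.
have nc1 := c_field (n := -1) n1 cN.
have nc2 := c_field (n := -1) n2 cN.
have nuZ : pr nuP (- c) \is a Num.int by rewrite prNr nu_c rpredN rpred1.
have omf := omL_hfield gam p E1V.
move=> x v [vA vD vS]; split; last first.
  have lin3 r1 r2 r3 a1 a2 a3 b1 b2 b3 : phiP a1 = b1 -> phiP a2 = b2 -> phiP a3 = b3 ->
      phiP (r1 *: a1 + (r2 *: a2 + r3 *: a3)) = r1 *: b1 + (r2 *: b2 + r3 *: b3).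
    by move=> <- <- <-; rewrite (linD phl) (linD phl) !(linZ phl).
  exact: (lin3 _ _ _ _ _ _ _ _ _ (phi_om ec x vA) (phi_fid nc1 x vA) (phi_fid nc2 x vA)).
split.
- apply: tens_subKD; first by apply: doubZ; exact: (om_tens_sub ec x vA).
  apply: tens_subKD; apply: doubZ.
    exact: (fid_tens_sub nc1 x vA).
  exact: (fid_tens_sub nc2 x vA).
- apply: keyedD; first by apply: keyedZ; exact: (dom_tens omf Ef).
  by apply: keyedD; apply: keyedZ; [exact: (dom_tens onef n1)|exact: (dom_tens onef n2)].
- rewrite (scr_ff x vD) vS.
  by rewrite /ffP /fadd /fscale !tens0 !scaler0 !addr0 oppr0.
Qed.

End Screening.

(** * The isomorphism *)

Section FockShift.
Variables (F : numFieldType) (r : nat) (G : 'M[rat]_r).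
Hypotheses (G_sym : G^T = G) (G_unit : G \in unitmx).
Variables (K J : choiceType) (kc : K -> 'rV[rat]_r) (km : K -> cmonom J).
Variables (mk : 'rV[rat]_r -> cmonom J -> K).
Variables (ix : 'I_r -> nat -> J) (ji : J -> 'I_r) (jn : J -> nat).
Hypotheses (mkK : forall k, mk (kc k) (km k) = k).
Hypotheses (kcE : forall l m, kc (mk l m) = l) (kmE : forall l m, km (mk l m) = m).
Hypotheses (ixK : forall a, ix (ji a) (jn a) = a).
Hypotheses (jiE : forall i n, ji (ix i n) = i) (jnE : forall i n, jn (ix i n) = n).
Local Notation V := {malg F[K]}.
Local Notation S := (fock_space F G_sym G_unit mkK kcE kmE ixK jiE jnE).
Implicit Types (k : K) (v : V).

Definition shiftK (b : 'rV[rat]_r) : V -> V := linext (fun k => << mk (kc k + b) (km k) >>).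

Lemma shiftK_lin b : lin (shiftK b). Proof. exact: linext_lin. Qed.

Lemma shiftK1 b k : shiftK b << k >> = << mk (kc k + b) (km k) >>.
Proof. exact: linextE. Qed.

Lemma shiftK_hsp b (l : charges S) q v : hsp l q v -> @hsp F S (l + b) q (shiftK b v).
Proof.
move=> vq; apply: (keyed_lin (shiftK_lin b) _ vq) => k /= [<- <-].
by rewrite shiftK1; refine (keyed1 _); rewrite /= kcE kmE.
Qed.

Lemma shiftK_vac b l : shiftK b << @vac F S l >> = << @vac F S (l + b) >>.
Proof. by rewrite shiftK1 /= kcE kmE. Qed.

Lemma shiftK_annih b a v : annih kc km mk a (shiftK b v) = shiftK b (annih kc km mk a v).
Proof.
have al := @annih_lin F r K J kc km mk a; have sl := shiftK_lin b.
apply: (lin_eq (lin_comp al sl) (lin_comp sl al)) => k _.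
by rewrite shiftK1 !annih1 (linZ sl) shiftK1 !kcE !kmE.
Qed.

Lemma shiftK_creat b a v : creat kc km mk a (shiftK b v) = shiftK b (creat kc km mk a v).
Proof.
have al := @creat_lin F r K J kc km mk a; have sl := shiftK_lin b.
apply: (lin_eq (lin_comp al sl) (lin_comp sl al)) => k _.
by rewrite shiftK1 !creat1 shiftK1 !kcE !kmE.
Qed.

Lemma shiftK_hm b (h : charges S) n v : n != 0 -> hm h n (shiftK b v) = shiftK b (hm h n v).
Proof.
rewrite -[@hm F S h n]/(hmodeK G kc km mk ix h n); case: n => [[|n]|n] // _.
  rewrite !hmode_annih (lin_sum (shiftK_lin b)); apply: eq_bigr => i _.
  by rewrite (linZ (shiftK_lin b)) shiftK_annih.
rewrite !hmode_creat (lin_sum (shiftK_lin b)); apply: eq_bigr => i _.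
by rewrite (linZ (shiftK_lin b)) shiftK_creat.
Qed.

Lemma vopK_vertex_op (b : charges S) : vertex_op b (@vopS F S shiftK b).
Proof.
apply: vopS_vertex_op.
- exact: shiftK_lin.
- exact: shiftK_hsp.
- exact: shiftK_vac.
- exact: shiftK_hm.
Qed.

End FockShift.

Section FockInstance.
Variables (F : numFieldType) (r : nat) (G : 'M[rat]_r).
Hypotheses (G_sym : G^T = G) (G_unit : G \in unitmx).

Definition fkeyC : choiceType := fkey r.
Definition modes : choiceType := ('I_r * nat)%type.

Definition fockS : fockSpace F :=
  @fock_space F r G G_sym G_unit fkeyC modes fst snd (fun l m => (l, m)) (fun i n => (i, n)) fst snd
   (fun k => let: (_, _) := k in erefl) (fun _ _ => erefl) (fun _ _ => erefl)
   (fun k => let: (_, _) := k in erefl) (fun _ _ => erefl) (fun _ _ => erefl).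

Lemma vop_vertex_op b : @vertex_op F fockS b (@vop F r G b).
Proof. exact: vopK_vertex_op. Qed.

End FockInstance.

Lemma gramL_sym p : (gramL p)^T = gramL p.
Proof. exact: tr_scalar_mx. Qed.

Lemma gramL_unit p : (2 <= p)%N -> gramL p \in unitmx.
Proof. by move=> p2; rewrite unitmxE det_scalar1 unitfE pnatr_eq0; lia. Qed.

Lemma gramPi_sym : gramPi^T = gramPi.
Proof. by apply/matrixP => i j; rewrite !mxE eq_sym. Qed.

Lemma gramPi_unit : gramPi \in unitmx.
Proof.
(* The square of this matrix is 4, so a quarter of it is its inverse. *)
have e : gramPi *m (4%:R^-1 *: gramPi) = 1%:M.
  apply/matrixP => -[[|[|//]] i] -[[|[|//]] j];
    rewrite !mxE !big_ord_recl big_ord0 !mxE /=; by field.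
by have [] := mulmx1_unit e.
Qed.

Lemma pair_gamma p : pair (gramL p) gamma gamma = (2 * p)%:R.
Proof. by rewrite /pair mxE big_ord1 !mxE big_ord1 !mxE eqxx mul1r mulr1. Qed.

Lemma pair_delta2 (i j : 'I_2) : pair gramPi (delta_mx 0 i) (delta_mx 0 j) = gramPi i j.
Proof. by rewrite pair_delta -rowE mxE. Qed.

(** * Assembly for the concrete spaces *)

Section Main.
Variables (F : numFieldType) (p : nat).
Hypothesis p_ge2 : (2 <= p)%N.

Let SL := fockS F (gramL_sym p) (gramL_unit p_ge2).
Let SPi := fockS F gramPi_sym gramPi_unit.
Let KT : choiceType := (fkey 1 * fkey 2)%type.
Let pt1 : KT -> fkeys SL := fst.
Let pt2 : KT -> fkeys SPi := snd.
Let mkT : fkeys SL -> fkeys SPi -> KT := fun a b => (a, b).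
Let mkTK k : mkT (pt1 k) (pt2 k) = k. Proof. by case: k. Qed.
Let E1 : charges SL -> fieldOn {malg F[fkeys SL]} := vop (gramL p).
Let E2 : charges SPi -> fieldOn {malg F[fkeys SPi]} := vop gramPi.
Let E1V a : vertex_op a (E1 a). Proof. exact: vop_vertex_op. Qed.
Let E2V a : vertex_op a (E2 a). Proof. exact: vop_vertex_op. Qed.
Let gamC : charges SL := gamma.
Let cC : charges SPi := c_.
Let dC : charges SPi := d_.

Let gam_pr : pr gamC gamC = (2 * p)%:R. Proof. exact: pair_gamma. Qed.
Let cc : pr cC cC = 0. Proof. by rewrite /pr /= /cC /c_ pair_delta2 mxE. Qed.
Let dd : pr dC dC = 0. Proof. by rewrite /pr /= /dC /d_ pair_delta2 mxE. Qed.
Let cd : pr cC dC = 2. Proof. by rewrite /pr /= /cC /dC /c_ /d_ pair_delta2 mxE. Qed.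

Let pt1E k1 k2 : pt1 (mkT k1 k2) = k1. Proof. by []. Qed.
Let pt2E k1 k2 : pt2 (mkT k1 k2) = k2. Proof. by []. Qed.

Local Notation phi := (@Omega_bar F p).
Local Notation Vold := (@Vp F p).
Local Notation Vnew := (@Vp_new F p).

Let phi_lin : lin phi. Proof. exact: linext_lin. Qed.

Let Vold_lin t u v : Vold u -> Vold v -> Vold (t *: u + v).
Proof.
(* [Vp] is convertible to [kerP] of [doubP] at these instances; the general lemmas are transported
   by conversion alone. *)
move=> uV vV; refine (@kerP_lin F SL SPi KT pt1 pt2 mkT mkTK pt1E pt2E gamC cC dC p
  E1 E2 E1V E2V (doubP gamC p E1) _ t u v uV vV) => s w; exact: doubP_Z.
Qed.

Let Vold0 : Vold 0. Proof. exact: (kerP0 mkTK pt1E pt2E gamC cC dC p E1V E2V). Qed.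

Let Vnew_lin t u v : Vnew u -> Vnew v -> Vnew (t *: u + v).
Proof.
move=> uV vV; refine (@kerP_lin F SL SPi KT pt1 pt2 mkT mkTK pt1E pt2E gamC cC dC p
  E1 E2 E1V E2V (doubNP gamC p E1) _ t u v uV vV) => s w; exact: doubNP_Z.
Qed.

Let Vnew0 : Vnew 0. Proof. exact: (kerP0 mkTK pt1E pt2E gamC cC dC p E1V E2V). Qed.

Let psi := psiP pt1 pt2 mkT gamC E1.

Let phi_Vold v : Vold v -> Vnew (phi v).
Proof. exact: (phiP_ker mkTK pt1E pt2E p_ge2 gam_pr E1V E2V). Qed.

Let psi_Vnew v : Vnew v -> Vold (psi v).
Proof. exact: (psiP_ker mkTK pt1E pt2E p_ge2 gam_pr E1V E2V). Qed.

Let phiK v : Vold v -> psi (phi v) = v.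
Proof. exact: (phiPK pt1E pt2E p_ge2 gam_pr E1V). Qed.

Let psiK v : Vnew v -> phi (psi v) = v.
Proof. exact: (psiPK pt1E pt2E p_ge2 gam_pr E1V). Qed.

Let phi_inj v : Vold v -> phi v = 0 -> v = 0.
Proof.
have psl : lin psi by exact: linext_lin.
by move=> vV v0; exact (etrans (esym (phiK vV)) (etrans (congr1 psi v0) (lin0 psl))).
Qed.

(** Stability of the kernel and equivariance go through the induction together, since the terms of
    an n-th product apply one field to the result of another. *)
Lemma Lk_action_intertwined a b : @Lk_action F p a b -> intertwined Vold phi a b.
Proof.
elim=> [||||{}a {}b a' b' _ Ia _ Ia'|t {}a {}b _ Ia|n {}a {}b a' b' _ Ia _ Ia'].
- exact: intertwined_fid.
- exact: (fe_intertwined mkTK pt1E pt2E p_ge2 gam_pr cc cd E1V E2V).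
- exact: (fh_intertwined mkTK pt1E pt2E p_ge2 gam_pr cc dd cd E1V E2V).
- exact: (ff_intertwined mkTK pt1E pt2E p_ge2 gam_pr cc dd cd E1V E2V).
- exact: intertwined_fadd.
- exact: intertwined_fscale.
- exact: intertwined_nprod.
Qed.

Lemma Omega_bar_iso : module_iso (@Lk_action F p) Vold Vnew phi.
Proof.
split.
- split; [exact Vold0|exact Vold_lin|move=> a n v [b /Lk_action_intertwined ab] vV].
  exact (proj1 (ab n%:~R v vV)).
- split; [exact Vnew0|exact Vnew_lin|move=> b n v [a /Lk_action_intertwined ab] vV].
  (* Stability of the target is inherited from the source: v = phi (psi v), so b v is the image
     under phi of a vector of the source. *)
  have [uV e] := ab n%:~R _ (psi_Vnew vV).
  by rewrite (psiK vV) in e; rewrite -e; exact: (phi_Vold uV).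
- split; first by move=> v; exact: phi_Vold.
    move=> u v /set_mem uV /set_mem vV e.
    exact (etrans (esym (phiK uV)) (etrans (congr1 psi e) (phiK vV))).
  by move=> v vV; exists (psi v); [exact: psi_Vnew|exact: psiK].
- by move=> t u v _ _; exact: phi_lin.
- by move=> a b n v /Lk_action_intertwined ab vV; exact (proj2 (ab n%:~R v vV)).
Qed.

End Main.

Local Open Scope complex_scope.

Theorem theorem7p3 (R : realType) (p : nat) (hp : (2 <= p)%N) :
  module_iso (@Lk_action R[i] p) (@Vp R[i] p) (@Vp_new R[i] p)
    (@Omega_bar R[i] p).
Proof. exact: Omega_bar_iso. Qed.
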